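(* Let $b_0,\dots,b_m:\mathbb{R}\times\mathbb{R}^n\to\mathbb{R}^n$ and $u_1,\dots,u_m:\mathbb{R}\times\mathbb{R}\to\mathbb{R}$ satisfy Assumptions A1--A4 listed in the context. For $\omega\in(0,\infty)$ consider the input-affine system $$\dot x=b_0(t,x)+\sum_{i=1}^m b_i(t,x)\sqrt{\omega}\,u_i(t,\omega t)\qquad(\mathrm{IA}_\omega)$$ and its Lie bracket system $$\dot z=b_0(t,z)+\sum_{i=1}^m\sum_{j=i+1}^m[b_i,b_j](t,z)\,\nu_{ji}(t),\qquad \nu_{ji}(t)=\frac1T\int_0^T u_j(t,\theta)\int_0^\theta u_i(t,\tau)\,d\tau\,d\theta.\qquad(\mathrm{LB})$$ Suppose that a compact set $\mathcal{S}\subseteq\mathbb{R}^n$ is globally uniformly asymptotically stable for (LB). Then $\mathcal{S}$ is semi-globally practically uniformly asymptotically stable for $(\mathrm{IA}_\omega)$ (with respect to the parameter $\omega$).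
   Context: $|\cdot|$ is the Euclidean norm (with a corresponding norm for matrices). For vector fields $f,g:\mathbb{R}\times\mathbb{R}^n\to\mathbb{R}^n$ that are $C^1$ in $x$, the Lie bracket is $[f,g](t,x):=\frac{\partial g(t,x)}{\partial x}f(t,x)-\frac{\partial f(t,x)}{\partial x}g(t,x)$. Measurable means Lebesgue-measurable. A solution of $\dot x=f(t,x)$ through $x(t_0)=x_0$ is an absolutely continuous function with $x(t)=x_0+\int_{t_0}^t f(\tau,x(\tau))\,d\tau$ on the interval considered. For $\mathcal{S}\subseteq\mathbb{R}^n$ and $a\in(0,\infty)$, $\mathcal{U}_a^{\mathcal{S}}:=\{x\in\mathbb{R}^n:\inf_{y\in\mathcal{S}}|x-y|<a\}$. Assumptions: A1: $b_i\in C^2(\mathbb{R}\times\mathbb{R}^n;\mathbb{R}^n)$, $i=0,\dots,m$. A2: For every compact set $\mathcal{C}\subseteq\mathbb{R}^n$ there exist $A_1,\dots,A_6\in[0,\infty)$ such that $|b_i(t,x)|\le A_1$, $|\frac{\partial b_i(t,x)}{\partial t}|\le A_2$, $|\frac{\partial b_i(t,x)}{\partial x}|\le A_3$, $|\frac{\partial^2 b_j(t,x)}{\partial t\,\partial x}|\le A_4$, $|\frac{\partial[b_j,b_k](t,x)}{\partial x}|\le A_5$, $|\frac{\partial[b_j,b_k](t,x)}{\partial t}|\le A_6$ for all $x\in\mathcal{C}$, $t\in\mathbb{R}$, $i=0,\dots,m$, $j=1,\dots,m$, $k=j,\dots,m$. A3: $u_i:\mathbb{R}\times\mathbb{R}\to\mathbb{R}$,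 $i=1,\dots,m$, are measurable, and for every $i$ there exist $L_i,M_i\in(0,\infty)$ with $|u_i(t_1,\theta)-u_i(t_2,\theta)|\le L_i|t_1-t_2|$ for all $t_1,t_2,\theta\in\mathbb{R}$ and $\sup_{t,\theta\in\mathbb{R}}|u_i(t,\theta)|\le M_i$. A4: There is $T\in(0,\infty)$ such that for all $i=1,\dots,m$ and $t,\theta\in\mathbb{R}$: $u_i(t,\theta+T)=u_i(t,\theta)$ and $\int_0^T u_i(t,\tau)\,d\tau=0$. Stability notions for a family $\dot x=f_\omega(t,x)$, $\omega\in(0,\infty)$, and a compact set $\mathcal{S}\subseteq\mathbb{R}^n$: - $\mathcal{S}$ is practically uniformly stable if for every $\epsilon\in(0,\infty)$ there exist $\delta\in(0,\infty)$ and $\omega_0\in(0,\infty)$ such that for all $t_0\in\mathbb{R}$ and all $\omega\in(\omega_0,\infty)$: $x(t_0)\in\mathcal{U}_\delta^{\mathcal{S}}\Rightarrow x(t)\in\mathcal{U}_\epsilon^{\mathcal{S}}$ for $t\in[t_0,\infty)$. - For $\delta\in(0,\infty)$, $\mathcal{S}$ is $\delta$-practically uniformly attractive if for every $\epsilon\in(0,\infty)$ there exist $t_f\in[0,\infty)$ and $\omega_0\in(0,\infty)$ such that for all $t_0\in\mathbb{R}$ and all $\omega\in(\omega_0,\infty)$: $x(t_0)\in\mathcal{U}_\delta^{\mathcal{S}}\Rightarrow x(t)\in\mathcal{U}_\epsilon^{\mathcal{S}}$ for $t\in[t_0+t_f,\infty)$. - The solutions are practically uniformly bounded if for every $\delta\in(0,\infty)$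 there exist $\epsilon\in(0,\infty)$ and $\omega_0\in(0,\infty)$ such that for all $t_0\in\mathbb{R}$ and all $\omega\in(\omega_0,\infty)$: $x(t_0)\in\mathcal{U}_\delta^{\mathcal{S}}\Rightarrow x(t)\in\mathcal{U}_\epsilon^{\mathcal{S}}$ for $t\in[t_0,\infty)$. - $\mathcal{S}$ is semi-globally practically uniformly asymptotically stable if it is practically uniformly stable, for every $\delta\in(0,\infty)$ it is $\delta$-practically uniformly attractive, and the solutions are practically uniformly bounded. For a system independent of $\omega$ (such as (LB)), the words ''practically'' and ''semi-'' are dropped and the same definitions are used without $\omega$ and $\omega_0$ (giving ''globally uniformly asymptotically stable''). *)

(* Defs.v *)
From HB Require Import structures.
From mathcomp Require Import all_boot all_order all_algebra.
From mathcomp Require Import all_classical all_reals all_analysis.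
From mathcomp Require Import measurable_realfun.
Import Order.TTheory GRing.Theory Num.Theory.
Import numFieldNormedType.Exports.

Set Implicit Arguments.
Unset Strict Implicit.
Unset Printing Implicit Defensive.

Local Open Scope classical_set_scope.
Local Open Scope ring_scope.

(* Points of R^n are row vectors, as in the library's Jacobian: ['J f x] is the
   transpose of the usual matrix and acts by [v |-> v *m 'J f x].  The library
   norm on ['rV[R]_n] is the sup norm; it is used only through the topology it
   induces. *)

Section Norms.
Context {R : realType}.

Definition enorm n (x : 'rV[R]_n) : R := Num.sqrt (\sum_i x 0 i ^+ 2).

(* Operator norm for the Euclidean norm; it is invariant under transposition. *)
Definition opnorm n p (A : 'M[R]_(n, p)) : R :=
  sup [set enorm (v *m A) | v in [set v : 'rV[R]_n | enorm v <= 1]].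

(* The infimum is taken in the extended reals, so that the neighbourhoods of the
   empty set are empty. *)
Definition Unbhd n (S : set 'rV[R]_n) (a : R) : set 'rV[R]_n :=
  [set x | (ereal_inf [set (enorm (x - y))%:E | y in S] < a%:E)%E].

End Norms.

(* Intended for finite-dimensional [V], where continuity of the differential
   amounts to continuity of each directional derivative. *)
Definition C1 (R : realType) (V W : normedModType R) (f : V -> W) : Prop :=
  (forall p, differentiable f p) /\ (forall v, continuous (fun p => 'D_v f p)).

Definition C2 (R : realType) (V W : normedModType R) (f : V -> W) : Prop :=
  C1 f /\ (forall v, C1 (fun p => 'D_v f p)).

Section Measurability.
Context {R : realType}.

(* Lebesgue measurability on R x R: preimages of Borel sets belong to the
   completion of the Borel sigma-algebra of the plane for the product of the
   Lebesgue measures. *)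
Definition lebesgue_measurable_fun2 (f : R * R -> R) : Prop :=
  forall B : set R, measurable B ->
    completed_algebra_gen (@lebesgue_measure R \x @lebesgue_measure R)%E
      (f @^-1` B).

(* Integrals over a bounded interval of R are taken for the completed measure:
   the integrands are Lebesgue measurable, not necessarily Borel measurable. *)
Definition Lintegrable (a b : R) (f : R -> R) : Prop :=
  (@completed_lebesgue_measure R).-integrable `[a, b] (fun s => (f s)%:E).

Definition Lint (a b : R) (f : R -> R) : R :=
  \int[@completed_lebesgue_measure R]_(s in `[a, b]) f s.

End Measurability.

Section Solutions.
Context {R : realType} {n : nat}.
Implicit Types (f : R -> 'rV[R]_n -> 'rV[R]_n) (x : R -> 'rV[R]_n).

Definition abs_continuous (a b : R) x : Prop :=
  forall e : R, 0 < e -> exists2 d : R, 0 < d &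
    forall (k : nat) (l r : 'I_k -> R),
      (forall i, a <= l i /\ l i <= r i /\ r i <= b) ->
      (forall i j, i != j -> r i <= l j \/ r j <= l i) ->
      \sum_i (r i - l i) < d ->
      \sum_i enorm (x (r i) - x (l i)) < e.

(* [x] solves the equation with right-hand side [f] on the interval with left
   endpoint [t0] (included) and right bound [b] (included, excluded or +oo).
   Values of [x] outside the interval are irrelevant. *)
Definition solution f (t0 : R) (x0 : 'rV[R]_n) (b : itv_bound R) x : Prop :=
  forall t : R, t \in Interval (BLeft t0) b ->
    abs_continuous t0 t x /\
    (forall k, Lintegrable t0 t (fun s => f s (x s) 0 k)) /\
    x t = x0 + \row_k Lint t0 t (fun s => f s (x s) 0 k).

(* "x(t0) in U_d implies x(t) in U_e for all t >= s": from each initial value in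
   U_d some solution exists on all of [t0, +oo[, and all solutions, including
   those given on a shorter interval only, are in U_e from time s on. *)
Definition steers f (S : set 'rV[R]_n) (t0 d s e : R) : Prop :=
  forall x0 : 'rV[R]_n, Unbhd S d x0 ->
    (exists x, solution f t0 x0 +oo%O x) /\
    (forall b x, solution f t0 x0 b x ->
      forall t, t \in Interval (BLeft t0) b -> s <= t -> Unbhd S e (x t)).

Definition unif_stable f S : Prop :=
  forall e : R, 0 < e -> exists2 d : R, 0 < d &
    forall t0 : R, steers f S t0 d t0 e.

Definition unif_attractive (d : R) f S : Prop :=
  forall e : R, 0 < e -> exists2 tf : R, 0 <= tf &
    forall t0 : R, steers f S t0 d (t0 + tf) e.

Definition unif_bounded f S : Prop :=
  forall d : R, 0 < d -> exists2 e : R, 0 < e &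
    forall t0 : R, steers f S t0 d t0 e.

Definition globally_unif_asympt_stable f S : Prop :=
  [/\ unif_stable f S,
      forall d : R, 0 < d -> unif_attractive d f S
    & unif_bounded f S].

Implicit Types F : R -> R -> 'rV[R]_n -> 'rV[R]_n.

Definition pract_unif_stable F S : Prop :=
  forall e : R, 0 < e -> exists2 d : R, 0 < d & exists2 w0 : R, 0 < w0 &
    forall t0 w : R, w0 < w -> steers (F w) S t0 d t0 e.

Definition pract_unif_attractive (d : R) F S : Prop :=
  forall e : R, 0 < e -> exists2 tf : R, 0 <= tf & exists2 w0 : R, 0 < w0 &
    forall t0 w : R, w0 < w -> steers (F w) S t0 d (t0 + tf) e.

Definition pract_unif_bounded F S : Prop :=
  forall d : R, 0 < d -> exists2 e : R, 0 < e & exists2 w0 : R, 0 < w0 &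
    forall t0 w : R, w0 < w -> steers (F w) S t0 d t0 e.

Definition semiglobally_pract_unif_asympt_stable F S : Prop :=
  [/\ pract_unif_stable F S,
      forall d : R, 0 < d -> pract_unif_attractive d F S
    & pract_unif_bounded F S].

End Solutions.

Section Systems.
Context {R : realType} {n : nat}.
Implicit Types f g : R -> 'rV[R]_n -> 'rV[R]_n.

Definition lie f g : R -> 'rV[R]_n -> 'rV[R]_n :=
  fun t x => f t x *m 'J (g t) x - g t x *m 'J (f t) x.

Context {m : nat}.

(* The drift is [b ord0]; the input [u i], with i : 'I_m counted from 0, drives
   the vector field [bu b i := b (lift ord0 i)]. *)
Implicit Types (b : 'I_m.+1 -> R -> 'rV[R]_n -> 'rV[R]_n)
  (u : 'I_m -> R -> R -> R).

Definition bu b (i : 'I_m) : R -> 'rV[R]_n -> 'rV[R]_n := b (lift ord0 i).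

Definition assumption_A1 b : Prop :=
  forall i, C2 (fun p : R * 'rV[R]_n => b i p.1 p.2).

Definition assumption_A2 b : Prop :=
  forall C : set 'rV[R]_n, compact C ->
  exists A1 A2 A3 A4 A5 A6 : R,
    (0 <= A1 /\ 0 <= A2 /\ 0 <= A3 /\ 0 <= A4 /\ 0 <= A5 /\ 0 <= A6) /\
    forall (x : 'rV[R]_n) (t : R), C x ->
    [/\ forall i, [/\ enorm (b i t x) <= A1,
                      enorm (derive1 (fun s => b i s x) t) <= A2
                    & opnorm ('J (b i t) x) <= A3],
        forall j, opnorm (derive1 (fun s => 'J (bu b j s) x) t) <= A4
      & forall j k : 'I_m, (j <= k)%N ->
          opnorm ('J (lie (bu b j) (bu b k) t) x) <= A5 /\
          enorm (derive1 (fun s => lie (bu b j) (bu b k) s x) t) <= A6].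

Definition assumption_A3 u : Prop :=
  forall i,
    lebesgue_measurable_fun2 (fun p => u i p.1 p.2) /\
    exists L M : R, [/\ 0 < L, 0 < M,
      forall t1 t2 th, `|u i t1 th - u i t2 th| <= L * `|t1 - t2|
    & forall t th, `|u i t th| <= M].

Definition assumption_A4 u (T : R) : Prop :=
  forall i t,
    (forall th, u i t (th + T) = u i t th) /\ Lint 0 T (fun th => u i t th) = 0.

Definition input_affine b u (w : R) : R -> 'rV[R]_n -> 'rV[R]_n :=
  fun t x => b ord0 t x + \sum_i (Num.sqrt w * u i t (w * t)) *: bu b i t x.

Definition nu u (T : R) (j i : 'I_m) (t : R) : R :=
  T^-1 * Lint 0 T (fun th => u j t th * Lint 0 th (fun ta => u i t ta)).

Definition lie_bracket_system b u (T : R) : R -> 'rV[R]_n -> 'rV[R]_n :=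
  fun t z => b ord0 t z +
    \sum_(i < m) \sum_(j < m | (i < j)%N)
      nu u T j i t *: lie (bu b i) (bu b j) t z.

End Systems.

(* Main.v *)
Require Import Defs.
From HB Require Import structures.
From mathcomp Require Import all_boot all_order all_algebra.
From mathcomp Require Import all_classical all_reals all_analysis.
From mathcomp Require Import measurable_realfun ring lra.
Import Order.TTheory GRing.Theory Num.Theory.
Import numFieldNormedType.Exports.

(* Over one period, of length e = T/w, the slow time in the fields and the inputs can be frozen.
   The primitive v of the frozen fast input is O(w^(-1/2)) and returns to 0, so the time-one flow
   of sum_i v_i b_i is a closed curve; differentiating it in v shows that it follows the fast
   input up to the half brackets [b_j, b_i] v_i dv_j.  These are missing in (IA_w), so x drifts by
   the opposite of their integral, which by antisymmetry is the bracket part of (LB).  Hence a solution x of (IA_w) satisfies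
   |x(a + e) - x(a) - e LB(a, x(a))| <= D w^(-3/2), and summing O(w) such steps gives
   |x - z| = O(w^(-1/2)) on bounded time intervals.
   Assumption A2 bounds the brackets and their derivatives but not the second derivatives of the
   b_i, uniformly in time.  The time-one flow is therefore replaced by its Euler polygon with N
   steps: the second derivatives enter the error only through a term that vanishes as N grows,
   with N depending on the step considered.
   Tracking passes stability on to (IA_w): z re-enters a smaller neighbourhood within a fixed
   time, so x can be compared with a solution of (LB) restarted from x at the end of each window.
   Solutions of (IA_w) are obtained from the equation modified outside a large cube. *)

(** Solutions are only absolutely continuous and the inputs only measurable, so nothing is
    differentiated along a trajectory: increments are bounded with a quadratic remainder, which
    subdivision removes. Orders are counted in powers of h = w^(-1/2): a period has length O(h^2)
    and the speed is O(1/h), so x moves by O(h) within a period, while the error sought is O(h^3).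
    The closed reference curve P absorbs the O(h) oscillation; x - P is then estimated twice by one
    lemma, each pass gaining a factor h. The half in front of the brackets is the integral of r over
    [0, 1] in the second variation of the time-one flow. Joint Lebesgue measurability controls only
    almost every section of an input; Lipschitz dependence on slow time extends it to all sections
    and to the diagonal s -> u(s, w s). Any solution, even on a short interval, is compared with a
    solution of (LB) having the same initial value; uniqueness for (IA_w) is not invoked, and the
    thresholds on w do not depend on the initial time. *)

Set Implicit Arguments.
Unset Strict Implicit.
Unset Printing Implicit Defensive.
Local Open Scope classical_set_scope.
Local Open Scope ring_scope.

(** * Lebesgue integration over intervals *)

Section Leb.
Context {R : realType}.
Notation cmu := (@completed_lebesgue_measure R).
Notation lebT := (caratheodory_type (wlength (@idfun R))^*%mu).

Lemma leb_sub (A : set R) : measurable A -> @measurable _ lebT A.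
Proof. exact: sub_caratheodory. Qed.

Lemma leb_itv (a b : R) (x y : bool): @measurable _ lebT [set` Interval (BSide x a) (BSide y b)].
Proof. by apply: leb_sub; exact: measurable_itv. Qed.

Lemma cmu_itv (a b : R) : a <= b -> cmu `[a, b] = (b - a)%:E.
Proof.
(* Both measures are the same outer measure restricted to different sigma-algebras, so they agree by
   conversion. *)
move=> ab; transitivity (@lebesgue_measure R `[a, b]); first by [].
rewrite lebesgue_measure_itv /= lte_fin.
move: ab; rewrite le_eqVlt => /predU1P[->|ab]; first by rewrite ltxx subrr.
by rewrite ab -EFinB.
Qed.

Lemma LintD (a b : R) (f g : R -> R) : Lintegrable a b f -> Lintegrable a b g ->
  Lint a b (fun s => f s + g s) = Lint a b f + Lint a b g.
Proof. by move=> hf hg; apply: RintegralD => //; exact: leb_itv. Qed.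

Lemma LintegrableD (a b : R) (f g : R -> R) : Lintegrable a b f -> Lintegrable a b g ->
  Lintegrable a b (fun s => f s + g s).
Proof. by move=> hf hg; apply: (@integrableD _ _ _ cmu _ _ _ _ hf hg); exact: leb_itv. Qed.

Lemma LintZ (a b : R) (f : R -> R) (k : R) : Lintegrable a b f ->
  Lint a b (fun s => k * f s) = k * Lint a b f.
Proof. by move=> hf; apply: RintegralZl => //; exact: leb_itv. Qed.

Lemma LintegrableZ (a b : R) (f : R -> R) (k : R) : Lintegrable a b f ->
  Lintegrable a b (fun s => k * f s).
Proof. by move=> hf; apply: (@integrableZl _ _ _ cmu _ _ k _ hf); exact: leb_itv. Qed.

Lemma Lint_cst (a b c : R) : a <= b -> Lint a b (fun _ => c) = c * (b - a).
Proof.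
move=> ab; rewrite /Lint Rintegral_cst; last exact: leb_itv.
by congr (_ * _); exact: (congr1 fine (cmu_itv ab)).
Qed.

Lemma bounded_Lintegrable (a b M : R) (f : R -> R) :
  measurable_fun (T := lebT) `[a, b] f -> (forall s, a <= s <= b -> `|f s| <= M) ->
  Lintegrable a b f.
Proof.
move=> mf hM; apply: (@measurable_bounded_integrable _ _ _ cmu) => //.
- exact: leb_itv.
- have [ab|ba] := leP a b; first exact: (eq_ind_r (fun z => (z < +oo)%E) (ltry _) (cmu_itv ab)).
  by rewrite set_itv_ge ?measure0 ?ltry // bnd_simp -ltNge.
- exists M; split; first exact: num_real.
  by move=> x Mx s /=; rewrite in_itv /= => hs; apply: le_trans (ltW Mx); exact: hM.
Qed.

Lemma LintegrableS (a b s t : R) (f : R -> R) : a <= s -> t <= b ->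
  Lintegrable a b f -> Lintegrable s t f.
Proof.
move=> as_ tb hf; apply: integrableS hf; try exact: leb_itv.
by move=> x /=; rewrite !in_itv /= => /andP[h1 h2]; rewrite (le_trans as_) //= (le_trans h2).
Qed.

Lemma Lint_eq (a b : R) (f g : R -> R) : (forall s, a <= s <= b -> f s = g s) ->
  Lint a b f = Lint a b g.
Proof.
by move=> h; apply: eq_Rintegral => s; rewrite inE /= in_itv /=; exact: h.
Qed.

Lemma Lintegrable_eq (a b : R) (f g : R -> R) : (forall s, a <= s <= b -> f s = g s) ->
  Lintegrable a b f -> Lintegrable a b g.
Proof.
move=> h; apply: eq_integrable; first exact: leb_itv.
by move=> s; rewrite inE /= in_itv /= => hs; rewrite h.
Qed.

Lemma Lint_le (a b M : R) (f : R -> R) : a <= b -> Lintegrable a b f ->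
  (forall s, a <= s <= b -> `|f s| <= M) -> `|Lint a b f| <= M * (b - a).
Proof.
move=> ab hf hM; rewrite -Lint_cst //.
apply: le_trans (_ : \int[cmu]_(s in `[a, b]) `|f s| <= _).
  by apply: le_normr_Rintegral => //; exact: leb_itv.
apply: le_Rintegral.
- exact: leb_itv.
- exact: integrable_norm.
- apply: (@bounded_Lintegrable _ _ `|M|) => //.
- by move=> s /=; rewrite in_itv /=; exact: hM.
Qed.

Lemma Lint_point (a : R) (f : R -> R) : Lintegrable a a f -> Lint a a f = 0.
Proof.
move=> hf; rewrite /Lint /Rintegral.
have h1 : cmu `[a, a] = 0%E by rewrite -[RHS](congr1 EFin (subrr a)); exact: cmu_itv.
have h2 : measurable_fun (T := lebT) `[a, a] (EFin \o f) by case/integrableP : hf.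
exact: (congr1 fine (null_set_integral (leb_itv a a true false) h2 h1)).
Qed.

(** Both closed intervals on the right contain b; the second is exchanged for ]b, c], a singleton
    being null. *)
Lemma Lint_chasles (a b c : R) (f : R -> R) : a <= b -> b <= c -> Lintegrable a c f ->
  Lint a c f = Lint a b f + Lint b c f.
Proof.
move=> ab bc hf.
have E : `[a, c]%classic = `[a, b] `|` `]b, c] :> set R.
  by rewrite -itv_bndbnd_setU // bnd_simp.
have E' : `[b, c] `\` `[b, b] = `]b, c]%classic :> set R.
  apply/seteqP; split => x /=; rewrite !in_itv /=.
    move=> [/andP[h1 h2] h3]; rewrite h2 andbT lt_neqAle h1 andbT.
    by apply/eqP => h; apply: h3; rewrite h lexx.
  move=> /andP[h1 h2]; split; first by rewrite h2 andbT ltW.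
  by move=> /andP[_ h3]; move: h1; rewrite ltNge h3.
rewrite /Lint E Rintegral_setU.
- congr (_ + _); rewrite -E'; rewrite /Rintegral; congr fine; apply/esym.
  apply: negligible_integral.
  + exact: leb_itv.
  + exact: leb_itv.
  + exact: LintegrableS hf.
  + by rewrite -[RHS](congr1 EFin (subrr b)); exact: cmu_itv.
- exact: leb_itv.
- exact: leb_itv.
- by rewrite -E.
- apply/disj_setPS => y [/=]; rewrite !in_itv/= => /andP[_ yx] /andP[].
  by rewrite ltNge yx.
Qed.

(* Replaces the integration of derivatives: subdividing [a, b] makes the second-order
   term disappear. *)
Lemma increment_le (H : R -> R) (a b C K : R) : a <= b ->
  (forall s t, a <= s -> s <= t -> t <= b -> H t - H s <= (C + K * (t - s)) * (t - s)) ->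
  H b - H a <= C * (b - a).
Proof.
move=> ab hH.
have step (N : nat) : (0 < N)%N -> forall k : nat, (k <= N)%N ->
    H (a + k%:R * ((b - a) / N%:R)) - H a <=
    k%:R * ((C + K * ((b - a) / N%:R)) * ((b - a) / N%:R)).
  move=> N0; set d := (b - a) / N%:R.
  have N0' : 0 < N%:R :> R by rewrite ltr0n.
  have d0 : 0 <= d by rewrite divr_ge0 ?subr_ge0 // ltW.
  elim=> [_|k IH kN]; first by rewrite !mul0r addr0 subrr.
  have le1 : a <= a + k%:R * d by rewrite lerDl mulr_ge0.
  have E : a + k.+1%:R * d = a + k%:R * d + d by rewrite -natr1 mulrDl mul1r addrA.
  have le2 : a + k.+1%:R * d <= b.
    rewrite -lerBrDl /d mulrCA -[leRHS]mulr1 ler_wpM2l ?subr_ge0 //.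
    by rewrite ler_pdivrMr // mul1r ler_nat.
  have := hH _ _ le1 _ le2; rewrite {1}E lerDl => /(_ d0).
  have -> : a + k.+1%:R * d - (a + k%:R * d) = d by rewrite E addrC addKr.
  move=> h; have := IH (ltnW kN).
  have -> : k.+1%:R * ((C + K * d) * d) = k%:R * ((C + K * d) * d) + (C + K * d) * d.
    by rewrite -natr1 mulrDl mul1r.
  move: h; set p := (C + _) * _; lra.
apply/ler_addgt0Pr => e e0.
(* Over N equal steps the quadratic terms add up to at most |K| (b - a)^2 / N; N >= M makes this at
   most e. *)
pose M := `|K| * (b - a) ^+ 2 / e.
have [N hN] : exists N : nat, (0 < N)%N /\ M <= N%:R.
  exists (Num.truncn M).+1; split=> //; apply: ltW; exact: truncnS_gt.
case: hN => N0 MN.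
have N0' : 0 < N%:R :> R by rewrite ltr0n.
have := step N N0 N (leqnn N).
have -> : N%:R * ((b - a) / N%:R) = b - a by rewrite mulrC divfK // gt_eqF.
rewrite [a + _]addrC subrK => /le_trans; apply.
rewrite mulrCA (mulrC N%:R) divfK ?gt_eqF // mulrDl lerD2l.
rewrite -mulrA -[(b - a) / _ * _]mulrAC -expr2.
apply: le_trans (_ : `|K| * ((b - a) ^+ 2 / N%:R) <= _).
  by rewrite ler_wpM2r ?ler_norm // divr_ge0 ?sqr_ge0 // ltW.
by rewrite mulrA ler_pdivrMr // [e * _]mulrC -ler_pdivrMr.
Qed.

(** The scalar lemma applies to s -> |G s - G a|, whose increments are at most those of G in
    norm. *)
Lemma increment_bound (V : normedModType R) (G : R -> V) (a b C K : R) : a <= b ->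
  (forall s t, a <= s -> s <= t -> t <= b ->
     `|G t - G s| <= (C + K * (t - s)) * (t - s)) ->
  `|G b - G a| <= C * (b - a).
Proof.
move=> ab H.
have := @increment_le (fun s => `|G s - G a|) a b C K ab.
rewrite subrr normr0 subr0; apply=> s t as_ st tb.
apply: le_trans (H s t as_ st tb); rewrite lerBlDr.
by rewrite -[G t - G a](subrKA (G s)); exact: ler_normD.
Qed.

Lemma mxnorm_leP (n : nat) (x : 'rV[R]_n) (M : R) : 0 <= M ->
  (forall k, `|x 0 k| <= M) -> `|x| <= M.
Proof.
move=> M0 h; rewrite [leLHS]/Num.Def.normr /= mx_normrE; apply/bigmax_leP; split=> //= -[i j] _.
by rewrite /= ord1.
Qed.

Lemma coord_le_mxnorm (n : nat) (x : 'rV[R]_n) k : `|x 0 k| <= `|x|.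
Proof.
rewrite [leRHS]/Num.Def.normr /= mx_normrE.
exact: (le_bigmax _ (fun ij : 'I_1 * 'I_n => `|x ij.1 ij.2|) (0, k)).
Qed.

(** The componentwise integral that occurs in [solution]. *)
Definition VLint (n : nat) (a b : R) (f : R -> 'rV[R]_n) : 'rV[R]_n :=
  \row_k Lint a b (fun s => f s 0 k).

Definition VLintegrable (n : nat) (a b : R) (f : R -> 'rV[R]_n) : Prop :=
  forall k, Lintegrable a b (fun s => f s 0 k).

Section VLint.
Variable n : nat.
Implicit Types f g : R -> 'rV[R]_n.

Lemma VLintD a b f g : VLintegrable a b f -> VLintegrable a b g ->
  VLint a b (fun s => f s + g s) = VLint a b f + VLint a b g.
Proof.
move=> hf hg; apply/rowP => k; rewrite !mxE -LintD //.
by apply: Lint_eq => s _; rewrite mxE.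
Qed.

Lemma VLintegrableD a b f g : VLintegrable a b f -> VLintegrable a b g ->
  VLintegrable a b (fun s => f s + g s).
Proof.
move=> hf hg k; apply: Lintegrable_eq (LintegrableD (hf k) (hg k)) => s _.
by rewrite mxE.
Qed.

Lemma VLintZ a b f (c : R) : VLintegrable a b f ->
  VLint a b (fun s => c *: f s) = c *: VLint a b f.
Proof.
move=> hf; apply/rowP => k; rewrite !mxE -LintZ //.
by apply: Lint_eq => s _; rewrite mxE.
Qed.

Lemma VLintegrableZ a b f (c : R) : VLintegrable a b f ->
  VLintegrable a b (fun s => c *: f s).
Proof.
move=> hf k; apply: Lintegrable_eq (LintegrableZ c (hf k)) => s _.
by rewrite mxE.
Qed.

Lemma VLintegrableB a b f g : VLintegrable a b f -> VLintegrable a b g ->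
  VLintegrable a b (fun s => f s - g s).
Proof.
move=> hf /(VLintegrableZ (-1)) hg k.
by apply: Lintegrable_eq (VLintegrableD hf hg k) => s _; rewrite scaleN1r.
Qed.

Lemma VLintB a b f g : VLintegrable a b f -> VLintegrable a b g ->
  VLint a b (fun s => f s - g s) = VLint a b f - VLint a b g.
Proof.
move=> hf hg; rewrite -scaleN1r -VLintZ // -VLintD //; last exact: VLintegrableZ.
by apply/rowP => k; rewrite !mxE; apply: Lint_eq => s _; rewrite scaleN1r.
Qed.

Lemma VLint_eq a b f g : (forall s, a <= s <= b -> f s = g s) ->
  VLint a b f = VLint a b g.
Proof. by move=> h; apply/rowP => k; rewrite !mxE; apply: Lint_eq => s /h ->. Qed.

Lemma VLintegrable_eq a b f g : (forall s, a <= s <= b -> f s = g s) ->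
  VLintegrable a b f -> VLintegrable a b g.
Proof. by move=> h hf k; apply: Lintegrable_eq (hf k) => s /h ->. Qed.

Lemma VLintegrableS a b s t f : a <= s -> t <= b ->
  VLintegrable a b f -> VLintegrable s t f.
Proof. by move=> h1 h2 hf k; exact: LintegrableS (hf k). Qed.

Lemma VLint_chasles a b c f : a <= b -> b <= c -> VLintegrable a c f ->
  VLint a c f = VLint a b f + VLint b c f.
Proof. by move=> h1 h2 hf; apply/rowP => k; rewrite !mxE; exact: Lint_chasles. Qed.

Lemma VLint_point a f : VLintegrable a a f -> VLint a a f = 0.
Proof. by move=> hf; apply/rowP => k; rewrite !mxE; exact: Lint_point. Qed.

Lemma VLint_le a b M f : a <= b -> VLintegrable a b f ->
  (forall s, a <= s <= b -> `|f s| <= M) -> `|VLint a b f| <= M * (b - a).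
Proof.
move=> ab hf hM.
have M0 : 0 <= M by apply: le_trans (hM a _); rewrite ?lexx.
apply: mxnorm_leP => [|k]; first by rewrite mulr_ge0 ?subr_ge0.
rewrite mxE; apply: Lint_le => // s hs.
exact: le_trans (coord_le_mxnorm _ _) (hM _ hs).
Qed.

Lemma VLint_cst a b (c : 'rV[R]_n) : a <= b -> VLint a b (fun _ => c) = (b - a) *: c.
Proof. by move=> ab; apply/rowP => k; rewrite !mxE Lint_cst // mulrC. Qed.

End VLint.

End Leb.

Notation lebT R := (caratheodory_type (wlength (@idfun R))^*%mu).

(* Locked: [done] would otherwise split it and search for measurability proofs. *)
HB.lock Definition bmeas {R : realType} (a b : R) (f : R -> R) : Prop :=
  measurable_fun (T := lebT R) `[a, b] f /\
  exists M, forall s, a <= s <= b -> `|f s| <= M.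

Section BoundedMeasurable.
Context {R : realType}.
Implicit Types (a b c s t : R) (f g : R -> R).

Lemma bmeasP a b f : bmeas a b f <-> measurable_fun (T := lebT R) `[a, b] f /\
  exists M, forall s, a <= s <= b -> `|f s| <= M.
Proof. by rewrite bmeas.unlock. Qed.

Lemma bmeas_bound a b f : bmeas a b f -> exists M, forall s, a <= s <= b -> `|f s| <= M.
Proof. by case/bmeasP. Qed.

Lemma bmeas_Lintegrable a b f : bmeas a b f -> Lintegrable a b f.
Proof. by case/bmeasP=> mf [M hM]; exact: bounded_Lintegrable hM. Qed.

Lemma bmeasD a b f g : bmeas a b f -> bmeas a b g -> bmeas a b (fun s => f s + g s).
Proof.
case/bmeasP=> mf [M hM] /bmeasP[mg [N hN]]; apply/bmeasP; split; first exact: measurable_funD.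
exists (M + N) => s hs; apply: le_trans (ler_normD _ _) _.
by apply: lerD; [exact: hM|exact: hN].
Qed.

Lemma bmeasM a b f g : bmeas a b f -> bmeas a b g -> bmeas a b (fun s => f s * g s).
Proof.
case/bmeasP=> mf [M hM] /bmeasP[mg [N hN]]; apply/bmeasP; split; first exact: measurable_funM.
by exists (M * N) => s hs; rewrite normrM ler_pM //; [exact: hM|exact: hN].
Qed.

Lemma bmeas_cst a b c : bmeas a b (fun _ => c).
Proof. by apply/bmeasP; split; [exact: measurable_cst|exists `|c|]. Qed.

Lemma bmeasN a b f : bmeas a b f -> bmeas a b (fun s => - f s).
Proof.
move=> /(bmeasM (bmeas_cst a b (-1))); congr bmeas.
by apply/funext => s; rewrite mulN1r.
Qed.

Lemma bmeas_sum a b (I : Type) (r : seq I) (P : pred I) (F : I -> R -> R) :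
  (forall i, P i -> bmeas a b (F i)) -> bmeas a b (fun s => \sum_(i <- r | P i) F i s).
Proof.
move=> H; elim: r => [|i r IH].
  rewrite (_ : (fun _ => _) = fun _ => 0); first exact: bmeas_cst.
  by apply/funext => s; rewrite big_nil.
have [Pi|nPi] := boolP (P i).
  rewrite (_ : (fun _ => _) = fun s => F i s + \sum_(i <- r | P i) F i s).
    by apply: bmeasD => //; exact: H.
  by apply/funext => s; rewrite big_cons Pi.
rewrite (_ : (fun _ => _) = fun s => \sum_(i <- r | P i) F i s) //.
by apply/funext => s; rewrite big_cons (negbTE nPi).
Qed.

Lemma bmeasS a b s t f : a <= s -> t <= b -> bmeas a b f -> bmeas s t f.
Proof.
move=> as_ tb /bmeasP[mf [M hM]]; apply/bmeasP; split.
  apply: measurable_funS mf; first exact: leb_itv.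
  move=> x /=; rewrite !in_itv /= => /andP[h1 h2].
  by rewrite (le_trans as_) //= (le_trans h2).
exists M => x /andP[h1 h2]; apply: hM.
by rewrite (le_trans as_) //= (le_trans h2).
Qed.

Lemma bmeas_eq a b f g : (forall s, a <= s <= b -> f s = g s) -> bmeas a b f -> bmeas a b g.
Proof.
move=> h /bmeasP[mf [M hM]]; apply/bmeasP; split.
  by apply: eq_measurable_fun mf => s; rewrite inE /= in_itv /=; exact: h.
by exists M => s hs; rewrite -h //; exact: hM.
Qed.

Lemma Borel_bmeas (a b M : R) (f : R -> R) : measurable_fun `[a, b] f ->
  (forall s, a <= s <= b -> `|f s| <= M) -> bmeas a b f.
Proof.
move=> mf hM; apply/bmeasP; split; last by exists M.
by move=> _ B mB; apply: leb_sub; apply: mf => //; exact: measurable_itv.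
Qed.

(** Primitives of bounded functions and fields along Lipschitz curves enter the integrands through
    this criterion. No sign is assumed on K, hence |K| in the two-sided form. *)
Lemma bmeas_lip (a b K : R) (f : R -> R) :
  (forall s t, a <= s -> s <= t -> t <= b -> `|f t - f s| <= K * (t - s)) -> bmeas a b f.
Proof.
move=> H.
have [ab|ba] := leP a b; last first.
  apply/bmeasP; split; first by rewrite set_itv_ge ?bnd_simp -?ltNge //; exact: measurable_fun_set0.
  by exists 0 => s /andP[h1 h2]; have := le_trans h1 h2; rewrite leNgt ba.
have H' s t : a <= s <= b -> a <= t <= b -> `|f t - f s| <= `|K| * `|t - s|.
  move=> /andP[h1 h2] /andP[h3 h4].
  have K' (z : R) : 0 <= z -> K * z <= `|K| * z by move=> ?; rewrite ler_wpM2r ?ler_norm.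
  have [st|ts] := leP s t.
    by rewrite (ger0_norm (x := t - s)) ?subr_ge0 //; apply: le_trans (H _ _ _ _ _) (K' _ _); rewrite ?subr_ge0.
  rewrite distrC [`|t - s|]distrC (ger0_norm (x := s - t)) ?subr_ge0 ?(ltW ts) //.
  by apply: le_trans (H _ _ _ _ _) (K' _ _); rewrite ?subr_ge0 ?(ltW ts).
apply: (@Borel_bmeas _ _ (`|f a| + `|K| * (b - a))).
  apply: (subspace_continuous_measurable_fun (measurable_itv _)).
  apply/subspace_continuousP => x; rewrite /= in_itv /= => hx.
  apply/cvgrPdist_lt => e e0; rewrite near_withinE.
  have K1 : 0 < `|K| + 1 by rewrite ltr_wpDl.
  apply/nbhs_ballP; exists (e / (`|K| + 1)); first exact: divr_gt0.
  move=> y /= hy hy'; apply: le_lt_trans (H' _ _ _ hx) _; first by rewrite in_itv in hy'.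
  apply: le_lt_trans (_ : (`|K| + 1) * `|x - y| < _); first by rewrite ler_wpM2r // lerDl.
  by rewrite mulrC -ltr_pdivlMr.
move=> s hs; have -> : f s = f a + (f s - f a) by rewrite addrC subrK.
apply: le_trans (ler_normD _ _) _; rewrite lerD2l.
apply: le_trans (H' _ _ _ hs) _; first by rewrite lexx.
case/andP: hs => h1 h2.
by rewrite ler_wpM2l // ger0_norm ?subr_ge0 // lerD2r.
Qed.
End BoundedMeasurable.

(** * Change of variables and measurability of the inputs *)

Section Meas.
Context {R : realType}.
Notation cmu := (@completed_lebesgue_measure R).
Notation lebT := (caratheodory_type (wlength (@idfun R))^*%mu).
Notation lam := (@lebesgue_measure R).

Definition affine (w c : R) : R -> R := fun s => w * s + c.

Lemma affine_continuous (w c : R) : continuous (affine w c).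
Proof.
move=> x; apply: cvgD; last exact: cvg_cst.
by apply: cvgM; [exact: cvg_cst|exact: cvg_id].
Qed.

Lemma affine_Borel (w c : R) :
  measurable_fun (T := measurableTypeR R) (U := measurableTypeR R) setT (affine w c).
Proof. by apply: continuous_measurable_fun; exact: affine_continuous. Qed.

Let pushforward_measure_pack (w c : R) : {measure set (measurableTypeR R) -> \bar R} :=
  measure_function_pushforward__canonical__measure_function_Measure lam (affine_Borel w c).

(** The push-forward of the Lebesgue measure, rescaled by w, agrees with it on half-open intervals,
    and these determine it. *)
Lemma lebesgue_affine (w c : R) (A : set R) : 0 < w -> measurable A ->
  lam A = (w%:E * lam (affine w c @^-1` A))%E.
Proof.
move=> w0 mA.
pose p : {measure set (measurableTypeR R) -> \bar R} :=
  pushforward_measure_pack w c.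
pose m : {measure set (measurableTypeR R) -> \bar R} := [the measure _ _ of mscale (NngNum (ltW w0)) p].
rewrite (@lebesgue_measure_unique R m) //.
move=> _ [[x y] _ <-] /=.
rewrite /m /= /mscale /= /pushforward.
have -> : affine w c @^-1` `]x, y] = `](x - c) / w, (y - c) / w]%classic.
  apply/seteqP; split => z /=; rewrite !in_itv /= /affine ltr_pdivrMr // ler_pdivlMr //;
   by rewrite ltrBlDr lerBrDr mulrC.
rewrite !lebesgue_measure_itv /= !lte_fin ltr_pM2r ?invr_gt0 // ltrD2r.
case: ifP => _; last by rewrite mule0.
rewrite -!EFinB -EFinM; congr EFin.
by rewrite -mulrBl opprB addrA subrK mulrC divfK // gt_eqF.
Qed.

(** The form in which Lebesgue measurable sets are transported: the Borel part and the null part are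
    treated separately, both for affine preimages and for sections. *)
Lemma leb_gen (A : set R) : @measurable _ lebT A <->
  exists2 B, measurable B & exists2 N, lam.-negligible N & B `|` N = A.
Proof.
have := @completed_caratheodory_measurable R.
rewrite g_sigma_completed_algebra_genE => /seteqP[h1 h2]; split.
  by move=> /h2.
by move=> h; apply: h1.
Qed.

Lemma negligible_affine (w c : R) (N : set R) : 0 < w ->
  lam.-negligible N -> lam.-negligible (affine w c @^-1` N).
Proof.
move=> w0 [F [mF F0 NF]].
have mF' : measurable (affine w c @^-1` F).
  by rewrite -[X in measurable X]setTI; exact: affine_Borel.
exists (affine w c @^-1` F); split => //; last by move=> x; exact: NF.
move: F0; rewrite (@lebesgue_affine w c) // => /eqP.
by rewrite mule_eq0 eqe gt_eqF //= => /eqP.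
Qed.

Lemma leb_affine (w c : R) (A : set R) : 0 < w ->
  @measurable _ lebT A -> @measurable _ lebT (affine w c @^-1` A).
Proof.
move=> w0 /leb_gen[B mB [N nN <-]]; apply/leb_gen.
exists (affine w c @^-1` B).
  by rewrite -[X in measurable X]setTI; exact: affine_Borel.
by exists (affine w c @^-1` N) => //; exact: negligible_affine.
Qed.

Lemma cmu_gen (B N : set R) : measurable B -> lam.-negligible N -> cmu (B `|` N) = lam B.
Proof.
move=> mB [F [mF F0 NF]]; apply/eqP; rewrite eq_le; apply/andP; split.
  apply: le_trans (_ : lam (B `|` F) <= _)%E.
    by apply: le_outer_measure; exact: setUS.
  apply: le_trans (measureU2 _ _ _) _ => //.
  by have -> : (lam B + lam F = lam B)%E by rewrite F0 adde0.
by apply: le_outer_measure; exact: subsetUl.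
Qed.

Lemma cmu_affine (w c : R) (A : set R) : 0 < w -> @measurable _ lebT A ->
  cmu A = (w%:E * cmu (affine w c @^-1` A))%E.
Proof.
move=> w0 /leb_gen[B mB [N nN <-]].
rewrite preimage_setU !cmu_gen //; first exact: lebesgue_affine.
  by rewrite -[X in measurable X]setTI; exact: affine_Borel.
exact: negligible_affine.
Qed.

Lemma affine_leb (w c : R) : 0 < w ->
  measurable_fun (T := lebT) (U := lebT) setT (affine w c).
Proof. by move=> w0 _ B mB; rewrite setTI; exact: leb_affine. Qed.

Let cmu_pushforward (w c : R) (w0 : 0 < w) : {measure set lebT -> \bar R} :=
  measure_function_pushforward__canonical__measure_function_Measure cmu (affine_leb c w0).

(** The image of the completed measure under s -> w s + c is w^-1 times itself. The composition is
    measurable because preimages of null sets under this map are null. *)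
Lemma Lint_affine (w c a b : R) (f : R -> R) : 0 < w -> bmeas (w * a + c) (w * b + c) f ->
  bmeas a b (fun s => f (w * s + c)) /\
  Lint a b (fun s => f (w * s + c)) = w^-1 * Lint (w * a + c) (w * b + c) f.
Proof.
move=> w0 hf.
set D : set R := `[w * a + c, w * b + c]%classic.
have E : affine w c @^-1` D = `[a, b]%classic.
  apply/seteqP; split => z /=; rewrite /D /= !in_itv /= /affine !lerD2r !ler_pM2l //.
have hfc : bmeas a b (fun s => f (w * s + c)).
  case/bmeasP: hf => mf [M hM]; apply/bmeasP; split; last first.
    by exists M => s /andP[h1 h2]; apply: hM; rewrite !lerD2r !ler_pM2l // h1.
  move=> _ B mB; rewrite -E.
  exact: (@leb_affine w c (D `&` f @^-1` B) w0 (mf (leb_itv _ _ _ _) B mB)).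
split=> //.
have hD : cmu.-integrable D (EFin \o f) := bmeas_Lintegrable hf.
(* f is measurable on D only; extended by 0 it is measurable on the whole line. *)
pose g := (EFin \o f) \_ D.
have mD : @measurable _ lebT D by exact: leb_itv.
have mg : measurable_fun (T := lebT) setT g.
  by apply/(measurable_restrictT _ mD); case/integrableP : hD.
pose p := cmu_pushforward c w0.
have wi : 0 <= w^-1 by rewrite invr_ge0 ltW.
have key : (\int[p]_(y in D) g y = \int[mscale (NngNum wi) cmu]_(y in D) g y)%E.
  apply: eq_measure_integral => B mB _; rewrite /p /= /pushforward /mscale.
  have h := cmu_affine c w0 mB.
  transitivity ((w^-1)%:E * (w%:E * cmu (affine w c @^-1` B)))%E.
    by rewrite muleA -EFinM mulVf ?gt_eqF // mul1e.
  by congr (_ * _)%E; exact: esym h.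
have gD x : D x -> g x = (f x)%:E by move=> Dx; rewrite /g patchE mem_set.
have scale : (\int[mscale (NngNum wi) cmu]_(y in D) g y = (w^-1)%:E * \int[cmu]_(y in D) g y)%E.
  (* The rescaling of a measure is available for nonnegative integrands, so positive and negative
     parts are treated separately. *)
  have mgD : measurable_fun (T := lebT) D g by exact: measurable_funTS.
  have hg : cmu.-integrable D g.
    by apply: eq_integrable hD => // x /set_mem /gD.
  rewrite [LHS]integralE [X in _ = (_ * X)%E]integralE.
  rewrite (ge0_integral_mscale _ mD (NngNum wi) (measurable_funepos mgD)) //.
  rewrite (ge0_integral_mscale _ mD (NngNum wi) (measurable_funeneg mgD)) //.
  apply/esym/muleBr => //; apply: fin_num_adde_defl.
  rewrite fin_numN; apply: integrable_fin_num => //.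
  exact: integrable_funeneg.
rewrite /Lint /Rintegral -/D.
transitivity (fine (\int[p]_(y in D) g y)%E); last first.
  rewrite key scale fineM //; last first.
    by apply: integral_fune_fin_num => //; apply: eq_integrable hD => // x /set_mem /gD.
  congr (_ * fine _); apply: eq_integral => x /set_mem /gD //.
congr fine; rewrite /p /= integral_pushforward //.
- rewrite -E; apply: eq_integral => x /set_mem hx /=; rewrite gD //.
- exact: affine_leb.
- rewrite E; apply: eq_integrable (bmeas_Lintegrable hfc) => //; first exact: leb_itv.
  by move=> x /set_mem; rewrite -E => hx /=; rewrite gD.
Qed.

Lemma leb_fun_ray (f : R -> R) :
  (forall x : R, @measurable _ lebT [set s | x < f s]) -> measurable_fun (T := lebT) setT f.
Proof.
move=> H; apply: (measurability _ (RGenOInfty.measurableE R)) => //.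
move=> _ [_ [x ->] <-]; rewrite setTI.
rewrite (_ : f @^-1` _ = [set s | x < f s]) //.
by apply/seteqP; split => s; rewrite /= in_itv /= andbT.
Qed.

Lemma negligible_dense (N : set R) (t e : R) : 0 < e -> lam.-negligible N ->
  exists2 s, `|s - t| < e & ~ N s.
Proof.
move=> e0 nN; apply: contrapT => H.
have sub : `](t - e), (t + e)[ `<=` N.
  move=> s /= hs; apply: contrapT => Ns; apply: H; exists s => //.
  by move: hs; rewrite in_itv /= ltr_distl.
have /(negligibleP lam (measurable_itv _)) : lam.-negligible `](t - e), (t + e)[ by exact: negligibleS nN.
move=> h; have := etrans (esym (lebesgue_measure_itv `](t - e), (t + e)[)) h.
apply/eqP; rewrite /= lte_fin.
have -> : t - e < t + e by rewrite ltrD2l gt0_cp.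
rewrite -EFinB eqe gt_eqF // opprD opprK addrACA subrr add0r.
exact: addr_gt0.
Qed.

Variable u : R -> R -> R.
Hypothesis mu_ : lebesgue_measurable_fun2 (fun p => u p.1 p.2).

(** The preimage is A together with a subset N of a null product-measurable set F. By Tonelli almost
    every section of F is null, and for such t the section of N is negligible. *)
Lemma ae_section_measurable (B : set R) : measurable B ->
  exists2 N, lam.-negligible N & forall t, ~ N t -> @measurable _ lebT [set th | B (u t th)].
Proof.
move=> mB; have [A mA [N [F [mF F0 NF]] AN]] := mu_ mB.
have mx := @measurable_fun_xsection _ _ _ _ R lam F mF.
have Fint : (\int[lam]_x `|(lam \o xsection F) x| = 0)%E.
  by rewrite -[RHS]F0; apply: eq_integral => x _; rewrite gee0_abs.
have nN := (ae_eq_integral_abs lam measurableT mx).1 Fint.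
exists (~` [set t | lam (xsection F t) = 0%E]).
  by apply: negligibleS nN => t /= h h'; apply: h; exact: h'.
move=> t /contrapT /= Ft0; apply/leb_gen.
exists (xsection A t); first exact: measurable_xsection.
exists (xsection N t).
  exists (xsection F t); split=> //; first exact: measurable_xsection.
  by move=> y; rewrite /xsection /= !inE; exact: NF.
apply/seteqP; split => y /=.
  rewrite /xsection /= !inE => h.
  by have : (A `|` N) (t, y) by []; rewrite AN.
move=> Bu; have : (A `|` N) (t, y) by rewrite AN.
by rewrite /xsection /= !inE.
Qed.

Variable L : R.
Hypothesis uL : forall t1 t2 th, `|u t1 th - u t2 th| <= L * `|t1 - t2|.

Let L0 : 0 <= L.
Proof. by have := uL 1 0 0; rewrite subr0 normr1 mulr1; exact: le_trans. Qed.

(** Of the two terms L / k.+1, one raises the level in the approximating sets and the other pays for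
    moving the first argument by 1 / k.+1. *)
Let near_lev (x d : R) : x < d -> exists k : nat, x + (L + L) / k.+1%:R < d.
Proof.
move=> xd; pose M := (L + L) / (d - x).
exists (Num.truncn M); rewrite -ltrBrDl ltr_pdivrMr // mulrC -ltr_pdivrMr ?subr_gt0 //.
exact: truncnS_gt.
Qed.

(** Good sections are dense, the exceptional set being null. By the Lipschitz property, the set
    where u t exceeds x is the union over k of the sets where u (s k) exceeds the level x + L /
    k.+1, with s k a good time within 1 / k.+1 of t. *)
Lemma section_measurable (t : R) : measurable_fun (T := lebT) setT (u t).
Proof.
apply: leb_fun_ray => x.
have H (k : nat) : exists s, `|s - t| < k.+1%:R^-1 /\
    @measurable _ lebT [set th | x + L / k.+1%:R < u s th].
  have [N nN hN] := @ae_section_measurable `]x + L / k.+1%:R, +oo[ (measurable_itv _).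
  have [s s1 s2] := @negligible_dense N t k.+1%:R^-1 ltac:(by rewrite invr_gt0) nN.
  exists s; split=> //; have := hN s s2; congr measurable.
  by apply/seteqP; split => th; rewrite /= in_itv /= andbT.
have [s hs] := choice H.
have -> : [set th | x < u t th] = \bigcup_k [set th | x + L / k.+1%:R < u (s k) th].
  apply/seteqP; split => th /=.
    move=> /near_lev[k hk]; exists k => //=.
    have h1 : L * `|t - s k| <= L / k.+1%:R by rewrite ler_wpM2l // distrC ltW //; case: (hs k).
    have := le_trans (uL t (s k) th) h1; rewrite ler_distl => /andP[_].
    move: hk; rewrite mulrDl; set d := L / _; lra.
  move=> [k _ /=] hk.
  have h1 : L * `|t - s k| <= L / k.+1%:R by rewrite ler_wpM2l // distrC ltW //; case: (hs k).
  have := le_trans (uL t (s k) th) h1; rewrite ler_distl => /andP[+ _].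
  move: hk; set d := L / _; lra.
by apply: bigcupT_measurable => k; case: (hs k).
Qed.

(** The argument for sections is repeated with the first variable frozen at the left end of each
    cell of a grid of mesh 1 / k.+1; on a cell the function of s is a fixed section composed with s
    -> w s. *)
Lemma diagonal_measurable (w : R) : 0 < w ->
  measurable_fun (T := lebT) setT (fun s => u s (w * s)).
Proof.
move=> w0; apply: leb_fun_ray => x.
(* The pairs (j, sg) enumerate the integers, so that the union over the grid is countable. *)
pose g (j k : nat) (sg : bool) : R := (-1) ^+ sg * j%:R / k.+1%:R.
pose F k (p : nat * bool) : set R :=
  [set s | g p.1 k p.2 <= s < g p.1 k p.2 + k.+1%:R^-1] `&`
  [set s | x + L / k.+1%:R < u (g p.1 k p.2) (w * s)].
have mF k p : @measurable _ lebT (F k p).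
  apply: measurableI.
    have := leb_itv (g p.1 k p.2) (g p.1 k p.2 + k.+1%:R^-1) true true.
    by congr measurable; apply/seteqP; split => s; rewrite /= in_itv.
  have := section_measurable (g p.1 k p.2) measurableT (measurable_itv `]x + L / k.+1%:R, +oo[).
  move=> /(leb_affine 0 w0); rewrite setTI; congr measurable.
  by apply/seteqP; split => s; rewrite /= in_itv /= andbT /affine addr0.
have E (k : nat) s : exists p : nat * bool, g p.1 k p.2 <= s < g p.1 k p.2 + k.+1%:R^-1.
  have k0 : 0 < k.+1%:R :> R by [].
  pose z := Num.floor (s * k.+1%:R).
  have hz : (z%:~R : R) <= s * k.+1%:R < z%:~R + 1.
    by rewrite floor_le /= -[_ + 1]intrD1 floorD1_gt.
  exists (absz z, (z < 0)); rewrite /g /=.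
  have -> : (-1) ^+ (z < 0)%R * (absz z)%:R = z%:~R :> R.
    by rewrite [in RHS](intEsign z) intrM rmorph_sign.
  rewrite ler_pdivrMr // -[X in _ / _ + X]mul1r -mulrDl ltr_pdivlMr //.
have -> : [set s | x < u s (w * s)] = \bigcup_k \bigcup_p F k p.
  apply/seteqP; split => s /=.
    move=> /near_lev[k hk]; exists k => //; have [p hp] := E k s; exists p => //.
    split=> //=; set r := g _ _ _ in hp *.
    have h1 : L * `|s - r| <= L / k.+1%:R.
      rewrite ler_wpM2l // ger0_norm ?subr_ge0; case/andP: hp => // h1 h2.
      by rewrite lerBlDl ltW.
    have := le_trans (uL s r (w * s)) h1; rewrite ler_distl => /andP[_].
    move: hk; rewrite mulrDl; set d := L / _; lra.
  move=> [k _ [p _ [/= hp]]]; set r := g _ _ _ in hp *.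
  have h1 : L * `|s - r| <= L / k.+1%:R.
    rewrite ler_wpM2l // ger0_norm ?subr_ge0; case/andP: hp => // h1 h2.
    by rewrite lerBlDl ltW.
  have := le_trans (uL s r (w * s)) h1; rewrite ler_distl => /andP[+ _].
  set d := L / _; lra.
apply: bigcupT_measurable => k; apply: countable_bigcupT_measurable => //.
Qed.

End Meas.

(** * Integrals of periodic functions *)

Section Periodic.
Context {R : realType}.
Implicit Types (f g : R -> R) (a b c T : R).

Lemma LintB a b f g : Lintegrable a b f -> Lintegrable a b g ->
  Lint a b (fun s => f s - g s) = Lint a b f - Lint a b g.
Proof.
move=> hf hg; rewrite -[X in _ = _ + X]mulN1r -LintZ // -LintD //; last exact: LintegrableZ.
by apply: Lint_eq => s _; rewrite mulN1r.
Qed.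

Lemma primitive_lip a b M f : bmeas a b f -> (forall s, a <= s <= b -> `|f s| <= M) ->
  forall s t, a <= s -> s <= t -> t <= b -> `|Lint a t f - Lint a s f| <= M * (t - s).
Proof.
move=> hf hM s t as_ st tb.
have hfi := bmeas_Lintegrable hf.
rewrite (@Lint_chasles _ a s t) //; last exact: LintegrableS hfi.
rewrite addrC addKr; apply: Lint_le => //; first exact: LintegrableS hfi.
move=> x /andP[h1 h2]; apply: hM.
by rewrite (le_trans as_ h1) (le_trans h2 tb).
Qed.

Lemma primitive_bmeas a b f : bmeas a b f -> bmeas a b (fun s => Lint a s f).
Proof.
move=> hf; have [M hM] := bmeas_bound hf.
exact: (bmeas_lip (K := M) (primitive_lip hf hM)).
Qed.

Lemma primitive_bound a b M f s : bmeas a b f -> (forall s, a <= s <= b -> `|f s| <= M) ->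
  a <= s <= b -> `|Lint a s f| <= M * (s - a).
Proof.
move=> hf hM /andP[h1 h2]; have := primitive_lip hf hM (lexx a) h1 h2.
rewrite Lint_point ?subr0 //; apply: bmeas_Lintegrable; apply: bmeasS hf => //.
exact: le_trans h2.
Qed.

(** The product of the primitives is not differentiated: the difference H of the two sides, as a
    function of the upper bound, has quadratic increments and is therefore constant. *)
Lemma integration_by_parts_Lint a b f g : a <= b -> bmeas a b f -> bmeas a b g ->
  Lint a b (fun s => f s * Lint a s g) + Lint a b (fun s => g s * Lint a s f) =
  Lint a b f * Lint a b g.
Proof.
move=> ab hf hg; have [M hM] := bmeas_bound hf; have [N hN] := bmeas_bound hg.
have hF := primitive_bmeas hf; have hG := primitive_bmeas hg.
have M0 : 0 <= M by apply: le_trans (hM a _); rewrite ?lexx.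
have N0 : 0 <= N by apply: le_trans (hN a _); rewrite ?lexx.
pose h s := f s * Lint a s g + g s * Lint a s f.
have hh : bmeas a b h by apply: bmeasD; apply: bmeasM.
rewrite -LintD; try by apply: bmeas_Lintegrable; apply: bmeasM.
pose H s := Lint a s h - Lint a s f * Lint a s g.
suff : `|H b - H a| <= 0 * (b - a).
  rewrite mul0r normr_le0 /H !Lint_point; first 1 last.
  - by apply: bmeas_Lintegrable; apply: bmeasS hg.
  - by apply: bmeas_Lintegrable; apply: bmeasS hf.
  - by apply: bmeas_Lintegrable; apply: bmeasS hh.
  by rewrite mulr0 subr0 subr0 subr_eq0 => /eqP.
(* In the constant 3 M N, two units come from the variation of the primitives inside the integral
   over [s, t] and one from the product df dg. *)
apply: (@increment_bound _ _ _ _ _ _ (3 * M * N)) => // s t as_ st tb.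
rewrite add0r.
have sub (q : R -> R) : bmeas a b q -> bmeas s t q by apply: bmeasS.
have itg (q : R -> R) : bmeas a b q -> Lintegrable a t q.
  by move=> hq; apply: bmeas_Lintegrable; apply: bmeasS hq.
rewrite /H !(@Lint_chasles _ a s t) //; try exact: itg.
set Fs := Lint a s f; set Gs := Lint a s g; set df := Lint s t f; set dg := Lint s t g.
have dfM : `|df| <= M * (t - s).
  apply: Lint_le => //; first exact/bmeas_Lintegrable/sub.
  by move=> x /andP[h1 h2]; apply: hM; rewrite (le_trans as_ h1) (le_trans h2 tb).
have dgN : `|dg| <= N * (t - s).
  apply: Lint_le => //; first exact/bmeas_Lintegrable/sub.
  by move=> x /andP[h1 h2]; apply: hN; rewrite (le_trans as_ h1) (le_trans h2 tb).
have -> : Lint a s h + Lint s t h - (Fs + df) * (Gs + dg) - (Lint a s h - Fs * Gs) =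
   (Lint s t h - (Gs * df + Fs * dg)) - df * dg by ring.
have E : Lint s t h - (Gs * df + Fs * dg) =
   Lint s t (fun x => f x * (Lint a x g - Gs) + g x * (Lint a x f - Fs)).
  rewrite /df /dg -!LintZ -?LintD -?LintB //; try by
    apply: bmeas_Lintegrable; repeat first [exact: sub | apply: bmeasD | apply: bmeasM
       | exact: bmeas_cst].
  by apply: Lint_eq => x _; rewrite /h; ring.
rewrite E; apply: le_trans (ler_normB _ _) _.
have -> : 3 * M * N * (t - s) * (t - s) = (2 * M * N * (t - s)) * (t - s) + (M * (t - s)) * (N * (t - s)).
  ring.
apply: lerD; last by rewrite normrM; apply: ler_pM.
apply: Lint_le => //.
  apply: bmeas_Lintegrable; apply: bmeasD; apply: bmeasM; try exact: sub;
  apply: bmeasD; try exact: sub; apply: bmeas_cst.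
move=> x /andP[sx xt]; have xb := le_trans xt tb; have ax := le_trans as_ sx.
apply: le_trans (ler_normD _ _) _; rewrite !normrM.
have fx : `|f x| <= M by apply: hM; rewrite ax xb.
have gx : `|g x| <= N by apply: hN; rewrite ax xb.
have h1 : `|Lint a x g - Gs| <= N * (t - s).
  apply: le_trans (primitive_lip hg hN as_ sx xb) _.
  by rewrite ler_wpM2l // lerB.
have h2 : `|Lint a x f - Fs| <= M * (t - s).
  apply: le_trans (primitive_lip hf hM as_ sx xb) _.
  by rewrite ler_wpM2l // lerB.
have -> : 2 * M * N * (t - s) = M * (N * (t - s)) + N * (M * (t - s)) by ring.
by apply: lerD; apply: ler_pM.
Qed.

Lemma Lint_shift c a b f : bmeas (a + c) (b + c) f ->
  bmeas a b (fun s => f (s + c)) /\ Lint a b (fun s => f (s + c)) = Lint (a + c) (b + c) f.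
Proof.
have := @Lint_affine R 1 c a b f ltr01; rewrite !mul1r invr1 mul1r.
move=> H /H[h1 h2]; split.
  by apply: bmeas_eq h1 => s _; rewrite mul1r.
by rewrite -h2; apply: Lint_eq => s _; rewrite mul1r.
Qed.

Lemma Lint_period_pos T c f : 0 < T -> 0 <= c -> (forall a b, 0 <= a -> bmeas a b f) ->
  (forall s, 0 <= s -> f (s + T) = f s) -> Lint c (c + T) f = Lint 0 T f.
Proof.
move=> T0 c0 mf per.
have h1 : Lint 0 (c + T) f = Lint 0 c f + Lint c (c + T) f.
  by apply: Lint_chasles; rewrite ?lerDl ?(ltW T0) //; exact/bmeas_Lintegrable/mf.
have h2 : Lint 0 (c + T) f = Lint 0 T f + Lint T (c + T) f.
  by apply: Lint_chasles; rewrite ?lerDr ?(ltW T0) //; exact/bmeas_Lintegrable/mf.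
have mfT : bmeas (0 + T) (c + T) f by apply: mf; rewrite add0r ltW.
have [_ h3] := @Lint_shift T 0 c f mfT.
have h4 : Lint 0 c (fun s => f (s + T)) = Lint 0 c f.
  by apply: Lint_eq => s /andP[s0 _]; exact: per.
move: h3; rewrite add0r h4 => h3.
by apply: (addrI (Lint 0 c f)); rewrite -h1 h2 h3 addrC.
Qed.

Section Mean0.
Variables (T : R) (f g : R -> R).
Hypothesis T0 : 0 < T.
Hypotheses (mf : forall a b, bmeas a b f) (mg : forall a b, bmeas a b g).
Hypotheses (pf : forall s, f (s + T) = f s) (pg : forall s, g (s + T) = g s).
Hypotheses (f0 : Lint 0 T f = 0) (g0 : Lint 0 T g = 0).

(** [Lint] is 0 when its bounds are reversed, so primitives started at 0 are useful only on the
    right; other starting points are moved there by whole periods. *)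
Let reach_nonneg c : exists k : nat, 0 <= c + k%:R * T.
Proof.
exists (Num.truncn (- c / T)).+1.
have /ltW := truncnS_gt (- c / T); rewrite ler_pdivrMr //; lra.
Qed.

Lemma Lint_period c : Lint c (c + T) f = Lint 0 T f.
Proof.
have [k] := reach_nonneg c.
elim: k c => [|k IH] c.
  by rewrite mul0r addr0 => c0; apply: Lint_period_pos.
move=> H; rewrite -[RHS](IH (c + T)); last by move: H; rewrite -natr1; lra.
have [_ <-] := @Lint_shift T c (c + T) f (mf _ _).
by apply: Lint_eq => s _; rewrite pf.
Qed.

(** Moving the base point of the inner primitive changes it by a constant, which the zero mean of g
    removes; the zero mean of f makes the primitive itself periodic. *)
Lemma iterated_Lint_period c :
  Lint c (c + T) (fun s => g s * Lint c s f) = Lint 0 T (fun s => g s * Lint 0 s f).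
Proof.
have mgF a b : bmeas a b (fun s => g s * Lint a s f).
  by apply: bmeasM => //; exact: primitive_bmeas.
have [k] := reach_nonneg c.
elim: k c => [|k IH] c; last first.
  move=> H; rewrite -[RHS](IH (c + T)); last by move: H; rewrite -natr1; lra.
  have [_ <-] := @Lint_shift T c (c + T) _ (mgF _ _).
  apply: Lint_eq => s _; rewrite pg; congr (_ * _).
  have [_ <-] := @Lint_shift T c s f (mf _ _).
  by apply: Lint_eq => x _; rewrite pf.
rewrite mul0r addr0 => c0.
pose F s := Lint 0 s f.
have mF a b : 0 <= a -> bmeas a b F.
  by move=> a0; apply: (bmeasS a0 (lexx b)); exact: primitive_bmeas.
have split_F s : c <= s -> F s = F c + Lint c s f.
  by move=> cs; apply: Lint_chasles => //; exact/bmeas_Lintegrable.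
have -> : Lint c (c + T) (fun s => g s * Lint c s f) =
   Lint c (c + T) (fun s => g s * F s - F c * g s).
  by apply: Lint_eq => s /andP[cs _]; rewrite (split_F s cs); ring.
have mgF' a b : 0 <= a -> bmeas a b (fun s => g s * F s) by move=> a0; apply: bmeasM => //; exact: mF.
rewrite LintB; last 2 first.
- by apply: bmeas_Lintegrable; exact: mgF'.
- by apply/LintegrableZ/bmeas_Lintegrable.
rewrite LintZ; last exact: bmeas_Lintegrable.
rewrite (@Lint_period_pos T c g) // g0 mulr0 subr0.
apply: Lint_period_pos => // s s0; rewrite pg; congr (_ * _).
rewrite /F (@Lint_chasles _ 0 T (s + T)) ?lerDr ?(ltW T0) //; last exact: bmeas_Lintegrable.
rewrite f0 add0r -[X in Lint X _ _](add0r T).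
have [_ <-] := @Lint_shift T 0 s f (mf _ _).
by apply: Lint_eq => x _; rewrite pf.
Qed.

Lemma Lint_fast_mean0 (w a : R) : 0 < w -> Lint a (a + T / w) (fun s => f (w * s)) = 0.
Proof.
move=> w0; have [_ h] := @Lint_affine _ w 0 a (a + T / w) f w0 (mf _ _).
transitivity (Lint a (a + T / w) (fun s => f (w * s + 0))).
  by apply: Lint_eq => s _; rewrite addr0.
rewrite h !addr0 mulrDr [w * (T / w)]mulrC divfK ?gt_eqF //.
by rewrite Lint_period f0 mulr0.
Qed.

(** Each of the two integrations contributes w^-1. Together with the factor w of two amplitudes sqrt
    w, this leaves (T / w) times the coefficient nu. *)
Lemma Lint_fast_bracket (w a : R) : 0 < w ->
  Lint a (a + T / w) (fun s => g (w * s) * Lint a s (fun x => f (w * x))) =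
  w^-1 * (w^-1 * Lint 0 T (fun s => g s * Lint 0 s f)).
Proof.
move=> w0.
have mgF a' b' : bmeas a' b' (fun s => g s * Lint a' s f).
  by apply: bmeasM => //; exact: primitive_bmeas.
have [h1 h2] := @Lint_affine _ w 0 a (a + T / w) _ w0 (mgF (w * a + 0) (w * (a + T / w) + 0)).
transitivity (Lint a (a + T / w) (fun s => w^-1 * (g (w * s + 0) * Lint (w * a + 0) (w * s + 0) f))).
  apply: Lint_eq => s _.
  have [_ h3] := @Lint_affine _ w 0 a s f w0 (mf _ _).
  have -> : Lint a s (fun x => f (w * x)) = Lint a s (fun x => f (w * x + 0)).
    by apply: Lint_eq => x _; rewrite addr0.
  rewrite h3 !addr0; ring.
rewrite LintZ; last exact: bmeas_Lintegrable.
rewrite h2 !addr0 mulrDr [w * (T / w)]mulrC divfK; last by rewrite gt_eqF.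
by rewrite iterated_Lint_period.
Qed.
End Mean0.
End Periodic.

(** * Second variation of Euler polygons *)

Ltac vring := apply/rowP => ?; rewrite !mxE; ring.

Section Polygon.
Context {R : realType} {W : normedModType R} {n : nat}.
Notation V := 'rV[R]_n.
(** [X v] is the field with control value v and [DX v y] stands for its differential at y. Two
    constants are kept apart: c bounds what is controlled uniformly in time, while K comes from
    second derivatives and may only multiply quantities that can be made arbitrarily small. *)
Variables (X : W -> V -> V) (DX : W -> V -> V -> V) (x0 : V) (r0 c K : R).
Let near_x0 (y : V) : Prop := `|y - x0| <= r0.
Hypotheses (c1 : 1 <= c) (K0 : 0 <= K).
Hypothesis X_add : forall v w y, X (v + w) y = X v y + X w y.
Hypothesis DX_add : forall v y z z', DX v y (z + z') = DX v y z + DX v y z'.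
Hypothesis DX_scale : forall v y (a : R) z, DX v y (a *: z) = a *: DX v y z.
Hypothesis X_bound : forall v y, near_x0 y -> `|X v y| <= c * `|v|.
Hypothesis X_lip : forall v y y', near_x0 y -> near_x0 y' ->
  `|X v y' - X v y| <= c * `|v| * `|y' - y|.
Hypothesis DX_bound : forall v y z, near_x0 y -> `|DX v y z| <= c * `|v| * `|z|.
Hypothesis X_taylor : forall v y y', near_x0 y -> near_x0 y' ->
  `|X v y' - X v y - DX v y (y' - y)| <= K * `|v| * `|y' - y| ^+ 2.

(** In the sign convention of [lie] this is [X w, X v]. *)
Definition bracket (v w : W) (y : V) : V := DX v y (X w y) - DX w y (X v y).

Hypothesis bracket_lip : forall v w y, near_x0 y ->
  `|bracket v w y - bracket v w x0| <= c * `|v| * `|w| * `|y - x0|.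

(** Vertex k of the Euler polygon, with step 1/N, of the autonomous equation y' = X v y; vertex N
    approximates the time-one flow. *)
Definition polygon (N : nat) (v : W) (k : nat) : V :=
  iter k (fun y => y + N%:R^-1 *: X v y) x0.

Let c0 : 0 < c. Proof. exact: lt_le_trans c1. Qed.

Lemma discrete_growth (z : nat -> R) (d q E : R) (N : nat) :
  0 <= d -> N%:R * d <= 1 -> 0 <= q <= 2^-1 -> 0 <= E ->
  z 0 <= 0 -> (forall k, (k < N)%N -> z k.+1 <= (1 + d * q) * z k + d * E) ->
  forall k, (k <= N)%N -> z k <= 2 * E * (k%:R * d).
Proof.
move=> d0 Nd /andP[q0 q1] E0 z0 H; elim=> [_|k IH kN].
  by rewrite mul0r mulr0.
apply: le_trans (H k kN) _.
have zk := IH (ltnW kN).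
have kd : k%:R * d <= 1.
  by apply: le_trans Nd; rewrite ler_wpM2r // ler_nat ltnW.
have k0 : 0 <= k%:R * d by rewrite mulr_ge0.
have h1 : (1 + d * q) * z k <= (1 + d * q) * (2 * E * (k%:R * d)).
  by rewrite ler_wpM2l // addr_ge0 // mulr_ge0.
have h2 : d * q * (2 * E * (k%:R * d)) <= d * E.
  have -> : d * q * (2 * E * (k%:R * d)) = d * E * (2 * q * (k%:R * d)) by ring.
  rewrite -[leRHS]mulr1 ler_wpM2l ?mulr_ge0 //.
  by apply: mulr_ile1 => //; [rewrite mulr_ge0|lra].
rewrite -natr1; move: h1 h2; rewrite !mulrDl !mul1r mulrDr; lra.
Qed.

Section Step.
Variables (N : nat).
Hypothesis N0 : (0 < N)%N.
Let d : R := N%:R^-1.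
Let d0 : 0 < d. Proof. by rewrite invr_gt0 ltr0n. Qed.
Let Nd : N%:R * d = 1. Proof. by rewrite divff // pnatr_eq0 -lt0n. Qed.

Let frac k : (k <= N)%N -> 0 <= k%:R * d <= 1.
Proof.
move=> kN; rewrite mulr_ge0 ?(ltW d0) //= -[leRHS]Nd.
by rewrite ler_wpM2r ?(ltW d0) // ler_nat.
Qed.

Lemma polygon_near v k : c * `|v| <= r0 -> (k <= N)%N ->
  `|polygon N v k - x0| <= k%:R * d * (c * `|v|) /\ near_x0 (polygon N v k).
Proof.
move=> vr; elim: k => [_|k IH kN].
  rewrite /near_x0 subrr normr0 !mul0r; split=> //.
  by apply: le_trans vr; rewrite mulr_ge0 // ltW.
have [h1 h2] := IH (ltnW kN).
have h : `|polygon N v k.+1 - x0| <= k.+1%:R * d * (c * `|v|).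
  rewrite /= -/(polygon N v k) addrAC.
  apply: le_trans (ler_normD _ _) _.
  rewrite -natr1 !mulrDl mul1r; apply: lerD => //.
  rewrite normrZ gtr0_norm // ler_wpM2l ?(ltW d0) //; exact: X_bound.
split=> //; apply: le_trans h _; have /andP[h3 h4] := frac kN.
by apply: le_trans vr; rewrite ler_piMl // mulr_ge0 // ltW.
Qed.

Variables v w : W.
Hypotheses (vr : c * `|v| <= r0) (vwr : c * `|v + w| <= r0) (v2 : c * `|v| <= 2^-1).
Let y k := polygon N v k.
Let D k := polygon N (v + w) k - polygon N v k.

Let yS k : y k.+1 = y k + d *: X v (y k). Proof. by []. Qed.

Let y'E k : polygon N (v + w) k = y k + D k.
Proof. by rewrite /D [RHS]addrC subrK. Qed.

Let DS k : D k.+1 = D k + d *: ((X v (y k + D k) - X v (y k)) + X w (y k + D k)).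
Proof.
have E : polygon N (v + w) k.+1 = y k + D k + d *: X (v + w) (y k + D k) by rewrite -y'E.
rewrite {1}/D E X_add /= -/(polygon N v k) -/(y k) -/d.
by vring.
Qed.

Let near_y k : (k <= N)%N -> near_x0 (y k).
Proof. by move=> kN; case: (polygon_near vr kN). Qed.

Let near_y' k : (k <= N)%N -> near_x0 (y k + D k).
Proof. by move=> kN; rewrite -y'E; case: (polygon_near vwr kN). Qed.

Let D_bound k : (k <= N)%N -> `|D k| <= 2 * (c * `|w|).
Proof.
move=> kN.
have : `|D k| <= 2 * (c * `|w|) * (k%:R * d).
  apply: (@discrete_growth (fun k => `|D k|) d (c * `|v|) _ N) => //.
  - exact: ltW.
  - by rewrite Nd.
  - by rewrite v2 mulr_ge0 // ltW.
  - by rewrite mulr_ge0 // ltW.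
  - by rewrite /D subrr normr0.
  - move=> j jN; rewrite DS; apply: le_trans (ler_normD _ _) _.
    rewrite normrZ (gtr0_norm d0).
    set S := X v _ - _ + _.
    have hS : `|S| <= c * `|v| * `|D j| + c * `|w|.
      have h1 := near_y (ltnW jN); have h2 := near_y' (ltnW jN).
      apply: le_trans (ler_normD _ _) _; apply: lerD; last exact: X_bound.
      by have := X_lip v h1 h2; rewrite (addrC (y j)) addrK.
    have := ler_wpM2l (ltW d0) hS; lra.
move/le_trans; apply; have /andP[h3 h4] := frac kN.
by rewrite ler_piMr // !mulr_ge0 // ltW.
Qed.

Let B0 := bracket v w x0.
Let r k : R := k%:R * d.
(** Remainder of the variation at time r = k/N. The variation solves D' = DX_v D + X_w; inserting r
    X_w(y) + Q gives Q' = r [X_w, X_v] + DX_v Q, hence Q close to (r^2/2) B0. *)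
Let Z k := D k - (r k *: X w (y k) + (r k ^+ 2 / 2) *: B0).

Let e1 k := X v (y k + D k) - X v (y k) - DX v (y k) (D k).
Let e2 k := X w (y k + D k) - X w (y k).
Let e3 k := X w (y k.+1) - X w (y k) - DX w (y k) (y k.+1 - y k).
Let e4 k := X w (y k.+1) - X w (y k).

(** e1 and e3 are second-order Taylor remainders, of X v along D and of X w along one polygon step;
    e2 and e4 are the corresponding plain variations of X w. The term (d / 2) B0 arises because (r +
    d)^2 / 2 - r^2 / 2 exceeds r d by d^2 / 2. *)
Let ZS k : Z k.+1 = Z k + d *: (DX v (y k) (Z k) +
   (r k *: (bracket v w (y k) - B0) + (r k ^+ 2 / 2) *: DX v (y k) B0
    + e1 k + e2 k - e4 k - (d / 2) *: B0)) - r k *: e3 k.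
Proof.
have DZ : D k = Z k + (r k *: X w (y k) + (r k ^+ 2 / 2) *: B0) by rewrite /Z subrK.
have DXD : DX v (y k) (D k) = DX v (y k) (Z k) + r k *: DX v (y k) (X w (y k)) +
   (r k ^+ 2 / 2) *: DX v (y k) B0.
  by rewrite -!DX_scale -!DX_add -addrA -DZ.
have rS : r k.+1 = r k + d by rewrite /r -natr1 mulrDl mul1r.
have E3 : e3 k = X w (y k.+1) - X w (y k) - d *: DX w (y k) (X v (y k)).
  by rewrite /e3 yS [_ - y k]addrAC subrr add0r DX_scale.
have E1 : X v (y k + D k) - X v (y k) = DX v (y k) (D k) + e1 k by rewrite /e1 [RHS]addrC subrK.
have E2 : X w (y k + D k) = X w (y k) + e2 k by rewrite /e2 [RHS]addrC subrK.
rewrite {1}/Z DS E1 E2 DXD rS E3 /e4 /bracket {1}DZ.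
by apply/rowP => ?; rewrite !mxE; field.
Qed.

(** In the bound K occurs only with |w| + 1/N: w will be a small increment of the control and N is
    free. What survives is of order |v|^2 |w| with a constant depending on c alone. *)
Lemma polygon_variation : `|v| <= 1 ->
  `|polygon N (v + w) N - polygon N v N - X w (polygon N v N) - 2^-1 *: B0| <=
  `|w| * (2 * (c ^+ 2 + c ^+ 3) * `|v| ^+ 2 + (8 * K * c ^+ 2 + 4 * c ^+ 2) * (`|w| + d)).
Proof.
move=> v1.
have nv := normr_ge0 v; have nw := normr_ge0 w; have c0' := ltW c0; have d0' := ltW d0.
(* Half of the claimed bound, since [discrete_growth] returns 2 E at time 1. *)
pose E := `|w| * ((c ^+ 2 + c ^+ 3) * `|v| ^+ 2 + (4 * K * c ^+ 2 + 2 * c ^+ 2) * (`|w| + d)).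
have E0 : 0 <= E by rewrite /E !(mulr_ge0, addr_ge0, sqr_ge0, exprn_ge0).
have rN : r N = 1 by [].
have ->: polygon N (v + w) N - polygon N v N - X w (polygon N v N) - 2^-1 *: B0 = Z N.
  by rewrite /Z rN expr1n mul1r scale1r opprD addrA.
have -> : `|w| * (2 * (c ^+ 2 + c ^+ 3) * `|v| ^+ 2 + (8 * K * c ^+ 2 + 4 * c ^+ 2) * (`|w| + d)) =
  2 * E * (N%:R * d) by rewrite Nd /E; ring.
apply: (@discrete_growth (fun k => `|Z k|) d (c * `|v|) _ N) => //.
- by rewrite Nd.
- by rewrite v2 mulr_ge0.
- by rewrite /Z /D /r subrr mul0r scale0r expr0n mul0r scale0r addr0 subrr normr0.
move=> k kN; have yk := near_y (ltnW kN); have yk' := near_y' (ltnW kN).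
have ySk := near_y kN.
have /andP[r0' r1] : 0 <= r k <= 1 by apply: frac; exact: ltnW.
have B0b : `|B0| <= 2 * c ^+ 2 * `|v| * `|w|.
  rewrite /B0 /bracket; apply: le_trans (ler_normB _ _) _.
  have x0x0 : near_x0 x0 by have := @polygon_near v 0 vr isT => -[].
  have h1 : `|DX v x0 (X w x0)| <= c * `|v| * (c * `|w|).
    by apply: le_trans (DX_bound _ _ x0x0) _; rewrite ler_wpM2l ?mulr_ge0 //; exact: X_bound.
  have h2 : `|DX w x0 (X v x0)| <= c * `|w| * (c * `|v|).
    by apply: le_trans (DX_bound _ _ x0x0) _; rewrite ler_wpM2l ?mulr_ge0 //; exact: X_bound.
  nra.
rewrite ZS; apply: le_trans (ler_normB _ _) _.
have h3 : `|r k *: e3 k| <= d * (K * `|w| * (d * (c ^+ 2 * `|v| ^+ 2))).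
  rewrite normrZ (ger0_norm r0').
  apply: le_trans (_ : 1 * `|e3 k| <= _); first by rewrite ler_wpM2r.
  rewrite mul1r; apply: le_trans (X_taylor _ yk ySk) _.
  have -> : y k.+1 - y k = d *: X v (y k) by rewrite yS addrAC subrr add0r.
  have -> : d * (K * `|w| * (d * (c ^+ 2 * `|v| ^+ 2))) = K * `|w| * (d * (c * `|v|)) ^+ 2 by ring.
  rewrite ler_wpM2l ?mulr_ge0 // lerXn2r ?nnegrE ?mulr_ge0 //.
  by rewrite normrZ (ger0_norm d0') ler_wpM2l //; exact: X_bound.
have hZ : `|DX v (y k) (Z k)| <= c * `|v| * `|Z k| by exact: DX_bound.
have ha : `|r k *: (bracket v w (y k) - B0)| <= c ^+ 2 * `|v| ^+ 2 * `|w|.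
  rewrite normrZ (ger0_norm r0').
  apply: le_trans (_ : 1 * `|bracket v w (y k) - B0| <= _); first by rewrite ler_wpM2r.
  rewrite mul1r; apply: le_trans (bracket_lip _ _ yk) _.
  have -> : c ^+ 2 * `|v| ^+ 2 * `|w| = c * `|v| * `|w| * (c * `|v|) by ring.
  rewrite ler_wpM2l ?mulr_ge0 //.
  apply: le_trans (polygon_near vr (ltnW kN)).1 _.
  by have /andP[? ?] := frac (ltnW kN); rewrite ler_piMl ?mulr_ge0.
have hb : `|(r k ^+ 2 / 2) *: DX v (y k) B0| <= c ^+ 3 * `|v| ^+ 2 * `|w|.
  rewrite normrZ ger0_norm ?mulr_ge0 ?sqr_ge0 //.
  apply: le_trans (_ : 2^-1 * (c * `|v| * (2 * c ^+ 2 * `|v| * `|w|)) <= _); last first.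
    by rewrite le_eqVlt; apply/orP; left; apply/eqP; field.
  apply: ler_pM => //; first by rewrite mulr_ge0 ?sqr_ge0.
    by rewrite ler_piMl // expr_le1.
  by apply: le_trans (DX_bound _ _ yk) _; rewrite ler_wpM2l ?mulr_ge0.
have Db := D_bound (ltnW kN).
have he1 : `|e1 k| <= 4 * K * c ^+ 2 * `|w| ^+ 2.
  have := X_taylor v yk yk'; rewrite (addrC (y k) (D k)) addrK (addrC (D k)) => /le_trans; apply.
  have -> : 4 * K * c ^+ 2 * `|w| ^+ 2 = K * 1 * (2 * (c * `|w|)) ^+ 2 by ring.
  apply: ler_pM; rewrite ?mulr_ge0 ?sqr_ge0 ?ler_wpM2l //.
  by rewrite lerXn2r ?nnegrE ?mulr_ge0.
have he2 : `|e2 k| <= 2 * c ^+ 2 * `|w| ^+ 2.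
  have := X_lip w yk yk'; rewrite (addrC (y k) (D k)) addrK (addrC (D k)) => /le_trans; apply.
  have -> : 2 * c ^+ 2 * `|w| ^+ 2 = c * `|w| * (2 * (c * `|w|)) by ring.
  by rewrite ler_wpM2l ?mulr_ge0.
have he4 : `|e4 k| <= d * (c ^+ 2 * `|w|).
  apply: le_trans (X_lip w yk ySk) _.
  have -> : y k.+1 - y k = d *: X v (y k) by rewrite yS addrAC subrr add0r.
  have -> : d * (c ^+ 2 * `|w|) = c * `|w| * (d * (c * 1)) by ring.
  rewrite ler_wpM2l ?mulr_ge0 // normrZ (ger0_norm d0') ler_wpM2l //.
  by apply: le_trans (X_bound _ yk) _; rewrite ler_wpM2l.
have hB : `|(d / 2) *: B0| <= d * (c ^+ 2 * `|w|).
  rewrite normrZ ger0_norm ?mulr_ge0 //.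
  apply: le_trans (_ : d / 2 * (2 * c ^+ 2 * 1 * `|w|) <= _); last first.
    by rewrite le_eqVlt; apply/orP; left; apply/eqP; field.
  rewrite ler_wpM2l ?mulr_ge0 //; apply: le_trans B0b _.
  by rewrite ler_wpM2r // ler_wpM2l ?mulr_ge0 ?sqr_ge0.
apply: le_trans (lerD (ler_normD _ _) h3) _.
rewrite normrZ (ger0_norm d0').
set q := _ - (d / 2) *: B0.
have hq : `|q| <= c ^+ 2 * `|v| ^+ 2 * `|w| + c ^+ 3 * `|v| ^+ 2 * `|w| + 4 * K * c ^+ 2 * `|w| ^+ 2
   + 2 * c ^+ 2 * `|w| ^+ 2 + d * (c ^+ 2 * `|w|) + d * (c ^+ 2 * `|w|).
  rewrite /q; repeat (apply: le_trans (ler_normB _ _) _; apply: lerD; last by assumption).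
  by repeat (apply: le_trans (ler_normD _ _) _; apply: lerD; last by assumption).
have hv : K * `|w| * (d * (c ^+ 2 * `|v| ^+ 2)) <= K * `|w| * (d * (c ^+ 2 * 1)).
  by rewrite !ler_wpM2l ?mulr_ge0 ?sqr_ge0 // expr_le1.
have hE : c ^+ 2 * `|v| ^+ 2 * `|w| + c ^+ 3 * `|v| ^+ 2 * `|w| + 4 * K * c ^+ 2 * `|w| ^+ 2
   + 2 * c ^+ 2 * `|w| ^+ 2 + d * (c ^+ 2 * `|w|) + d * (c ^+ 2 * `|w|) +
   K * `|w| * (d * (c ^+ 2 * 1)) <= E.
  rewrite /E -subr_ge0; set lhs := (X in 0 <= X).
  have -> : lhs = 3 * (K * `|w| * (d * c ^+ 2)) by rewrite /lhs; ring.
  by rewrite !mulr_ge0 ?sqr_ge0.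
have hS : `|DX v (y k) (Z k) + q| <= c * `|v| * `|Z k| + `|q|.
  by apply: le_trans (ler_normD _ _) _; rewrite lerD2r.
move: (ler_wpM2l d0' hS) (ler_wpM2l d0' hq) (ler_wpM2l d0' hv) (ler_wpM2l d0' hE); lra.
Qed.
End Step.
End Polygon.

(** * Mean value inequalities and norms *)

Section MeanValue.
Context {R : realType}.

(** The mean value theorem is applied to each coordinate, at a point depending on the coordinate,
    which suffices for the sup norm. Subtracting a fixed vector w makes the same lemma yield Taylor
    remainders. *)
Lemma mean_value_line_affine (U : normedModType R) (q : nat) (f : U -> 'rV[R]_q) (w : 'rV[R]_q)
    (x v : U) (a b L : R) :
  a <= b ->
  (forall r, a <= r <= b -> derivable f (x + r *: v) v /\ `|'D_v f (x + r *: v) - w| <= L) ->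
  `|f (x + b *: v) - f (x + a *: v) - (b - a) *: w| <= L * (b - a).
Proof.
move=> ab H.
have L0 : 0 <= L.
  have [_ h] := H a ltac:(by rewrite lexx ab).
  exact: le_trans h.
apply: mxnorm_leP => [|k]; first by rewrite mulr_ge0 ?subr_ge0.
rewrite !mxE.
pose phi (r : R) : R := f (x + r *: v) 0 k.
have dphi r : a <= r <= b -> is_derive r 1 phi (('D_v f (x + r *: v)) 0 k).
  move=> /H[h _].
  have E : (fun h : R => h^-1 *: ((phi \o shift r) (h *: 1) - phi r)) =
    (fun y : 'rV[R]_q => y 0 k) \o
    (fun h : R => h^-1 *: ((f \o shift (x + r *: v)) (h *: v) - f (x + r *: v))).
    apply/funext => h' /=; rewrite /phi !mxE; congr (_ * (f _ 0 k - _)).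
    by rewrite scalerDl -scalerA scale1r addrCA.
  have cv : (fun h : R => h^-1 *: ((phi \o shift r) (h *: 1) - phi r)) @ 0^' -->
      (('D_v f (x + r *: v)) 0 k).
    rewrite E; apply: cvg_comp; first exact: h.
    exact: coord_continuous.
  split; first by apply/cvg_ex; eexists; exact: cv.
  exact: cvg_lim cv.
have cphi : {within `[a, b], continuous phi}.
  apply: continuous_in_subspaceT => r; rewrite inE /= in_itv /= => hr.
  have [d _] := dphi r hr.
  by apply: differentiable_continuous; apply/derivable1_diffP.
have dphi' r : r \in `]a, b[ -> is_derive r 1 phi (('D_v f (x + r *: v)) 0 k).
  by rewrite in_itv => /andP[/ltW ? /ltW ?]; apply: dphi; apply/andP.
have [r hr ->] := MVT_segment ab dphi' cphi.
rewrite [(b - a) * _]mulrC -mulrBl normrM (ger0_norm (x := b - a)) ?subr_ge0 //.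
rewrite ler_wpM2r ?subr_ge0 //.
have -> : 'D_v f (x + r *: v) 0 k - w 0 k = ('D_v f (x + r *: v) - w) 0 k by rewrite !mxE.
apply: le_trans (coord_le_mxnorm _ _) _.
by have [] := H r; rewrite in_itv in hr.
Qed.

Lemma mean_value_line (U : normedModType R) (q : nat) (f : U -> 'rV[R]_q) (x v : U) (a b L : R) :
  a <= b ->
  (forall r, a <= r <= b -> derivable f (x + r *: v) v /\ `|'D_v f (x + r *: v)| <= L) ->
  `|f (x + b *: v) - f (x + a *: v)| <= L * (b - a).
Proof.
move=> ab H; have := @mean_value_line_affine U q f 0 x v a b L ab.
rewrite scaler0 subr0; apply=> r hr; rewrite subr0; exact: H.
Qed.

Lemma segment_in_cube (p : nat) (rho : R) (x y : 'rV[R]_p) (r : R) :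
  `|x| <= rho -> `|y| <= rho -> 0 <= r <= 1 -> `|x + r *: (y - x)| <= rho.
Proof.
move=> xr yr /andP[r0 r1].
have -> : x + r *: (y - x) = (1 - r) *: x + r *: y.
  by apply/rowP => i; rewrite !mxE; ring.
apply: le_trans (ler_normD _ _) _; rewrite !normrZ !ger0_norm ?subr_ge0 //.
have -> : rho = (1 - r) * rho + r * rho by ring.
by apply: lerD; rewrite ler_wpM2l // subr_ge0.
Qed.

Lemma mean_value_space (p q : nat) (f : 'rV[R]_p -> 'rV[R]_q) (rho L : R) (x y : 'rV[R]_p) :
  `|x| <= rho -> `|y| <= rho ->
  (forall z, `|z| <= rho -> differentiable f z /\ forall v, `|'D_v f z| <= L * `|v|) ->
  `|f y - f x| <= L * `|y - x|.
Proof.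
move=> xr yr H.
have -> : `|f y - f x| = `|f (x + 1 *: (y - x)) - f (x + 0 *: (y - x))|.
  by rewrite scale1r scale0r addr0 [x + _]addrC subrK.
rewrite -[leRHS]mulr1 -[X in _ * X](subr0 1); apply: mean_value_line => // r r01.
have hr := segment_in_cube xr yr r01.
by have [h1 h2] := H _ hr; split => //; exact: diff_derivable.
Qed.

Lemma mean_value_time (q : nat) (f : R -> 'rV[R]_q) (L s t : R) :
  (forall r, derivable f r 1 /\ `|derive1 f r| <= L) -> `|f t - f s| <= L * `|t - s|.
Proof.
move=> H.
have le (a b : R) : a <= b -> `|f b - f a| <= L * (b - a).
  move=> ab.
  have -> : `|f b - f a| = `|f (0 + b *: 1) - f (0 + a *: 1)|.
    by rewrite !add0r !scaler1.
  apply: (@mean_value_line R q f 0 1 a b L ab) => r _.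
  have -> : (0 + r *: 1 : R) = r by rewrite add0r scaler1.
  by have [h1 h2] := H r; split; [exact: h1|rewrite -derive1E].
have [st|ts] := leP s t; first by rewrite [`|t - s|]ger0_norm ?subr_ge0 //; exact: le.
have := le _ _ (ltW ts); rewrite distrC => /le_trans; apply.
by rewrite distrC ger0_norm // subr_ge0 ltW.
Qed.

End MeanValue.

(** * Comparison of the Euclidean norm, the operator norm and the sup norm *)

Section EuclideanNorm.
Context {R : realType}.

Lemma mxnorm_le_enorm n (x : 'rV[R]_n) : `|x| <= enorm x.
Proof.
apply: mxnorm_leP => [|k]; first exact: sqrtr_ge0.
rewrite -sqrtr_sqr ler_wsqrtr // (bigD1 k) //= lerDl.
by apply: sumr_ge0 => i _; exact: sqr_ge0.
Qed.

Lemma enorm_le_mxnorm n (x : 'rV[R]_n) : enorm x <= n%:R * `|x|.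
Proof.
have n0 : 0 <= n%:R * `|x| by rewrite mulr_ge0.
rewrite -(ger0_norm n0) -sqrtr_sqr ler_wsqrtr //.
have nn : (n <= n ^ 2)%N by case: (n) => // k; rewrite expnS expn1 leq_pmulr.
apply: le_trans (_ : \sum_(i < n) `|x| ^+ 2 <= _).
  apply: ler_sum => i _; rewrite -(real_normK (num_real (x 0 i))).
  by rewrite lerXn2r ?nnegrE //; exact: coord_le_mxnorm.
rewrite sumr_const card_ord exprMn -[leLHS]mulr_natl ler_wpM2r ?sqr_ge0 //.
by rewrite -natrX ler_nat.
Qed.

Lemma enormZ n (a : R) (x : 'rV[R]_n) : enorm (a *: x) = `|a| * enorm x.
Proof.
rewrite /enorm -sqrtr_sqr -sqrtrM ?sqr_ge0 //; congr Num.sqrt.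
by rewrite mulr_sumr; apply: eq_bigr => i _; rewrite mxE exprMn.
Qed.

Lemma enorm_ge0 n (x : 'rV[R]_n) : 0 <= enorm x. Proof. exact: sqrtr_ge0. Qed.

Lemma enorm_sqr n (x : 'rV[R]_n) : enorm x ^+ 2 = \sum_i x 0 i ^+ 2.
Proof. by rewrite sqr_sqrtr // sumr_ge0 // => i _; exact: sqr_ge0. Qed.

Lemma enorm_eq0 n (x : 'rV[R]_n) : enorm x = 0 -> x = 0.
Proof.
move=> h; apply/eqP; rewrite -normr_le0 -h; exact: mxnorm_le_enorm.
Qed.

Lemma enormD n (x y : 'rV[R]_n) : enorm (x + y) <= enorm x + enorm y.
Proof.
have [/enorm_eq0 ->|x0] := eqVneq (enorm x) 0.
  by rewrite add0r lerDr enorm_ge0.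
have [/enorm_eq0 ->|y0] := eqVneq (enorm y) 0.
  by rewrite addr0 lerDl enorm_ge0.
have xp : 0 < enorm x by rewrite lt_neqAle eq_sym x0 enorm_ge0.
have yp : 0 < enorm y by rewrite lt_neqAle eq_sym y0 enorm_ge0.
rewrite -ler_sqr ?nnegrE ?addr_ge0 ?enorm_ge0 //.
set A := enorm x; set B := enorm y; rewrite -/A -/B in xp yp x0 y0.
have -> : (A + B) ^+ 2 = \sum_i ((1 + B / A) * x 0 i ^+ 2 + (1 + A / B) * y 0 i ^+ 2).
  rewrite big_split /= -!mulr_sumr -!enorm_sqr -/A -/B; field.
  by rewrite x0 y0.
rewrite enorm_sqr; apply: ler_sum => i _; rewrite mxE.
set s := x 0 i; set t := y 0 i.
have -> : (1 + B / A) * s ^+ 2 + (1 + A / B) * t ^+ 2 =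
  (s + t) ^+ 2 + (A * B)^-1 * (B * s - A * t) ^+ 2 by field; rewrite x0 y0.
by rewrite lerDl mulr_ge0 ?sqr_ge0 // invr_ge0 mulr_ge0 // ltW.
Qed.

Lemma opnorm_le n p (A : 'M[R]_(n, p)) (v : 'rV[R]_n) :
  enorm (v *m A) <= opnorm A * enorm v.
Proof.
have lin : forall v : 'rV[R]_n, enorm v <= 1 -> enorm (v *m A) <= opnorm A.
  move=> {}v v1; apply: ub_le_sup; last by exists v.
  (* The supremum is meaningful only for a bounded set; this crude bound provides it. *)
  exists (p%:R * (n%:R * `|A|)) => _ [w /= w1 <-].
  apply: le_trans (enorm_le_mxnorm _) _; rewrite ler_wpM2l //.
  apply: mxnorm_leP => [|k]; first by rewrite mulr_ge0.
  rewrite mxE; apply: le_trans (ler_norm_sum _ _ _) _.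
  rewrite mulr_natl -[X in _ *+ X]card_ord -sumr_const; apply: ler_sum => i _.
  rewrite normrM -[leRHS]mul1r; apply: ler_pM => //.
    exact: le_trans (coord_le_mxnorm _ _) (le_trans (mxnorm_le_enorm _) w1).
  rewrite [leRHS]/Num.Def.normr /= mx_normrE.
  exact: (le_bigmax _ (fun ij : 'I_n * 'I_p => `|A ij.1 ij.2|) (i, k)).
have [/enorm_eq0 ->|v0] := eqVneq (enorm v) 0.
  by rewrite mul0mx -(scale0r (0 : 'rV_n)) -(scale0r (0 : 'rV_p)) !enormZ normr0 !mul0r mulr0.
have vp : 0 < enorm v by rewrite lt_neqAle eq_sym v0 enorm_ge0.
have := lin ((enorm v)^-1 *: v); rewrite enormZ ger0_norm ?invr_ge0 ?enorm_ge0 // mulVf // lexx.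
move=> /(_ isT); rewrite -scalemxAl enormZ ger0_norm ?invr_ge0 ?enorm_ge0 //.
by rewrite mulrC ler_pdivrMr.
Qed.

End EuclideanNorm.

(** * The vector fields on a cube *)

Section Slices.
Context {R : realType} {n : nat}.
Notation V := 'rV[R]_n.
Implicit Types f g : R -> V -> V.

Definition joint f : R * V -> V := fun p => f p.1 p.2.

Lemma slice_differentiable (t : R) (x : V) : differentiable (fun y : V => (t, y) : R * V) x.
Proof. by apply: differentiable_pair => //; exact: differentiable_cst. Qed.

Lemma slice_space f t x : differentiable (joint f) (t, x) ->
  differentiable (f t) x /\ forall v, 'D_v (f t) x = 'D_(0, v) (joint f) (t, x).
Proof.
move=> df; split.
  rewrite (_ : f t = joint f \o (fun y => (t, y))); last by [].
  apply: differentiable_comp; [exact: slice_differentiable|exact: df].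
move=> v.
have E : (fun h : R => h^-1 *: ((f t \o shift x) (h *: v) - f t x)) =
  (fun h : R => h^-1 *: ((joint f \o shift (t, x)) (h *: (0, v)) - joint f (t, x))).
  apply/funext => h /=; rewrite /joint /=; congr (_ *: (f _ _ - _)).
  by rewrite scaler0 add0r.
by rewrite /derive E.
Qed.

Lemma slice_time f t x : differentiable (joint f) (t, x) ->
  derivable (fun s => f s x) t 1 /\ derive1 (fun s => f s x) t = 'D_(1, 0) (joint f) (t, x).
Proof.
move=> df.
have E : (fun h : R => h^-1 *: (((fun s => f s x) \o shift t) (h *: 1) - f t x)) =
  (fun h : R => h^-1 *: ((joint f \o shift (t, x)) (h *: (1, 0)) - joint f (t, x))).
  apply/funext => h /=; rewrite /joint /=; congr (_ *: (f _ _ - _)).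
  by rewrite scaler0 add0r.
have dd : derivable (joint f) (t, x) (1, 0) by exact: diff_derivable.
split; first by rewrite /derivable E.
by rewrite derive1E /derive E.
Qed.

Lemma mulmx_jacobian (g : V -> V) x (z : V) : differentiable g x -> z *m 'J g x = 'D_z g x.
Proof. by move=> h; rewrite deriveEjacobian. Qed.

(** Directional derivatives of the joint map replace the Jacobians: C2 makes them differentiable in
    (t, x), and so the bracket is. *)
Lemma lie_coordE f g t x : differentiable (joint f) (t, x) -> differentiable (joint g) (t, x) ->
  lie f g t x = \sum_k (f t x 0 k *: 'D_(0, delta_mx 0 k) (joint g) (t, x) -
                        g t x 0 k *: 'D_(0, delta_mx 0 k) (joint f) (t, x)).
Proof.
move=> /slice_space[df Df] /slice_space[dg Dg].
rewrite /lie !mulmx_sum_row -sumrB; apply: eq_bigr => k _.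
congr (_ *: _ - _ *: _); first by rewrite rowE (mulmx_jacobian _ dg) Dg.
by rewrite rowE (mulmx_jacobian _ df) Df.
Qed.

Lemma differentiable_scale_rV (U : normedModType R) (h : U -> R) (w : U -> V) p :
  differentiable h p -> differentiable w p -> differentiable (fun q => h q *: w q) p.
Proof.
move=> dh dw.
rewrite (_ : (fun q => h q *: w q) =
   \sum_(k < n) (fun q => (h q * w q 0 k) *: (delta_mx 0 k : V))).
  apply: differentiable_sum => k; apply: differentiableZl.
  apply: differentiableM => //.
  apply: (@differentiable_comp _ _ _ _ w (fun N : V => N 0 k)) => //.
  exact: differentiable_coord.
apply/funext => q; rewrite fct_sumE /=.
rewrite {1}(row_sum_delta (w q)) scaler_sumr.
by apply: eq_bigr => k _; rewrite scalerA.
Qed.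

Lemma lie_differentiable f g : C2 (joint f) -> C2 (joint g) ->
  forall p, differentiable (joint (lie f g)) p.
Proof.
move=> [[df _] d2f] [[dg _] d2g] p.
rewrite (_ : joint (lie f g) = \sum_k ((fun q => joint f q 0 k *: 'D_(0, delta_mx 0 k) (joint g) q) -
    (fun q => joint g q 0 k *: 'D_(0, delta_mx 0 k) (joint f) q))).
  apply: differentiable_sum => k; apply: differentiableB; apply: differentiable_scale_rV.
  - apply: (@differentiable_comp _ _ _ _ (joint f) (fun N : V => N 0 k)) => //.
    exact: differentiable_coord.
  - by case: (d2g (0, delta_mx 0 k)).
  - apply: (@differentiable_comp _ _ _ _ (joint g) (fun N : V => N 0 k)) => //.
    exact: differentiable_coord.
  - by case: (d2f (0, delta_mx 0 k)).
apply/funext => -[t x]; rewrite fct_sumE /= /joint /=.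
by rewrite lie_coordE.
Qed.

Definition cube (rho : R) : set V := [set x | `|x| <= rho].

Lemma cube_compact rho : compact (cube rho).
Proof.
apply: bounded_closed_compact.
  exists rho; split; first exact: num_real.
  by move=> M rM x /= hx; apply: le_trans hx (ltW rM).
rewrite (_ : cube rho = closed_ball_ (fun x : V => `|x|) 0 rho); last first.
  by apply/seteqP; split => x; rewrite /cube /closed_ball_ /= sub0r normrN.
exact: closed_closed_ball_.
Qed.

Lemma cube_bounded (W : normedModType R) (g : V -> W) rho : continuous g ->
  exists2 K, 0 <= K & forall x, cube rho x -> `|g x| <= K.
Proof.
move=> cg; have := @continuous_compact _ _ g (cube rho) (continuous_subspaceT cg) (@cube_compact rho).
move=> /compact_bounded[M [_ HM]].
exists (`|M| + 1); first by rewrite addr_ge0.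
move=> x hx; apply: (HM (`|M| + 1)); last by exists x.
by rewrite (le_lt_trans (ler_norm _)) // ltrDl.
Qed.

Lemma deriveD_coord (g : V -> V) x (z : V) : differentiable g x ->
  'D_z g x = \sum_k z 0 k *: 'D_(delta_mx 0 k) g x.
Proof.
move=> dg; rewrite -mulmx_jacobian // mulmx_sum_row; apply: eq_bigr => k _.
by rewrite rowE mulmx_jacobian.
Qed.

Lemma coord_sum_bound (p : nat) (z : 'rV[R]_p) (w : 'I_p -> V) (K : R) :
  (forall k, `|w k| <= K) -> `|\sum_k z 0 k *: w k| <= p%:R * K * `|z|.
Proof.
move=> H; apply: le_trans (ler_norm_sum _ _ _) _.
rewrite -mulrA mulr_natl -[X in _ *+ X]card_ord -sumr_const; apply: ler_sum => k _.
rewrite normrZ mulrC; apply: ler_pM => //; exact: coord_le_mxnorm.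
Qed.

(* The constant depends on t: the second derivatives are not assumed bounded in time. *)
Lemma taylor_cube f rho t : C2 (joint f) ->
  exists2 K, 0 <= K & forall x y, cube rho x -> cube rho y ->
    `|f t y - f t x - (y - x) *m 'J (f t) x| <= K * `|y - x| ^+ 2.
Proof.
move=> [[df _] d2f].
pose e k : R * V := (0, delta_mx 0 k).
pose Df k := 'D_(e k) (joint f).
have dDf k p : differentiable (Df k) p by have [h _] := d2f (e k); exact: h.
have cDDf k l : continuous (fun p => 'D_(e l) (Df k) p) by have [_ h] := d2f (e k); exact: h.
have line_cont : continuous (fun y : V => (t, y)).
  by move=> y; exact/differentiable_continuous/slice_differentiable.
have bnd k l : exists2 K, 0 <= K & forall x, cube rho x -> `|'D_(e l) (Df k) (t, x)| <= K.
  apply: (@cube_bounded _ (fun x => 'D_(e l) (Df k) (t, x))).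
  move=> y; exact: (cvg_comp _ _ (line_cont y) (cDDf k l (t, y))).
have [Kf hKf] := choice (fun kl : 'I_n * 'I_n =>
  (ltac:(by have [K ? ?] := bnd kl.1 kl.2; exists K) :
   exists K, 0 <= K /\ forall x, cube rho x -> `|'D_(e kl.2) (Df kl.1) (t, x)| <= K)).
(* The sum of the finitely many bounds serves for all second derivatives at once. *)
pose M := \sum_kl Kf kl.
have M0 : 0 <= M by apply: sumr_ge0 => kl _; case: (hKf kl).
have hM k l x : cube rho x -> `|'D_(e l) (Df k) (t, x)| <= M.
  move=> hx; apply: le_trans ((hKf (k, l)).2 _ hx) _.
  rewrite /M (bigD1 (k, l)) //= lerDl; apply: sumr_ge0 => kl _; by case: (hKf kl).
have Dlip k x y : cube rho x -> cube rho y -> `|Df k (t, y) - Df k (t, x)| <= n%:R * M * `|y - x|.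
  move=> hx hy.
  apply: (@mean_value_space R n n (fun z => Df k (t, z)) rho) => // z hz.
  have [d1 d2] := @slice_space (fun s z => Df k (s, z)) t z
     (ltac:(rewrite (_ : joint _ = Df k); [exact: dDf|by apply/funext => -[]])).
  split=> // v; rewrite deriveD_coord //; apply: coord_sum_bound => l.
  rewrite d2 (_ : joint _ = Df k); last by apply/funext => -[].
  exact: hM.
have ft x : differentiable (f t) x by case: (slice_space (df (t, x))).
have Dft x k : 'D_(delta_mx 0 k) (f t) x = Df k (t, x).
  by have [_ ->] := slice_space (df (t, x)).
exists (n%:R * (n%:R * M)); first by rewrite !mulr_ge0.
move=> x y hx hy.
have -> : f t y - f t x - (y - x) *m 'J (f t) x =
    f t (x + 1 *: (y - x)) - f t (x + 0 *: (y - x)) - (1 - 0) *: ((y - x) *m 'J (f t) x).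
  by rewrite subr0 !scale1r scale0r addr0 [x + _]addrC subrK.
rewrite -[leRHS]mulr1 -[X in _ * X](subr0 1).
apply: mean_value_line_affine => // r r01; split; first exact/diff_derivable/ft.
have hr := segment_in_cube hx hy r01.
rewrite (mulmx_jacobian _ (ft x)) !deriveD_coord // -sumrB.
rewrite (eq_bigr (fun k => (y - x) 0 k *: (Df k (t, x + r *: (y - x)) - Df k (t, x)))); last first.
  by move=> k _; rewrite !Dft -scalerBr.
have -> : n%:R * (n%:R * M) * `|y - x| ^+ 2 = n%:R * (n%:R * M * `|y - x|) * `|y - x| by ring.
apply: coord_sum_bound => k; apply: le_trans (Dlip _ _ _ hx hr) _.
rewrite ler_wpM2l ?mulr_ge0 // addrAC subrr add0r normrZ.
by case/andP: r01 => r0 r1; rewrite ger0_norm // ler_piMl.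
Qed.
End Slices.

(** * Bounds uniform in time drawn from A1 and A2 *)

Section FieldBounds.
Context {R : realType} {n m : nat}.
Notation V := 'rV[R]_n.
Variable b : 'I_m.+1 -> R -> V -> V.
Hypotheses (hA1 : assumption_A1 b) (hA2 : assumption_A2 b).

(** One constant serves as bound and as Lipschitz constant in both variables; only the space
    variable is restricted to the cube. *)
Definition lipschitz_on (f : R -> V -> V) (rho c : R) : Prop :=
  (forall t x, cube rho x -> `|f t x| <= c) /\
  (forall s t x y, cube rho x -> cube rho y -> `|f t y - f s x| <= c * (`|t - s| + `|y - x|)).

Lemma lipschitz_onW f rho c c' : c <= c' -> lipschitz_on f rho c -> lipschitz_on f rho c'.
Proof.
move=> cc' [h1 h2]; split=> [t x hx|s t x y hx hy]; first exact: le_trans (h1 _ _ hx) cc'.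
by apply: le_trans (h2 _ _ _ _ hx hy) _; rewrite ler_wpM2r ?addr_ge0.
Qed.

Let db i p : differentiable (joint (b i)) p.
Proof. by have [[h _] _] := hA1 i; exact: h. Qed.

Lemma lipschitz_on_criterion (f : R -> V -> V) (rho c A1 A2 A3 : R) :
  (forall p, differentiable (joint f) p) ->
  (forall t x, cube rho x -> `|f t x| <= A1) ->
  (forall t x, cube rho x -> `|derive1 (fun s => f s x) t| <= A2) ->
  (forall t x (v : V), cube rho x -> `|v *m 'J (f t) x| <= A3 * `|v|) ->
  A1 <= c -> A2 <= c -> A3 <= c -> lipschitz_on f rho c.
Proof.
move=> df h1 h2 h3 c1 c2 c3; split=> [t x hx|s t x y hx hy].
  exact: le_trans (h1 _ _ hx) c1.
have -> : f t y - f s x = (f t y - f t x) + (f t x - f s x) by rewrite addrA subrK.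
apply: le_trans (ler_normD _ _) _; rewrite mulrDr addrC; apply: lerD.
  apply: le_trans (_ : A2 * `|t - s| <= _); last by rewrite ler_wpM2r.
  apply: (@mean_value_time R n (fun s => f s x)) => r; split; last exact: h2.
  by have [? _] := slice_time (df (r, x)).
apply: le_trans (_ : A3 * `|y - x| <= _); last by rewrite ler_wpM2r.
apply: (@mean_value_space R n n (f t) rho) => // z hz.
have [dz _] := slice_space (df (t, z)); split=> // v.
by rewrite -(mulmx_jacobian _ dz); exact: h3.
Qed.

Lemma opnorm_bound (A : 'M[R]_n) (K : R) (v : V) : opnorm A <= K -> `|v *m A| <= K * n%:R * `|v|.
Proof.
move=> h; apply: le_trans (mxnorm_le_enorm _) _; apply: le_trans (opnorm_le _ _) _.
rewrite -mulrA; apply: le_trans (_ : K * enorm v <= _); first by rewrite ler_wpM2r ?enorm_ge0.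
rewrite ler_wpM2l ?enorm_le_mxnorm //; apply: le_trans h.
(* It remains to see that the operator norm is nonnegative: a nonzero vector shows it, and without
   one the supremum is that of the singleton 0. *)
have [v0|/= hv] := pselect (exists v : V, enorm v <> 0); last first.
  rewrite /opnorm (_ : [set _ | _ in _] = [set 0]) ?sup1 //.
  apply/seteqP; split => [_ [w _ <-]|_ ->] /=.
    have -> : w = 0 by apply: enorm_eq0; apply: contrapT => hw; apply: hv; exists w.
    by rewrite mul0mx -(scale0r (0 : V)) enormZ normr0 mul0r.
  exists 0; last by rewrite mul0mx -(scale0r (0 : V)) enormZ normr0 mul0r.
  by rewrite /= -(scale0r (0 : V)) enormZ normr0 mul0r.
case: v0 => w /eqP w0; have wp : 0 < enorm w by rewrite lt_neqAle eq_sym w0 enorm_ge0.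
have := le_trans (enorm_ge0 _) (opnorm_le A w).
by rewrite pmulr_lge0.
Qed.

Lemma field_bounds (rho : R) : exists2 c, 1 <= c &
  [/\ forall i, lipschitz_on (b i) rho c,
      forall i t x (z : V), cube rho x -> `|z *m 'J (b i t) x| <= c * `|z|
    & forall j k : 'I_m, lipschitz_on (lie (bu b j) (bu b k)) rho c].
Proof.
have [A1 [A2 [A3 [A4 [A5 [A6 [[A10 [A20 [A30 [A40 [A50 A60]]]]] H]]]]]]] :=
  hA2 (@cube_compact R n rho).
have n0 : 0 <= n%:R :> R by [].
pose a3 := A3 * n%:R; pose a5 := A5 * n%:R.
have a30 : 0 <= a3 by rewrite mulr_ge0.
have a50 : 0 <= a5 by rewrite mulr_ge0.
(* The factor n in a3 and a5 pays for the passage between norms; 2 a3 A1 bounds the brackets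
   themselves, through fields and Jacobians. *)
pose c := 1 + A1 + A2 + a3 + a5 + A6 + 2 * a3 * A1.
have p0 : 0 <= 2 * a3 * A1 by rewrite !mulr_ge0.
exists c; first by rewrite /c; lra.
have hb i t x : cube rho x -> `|b i t x| <= A1.
  move=> hx; have [/(_ i)[h _ _] _ _] := H x t hx.
  exact: le_trans (mxnorm_le_enorm _) h.
have hJ i t x (z : V) : cube rho x -> `|z *m 'J (b i t) x| <= a3 * `|z|.
  by move=> hx; have [/(_ i)[_ _ h] _ _] := H x t hx; exact: opnorm_bound.
split.
- move=> i; apply: (lipschitz_on_criterion (A1 := A1) (A2 := A2) (A3 := a3)) => //.
  + exact: hb.
  + move=> t x hx; have [/(_ i)[_ h _] _ _] := H x t hx.
    exact: le_trans (mxnorm_le_enorm _) h.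
  + by move=> t x v; exact: hJ.
  + by rewrite /c; lra.
  + by rewrite /c; lra.
  + by rewrite /c; lra.
- move=> i t x z hx; apply: le_trans (hJ _ _ _ _ hx) _.
  by rewrite ler_wpM2r // /c; lra.
have key (j k : 'I_m) : (j <= k)%N -> lipschitz_on (lie (bu b j) (bu b k)) rho c.
  move=> jk; apply: (lipschitz_on_criterion (A1 := 2 * a3 * A1) (A2 := A6) (A3 := a5)).
  + by apply: lie_differentiable; exact: hA1.
  + move=> t x hx; rewrite /lie; apply: le_trans (ler_normB _ _) _.
    have h1 := hJ (lift ord0 k) t x (bu b j t x) hx.
    have h2 := hJ (lift ord0 j) t x (bu b k t x) hx.
    have h3 := ler_wpM2l a30 (hb (lift ord0 j) t x hx).
    have h4 := ler_wpM2l a30 (hb (lift ord0 k) t x hx).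
    apply: le_trans (lerD (le_trans h1 h3) (le_trans h2 h4)) _.
    by rewrite le_eqVlt; apply/orP; left; apply/eqP; ring.
  + move=> t x hx; have [_ _ /(_ j k jk)[_ h]] := H x t hx.
    exact: le_trans (mxnorm_le_enorm _) h.
  + by move=> t x v hx; have [_ _ /(_ j k jk)[h _]] := H x t hx; exact: opnorm_bound.
  + by rewrite /c; lra.
  + by rewrite /c; lra.
  + by rewrite /c; lra.
(* A2 speaks of pairs j <= k only; the others follow by antisymmetry. *)
move=> j k; have [jk|/ltnW kj] := leqP j k; first exact: key.
have [h1 h2] := key k j kj.
have E t x : lie (bu b j) (bu b k) t x = - lie (bu b k) (bu b j) t x by rewrite /lie opprB.
split=> [t x hx|s t x y hx hy]; first by rewrite E normrN; exact: h1.
by rewrite !E -opprD normrN; exact: h2.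
Qed.

End FieldBounds.

(** * Control fields and their brackets *)

Section Combination.
Context {R : realType} {n m : nat}.
Notation V := 'rV[R]_n.
Notation W := 'rV[R]_m.
Implicit Types (v w : W) (z : 'I_m -> V).

Definition lincomb v z : V := \sum_i v 0 i *: z i.

Lemma lincombD v w z : lincomb (v + w) z = lincomb v z + lincomb w z.
Proof. by rewrite -big_split; apply: eq_bigr => i _; rewrite mxE scalerDl. Qed.

Lemma lincombZ (a : R) v z : lincomb (a *: v) z = a *: lincomb v z.
Proof. by rewrite scaler_sumr; apply: eq_bigr => i _; rewrite mxE scalerA. Qed.

Lemma lincombB v w z : lincomb (v - w) z = lincomb v z - lincomb w z.
Proof. by rewrite lincombD -scaleN1r lincombZ scaleN1r. Qed.

Lemma lincomb0 z : lincomb 0 z = 0.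
Proof. by rewrite -(scale0r (0 : W)) lincombZ scale0r. Qed.

Lemma lincombDr v z z' : lincomb v (fun i => z i + z' i) = lincomb v z + lincomb v z'.
Proof. by rewrite -big_split; apply: eq_bigr => i _; rewrite scalerDr. Qed.

Lemma lincombBr v z z' : lincomb v (fun i => z i - z' i) = lincomb v z - lincomb v z'.
Proof. by rewrite -sumrB; apply: eq_bigr => i _; rewrite scalerBr. Qed.

Lemma lincombZr v (a : R) z : lincomb v (fun i => a *: z i) = a *: lincomb v z.
Proof. by rewrite scaler_sumr; apply: eq_bigr => i _; rewrite !scalerA mulrC. Qed.

Lemma lincomb_eq v z z' : (forall i, z i = z' i) -> lincomb v z = lincomb v z'.
Proof. by move=> h; apply: eq_bigr => i _; rewrite h. Qed.

Lemma lincomb_bound v z (K : R) : (forall i, `|z i| <= K) -> `|lincomb v z| <= m%:R * K * `|v|.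
Proof. exact: coord_sum_bound. Qed.

Lemma bmeas_VLintegrable (p : nat) (a b : R) (g : R -> 'rV[R]_p) :
  (forall i, bmeas a b (fun s => g s 0 i)) -> VLintegrable a b g.
Proof. by move=> h i; exact: bmeas_Lintegrable. Qed.

Lemma bmeas_lincomb (a b : R) (g : R -> W) (Z : R -> 'I_m -> V) :
  (forall i, bmeas a b (fun s => g s 0 i)) ->
  (forall i k, bmeas a b (fun s => Z s i 0 k)) ->
  forall k, bmeas a b (fun s => lincomb (g s) (Z s) 0 k).
Proof.
move=> hg hZ k.
rewrite (_ : (fun s => _) = fun s => \sum_i g s 0 i * Z s i 0 k); last first.
  by apply/funext => s; rewrite summxE; apply: eq_bigr => i _; rewrite mxE.
by apply: bmeas_sum => i _; apply: bmeasM.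
Qed.

Lemma Lint_sum (a b : R) (I : Type) (r : seq I) (F : I -> R -> R) :
  a <= b -> (forall i, Lintegrable a b (F i)) ->
  Lintegrable a b (fun s => \sum_(i <- r) F i s) /\
  Lint a b (fun s => \sum_(i <- r) F i s) = \sum_(i <- r) Lint a b (F i).
Proof.
move=> ab hF; elim: r => [|i r [IH1 IH2]].
  have E : (fun s : R => \sum_(i <- [::]) F i s) = fun=> 0.
    by apply/funext => s; rewrite big_nil.
  rewrite E big_nil Lint_cst // mul0r; split=> //.
  exact/bmeas_Lintegrable/bmeas_cst.
have E : (fun s : R => \sum_(j <- i :: r) F j s) = fun s => F i s + \sum_(j <- r) F j s.
  by apply/funext => s; rewrite big_cons.
rewrite E big_cons LintD // IH2; split=> //.
exact: LintegrableD.
Qed.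

Lemma VLint_lincomb (a b : R) (g : R -> W) z : a <= b -> VLintegrable a b g ->
  VLintegrable a b (fun s => lincomb (g s) z) /\
  VLint a b (fun s => lincomb (g s) z) = lincomb (VLint a b g) z.
Proof.
move=> ab hg.
have E k : (fun s => lincomb (g s) z 0 k) = fun s => \sum_i z i 0 k * g s 0 i.
  by apply/funext => s; rewrite summxE; apply: eq_bigr => i _; rewrite mxE mulrC.
have H k := @Lint_sum a b _ (index_enum 'I_m) (fun i s => z i 0 k * g s 0 i) ab
   (fun i => LintegrableZ _ (hg i)).
split=> [k|]; first by rewrite E; case: (H k).
apply/rowP => k; rewrite mxE E (H k).2 summxE; apply: eq_bigr => i _.
by rewrite LintZ // !mxE mulrC.
Qed.

Lemma sum_pairs (F : 'I_m -> 'I_m -> V) : (forall i, F i i = 0) ->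
  \sum_(i < m) \sum_(j < m) F i j = \sum_(i < m) \sum_(j < m | (i < j)%N) (F i j + F j i).
Proof.
move=> F0.
have E (i : 'I_m) : \sum_j F i j =
    \sum_(j < m | (i < j)%N) F i j + \sum_(j < m | (j < i)%N) F i j.
  rewrite (bigD1 i) //= F0 add0r (bigID (fun j : 'I_m => (i < j)%N)) /=; congr (_ + _).
    apply: eq_bigl => j; case: ltngtP => // ij; rewrite ?andbF ?andbT //.
      by apply/eqP => h; move: ij; rewrite h ltnn.
  apply: eq_bigl => j; rewrite -leqNgt ltn_neqAle; congr (_ && _).
rewrite (eq_bigr _ (fun i _ => E i)) big_split /= [X in _ + X](exchange_big_dep xpredT) //=.
by rewrite -big_split; apply: eq_bigr => i _; rewrite -big_split.
Qed.

(** The summand is symmetric in i and j because both factors change sign, so every pair is counted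
    twice and the half compensates. The minus sign comes from writing L i j for L j i. *)
Lemma sum_antisym (q : 'I_m -> 'I_m -> R) (L : 'I_m -> 'I_m -> V) :
  (forall i j, q i j = - q j i) -> (forall i j, L i j = - L j i) ->
  2^-1 *: (\sum_(j < m) \sum_(i < m) q i j *: L j i) =
  - \sum_(i < m) \sum_(j < m | (i < j)%N) q i j *: L i j.
Proof.
move=> aq aL; rewrite exchange_big /= sum_pairs; last first.
  move=> i; have : q i i = 0 by have := aq i i; lra.
  by move=> ->; rewrite scale0r.
rewrite scaler_sumr -sumrN; apply: eq_bigr => i _.
rewrite scaler_sumr -sumrN; apply: eq_bigr => j _.
rewrite (aq j i) (aL j i); by apply/rowP => k; rewrite !mxE; field.
Qed.

End Combination.

Section Brackets.
Context {R : realType} {n m : nat}.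
Notation V := 'rV[R]_n.
Notation W := 'rV[R]_m.
Variables (b : 'I_m.+1 -> R -> V -> V) (u : 'I_m -> R -> R -> R) (T : R).

Definition uvec (t th : R) : W := \row_i u i t th.

Definition control (t : R) (v : W) (y : V) : V := lincomb v (fun i => bu b i t y).

Definition dcontrol (t : R) (v : W) (y z : V) : V :=
  lincomb v (fun i => z *m 'J (bu b i t) y).

(** The bracket [X w, X v] of combinations of the control fields at frozen time, expanded by
    bilinearity so that the bounds on the single brackets apply to it. *)
Definition brk (t : R) (y : V) (v w : W) : V :=
  lincomb w (fun j => lincomb v (fun i => lie (bu b j) (bu b i) t y)).

Lemma input_affineE (w t : R) (y : V) :
  input_affine b u w t y = b ord0 t y + Num.sqrt w *: control t (uvec t (w * t)) y.
Proof.
rewrite /input_affine; congr (_ + _); rewrite scaler_sumr.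
by apply: eq_bigr => i _; rewrite mxE scalerA.
Qed.

Lemma bracket_control (t : R) (v w : W) (y : V) :
  bracket (control t) (dcontrol t) v w y = brk t y v w.
Proof.
rewrite /bracket /brk /dcontrol /control.
have E1 : lincomb v (fun i => lincomb w (fun j => bu b j t y) *m 'J (bu b i t) y) =
    \sum_i \sum_j (v 0 i * w 0 j) *: (bu b j t y *m 'J (bu b i t) y).
  apply: eq_bigr => i _; rewrite mulmx_suml scaler_sumr; apply: eq_bigr => j _.
  by rewrite -scalemxAl scalerA.
have E2 : lincomb w (fun j => lincomb v (fun i => bu b i t y) *m 'J (bu b j t) y) =
    \sum_i \sum_j (v 0 i * w 0 j) *: (bu b i t y *m 'J (bu b j t) y).
  rewrite exchange_big; apply: eq_bigr => j _; rewrite mulmx_suml scaler_sumr.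
  by apply: eq_bigr => i _; rewrite -scalemxAl scalerA mulrC.
rewrite E1 E2 -sumrB [RHS]/lincomb.
transitivity (\sum_(i < m) \sum_(j < m) (v 0 i * w 0 j) *: lie (bu b j) (bu b i) t y).
  by apply: eq_bigr => i _; rewrite -sumrB; apply: eq_bigr => j _; rewrite /lie scalerBr.
rewrite exchange_big; apply: eq_bigr => j _; rewrite scaler_sumr.
by apply: eq_bigr => i _; rewrite scalerA mulrC.
Qed.

Lemma lie_anti (f g : R -> V -> V) t y : lie f g t y = - lie g f t y.
Proof. by rewrite /lie opprB. Qed.

Variables (rho c : R).
Hypotheses (c1 : 1 <= c) (T0 : 0 < T) (Tc : T <= c).
Hypothesis b_lip : forall i, lipschitz_on (b i) rho c.
Hypothesis b_jac : forall i t x (z : V), cube rho x -> `|z *m 'J (b i t) x| <= c * `|z|.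
Hypothesis lie_lip : forall j k : 'I_m, lipschitz_on (lie (bu b j) (bu b k)) rho c.

Let M : R := m.+1%:R.
Let C : R := M ^+ 2 * c.

Let M1 : 1 <= M. Proof. by rewrite ler1n. Qed.
Let mM : m%:R <= M. Proof. by rewrite ler_nat. Qed.
Let cC : c <= C. Proof. by rewrite ler_peMl ?expr_ge1 // (le_trans _ c1). Qed.
Let mcC : m%:R * c <= C.
Proof.
rewrite ler_wpM2r ?(le_trans _ c1) //; apply: le_trans mM _.
by rewrite expr2 ler_peMl // (le_trans _ M1).
Qed.
Let mmcC : m%:R * (m%:R * c) <= C.
Proof. by rewrite mulrA ler_wpM2r ?(le_trans _ c1) // expr2 ler_pM. Qed.

Lemma control_bound t v y : cube rho y -> `|control t v y| <= C * `|v|.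
Proof.
move=> hy; apply: le_trans (lincomb_bound (K := c) _ _) _.
  by move=> i; case: (b_lip (lift ord0 i)) => h _; exact: h.
by rewrite ler_wpM2r.
Qed.

Lemma control_lip s t v y y' : cube rho y -> cube rho y' ->
  `|control t v y' - control s v y| <= C * `|v| * (`|t - s| + `|y' - y|).
Proof.
move=> hy hy'; rewrite /control -lincombBr.
apply: le_trans (lincomb_bound (K := c * (`|t - s| + `|y' - y|)) _ _) _.
  by move=> i; case: (b_lip (lift ord0 i)) => _ h; exact: h.
rewrite mulrA [leLHS]mulrAC ler_wpM2r ?addr_ge0 // ler_wpM2r //.
Qed.

Lemma dcontrol_bound t v y z : cube rho y -> `|dcontrol t v y z| <= C * `|v| * `|z|.
Proof.
move=> hy; apply: le_trans (lincomb_bound (K := c * `|z|) _ _) _.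
  by move=> i; exact: b_jac.
by rewrite mulrA [leLHS]mulrAC ler_wpM2r // ler_wpM2r.
Qed.

Lemma brk_bound t y v w : cube rho y -> `|brk t y v w| <= C * `|v| * `|w|.
Proof.
move=> hy; apply: le_trans (lincomb_bound (K := m%:R * c * `|v|) _ _) _.
  move=> j; apply: lincomb_bound => i.
  by case: (lie_lip j i) => h _; exact: h.
by rewrite ler_wpM2r // mulrA ler_wpM2r.
Qed.

Lemma brk_lip t y y' v w : cube rho y -> cube rho y' ->
  `|brk t y v w - brk t y' v w| <= C * `|v| * `|w| * `|y - y'|.
Proof.
move=> hy hy'; rewrite /brk -lincombBr.
apply: le_trans (lincomb_bound (K := m%:R * (c * `|y - y'|) * `|v|) _ _) _.
  move=> j; rewrite -lincombBr; apply: lincomb_bound => i.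
  case: (lie_lip j i) => _ h; have := h t t y' y hy' hy.
  by rewrite (subrr t) normr0 add0r.
have -> : m%:R * (m%:R * (c * `|y - y'|) * `|v|) * `|w| =
  m%:R * (m%:R * c) * (`|v| * `|w| * `|y - y'|) by ring.
have -> : C * `|v| * `|w| * `|y - y'| = C * (`|v| * `|w| * `|y - y'|) by ring.
by rewrite ler_wpM2r ?mulr_ge0.
Qed.

Lemma control_taylor t : (forall i, C2 (joint (b i))) ->
  exists2 K, 0 <= K & forall v y y', cube rho y -> cube rho y' ->
   `|control t v y' - control t v y - dcontrol t v y (y' - y)| <= K * `|v| * `|y' - y| ^+ 2.
Proof.
move=> hC2.
have [K hK] := choice (fun i : 'I_m =>
  (ltac:(by have [K ? ?] := @taylor_cube R n (bu b i) rho t (hC2 _); exists K) :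
   exists K, 0 <= K /\ forall x y, cube rho x -> cube rho y ->
    `|bu b i t y - bu b i t x - (y - x) *m 'J (bu b i t) x| <= K * `|y - x| ^+ 2)).
pose K1 := \sum_i K i.
have K0 : 0 <= K1 by apply: sumr_ge0 => i _; case: (hK i).
exists (m%:R * K1); first by rewrite mulr_ge0.
move=> v y y' hy hy'; rewrite /control /dcontrol -!lincombBr.
have -> : m%:R * K1 * `|v| * `|y' - y| ^+ 2 = m%:R * (K1 * `|y' - y| ^+ 2) * `|v| by ring.
apply: lincomb_bound => i; apply: le_trans ((hK i).2 _ _ hy hy') _.
rewrite ler_wpM2r ?sqr_ge0 // /K1 (bigD1 i) //= lerDl.
by apply: sumr_ge0 => j _; case: (hK j).
Qed.

End Brackets.

(** * One period of the input *)

Section OneStep.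
Context {R : realType} {n m : nat}.
Notation V := 'rV[R]_n.
Notation W := 'rV[R]_m.
Variables (b : 'I_m.+1 -> R -> V -> V) (u : 'I_m -> R -> R -> R) (T rho c : R).
Hypotheses (c1 : 1 <= c) (T0 : 0 < T) (Tc : T <= c).
Hypothesis b_C2 : forall i, C2 (joint (b i)).
Hypothesis b_lip : forall i, lipschitz_on (b i) rho c.
Hypothesis b_jac : forall i t x (z : V), cube rho x -> `|z *m 'J (b i t) x| <= c * `|z|.
Hypothesis lie_lip : forall j k : 'I_m, lipschitz_on (lie (bu b j) (bu b k)) rho c.
Hypothesis u_meas : forall i, lebesgue_measurable_fun2 (fun p => u i p.1 p.2).
Hypothesis u_lip : forall i t1 t2 th, `|u i t1 th - u i t2 th| <= c * `|t1 - t2|.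
Hypothesis u_bound : forall i t th, `|u i t th| <= c.
Hypothesis u_mean : assumption_A4 u T.

(** Dominates c, m c and m^2 c, which arise from sums over no, one or two input indices. *)
Definition step_const : R := m.+1%:R ^+ 2 * c.
Notation C := step_const.

Lemma step_const_ge : c <= C.
Proof. by rewrite ler_peMl ?expr_ge1 ?ler1n // (le_trans _ c1). Qed.

Let C1 : 1 <= C. Proof. exact: le_trans c1 step_const_ge. Qed.
Let C0 : 0 <= C. Proof. exact: le_trans C1. Qed.
Let c0 : 0 <= c. Proof. exact: le_trans c1. Qed.

Lemma u_bmeas i t a0 b0 : bmeas a0 b0 (u i t).
Proof.
apply/bmeasP; split; last by exists c => s _; exact: u_bound.
exact/measurable_funTS/(section_measurable (u_meas i) (u_lip i)).
Qed.

Lemma uvec_bound t th : `|uvec u t th| <= C.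
Proof.
apply: mxnorm_leP => // i; rewrite mxE; apply: le_trans step_const_ge; exact: u_bound.
Qed.

Lemma uvec_lip s t th : `|uvec u t th - uvec u s th| <= C * `|t - s|.
Proof.
apply: mxnorm_leP => [|i]; first by rewrite mulr_ge0.
rewrite !mxE; apply: le_trans (u_lip _ _ _ _) _; rewrite ler_wpM2r //; exact: step_const_ge.
Qed.

Lemma input_affine_bound w t y : 1 <= Num.sqrt w -> cube rho y ->
  `|input_affine b u w t y| <= 2 * C ^+ 2 * Num.sqrt w.
Proof.
move=> r1 hy; have r0 : 0 <= Num.sqrt w by exact: sqrtr_ge0.
rewrite input_affineE; apply: le_trans (ler_normD _ _) _.
have k1 : `|b ord0 t y| <= C ^+ 2 * Num.sqrt w.
  apply: le_trans ((b_lip ord0).1 _ _ hy) _; apply: le_trans step_const_ge _.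
  by rewrite expr2 -mulrA ler_peMr // mulr_ege1.
have k2 : `|Num.sqrt w *: control b t (uvec u t (w * t)) y| <= C ^+ 2 * Num.sqrt w.
  rewrite normrZ ger0_norm // mulrC ler_wpM2r //.
  apply: le_trans (control_bound c1 b_lip _ _ hy) _.
  by rewrite expr2 ler_wpM2l //; exact: uvec_bound.
apply: le_trans (lerD k1 k2) _.
by have -> : 2 * C ^+ 2 * Num.sqrt w = C ^+ 2 * Num.sqrt w + C ^+ 2 * Num.sqrt w by ring.
Qed.

Section Fixed.
(** h = w^(-1/2) is the small parameter and e = T h^2 the period. The condition [hC] keeps the
    reference path within distance 1 of x(a), hence in the cube, and gives C |v| <= 1/2 for the
    values v of the fast primitive. *)
Variables (w a : R) (x : R -> V).
Let r := Num.sqrt w.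
Let h := r^-1.
Let e := T / w.
Hypotheses (w0 : 0 < w) (hC : 2 * C ^+ 3 * h <= 1).
Hypothesis xa : `|x a| <= rho - 1.
Hypothesis x_cube : forall s, a <= s <= a + e -> cube rho (x s).
Hypothesis x_int : forall s t, a <= s -> s <= t -> t <= a + e ->
  VLintegrable s t (fun ta => input_affine b u w ta (x ta)) /\
  x t - x s = VLint s t (fun ta => input_affine b u w ta (x ta)).

(* The slow time argument of the inputs is frozen at the start of the step. *)
Definition fast_input (ta : R) : W := r *: uvec u a (w * ta).
Notation g := fast_input.
Definition fast_primitive (s : R) : W := VLint a s g.
Notation Vp := fast_primitive.

Let r0 : 0 < r. Proof. by rewrite sqrtr_gt0. Qed.
Let h0 : 0 < h. Proof. by rewrite invr_gt0. Qed.
Let hr : h * r = 1. Proof. by rewrite mulVf // gt_eqF. Qed.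
Let rr : r ^+ 2 = w. Proof. by rewrite sqr_sqrtr // ltW. Qed.
Let C3 : 1 <= C ^+ 3. Proof. exact: exprn_ege1. Qed.
Let h1 : h <= 1.
Proof.
apply: le_trans hC; rewrite ler_peMl ?(ltW h0) //.
apply: le_trans C3 _; rewrite ler_peMl ?exprn_ge0 //; lra.
Qed.
Let r1 : 1 <= r. Proof. by rewrite -hr ler_piMl // ltW. Qed.
Let eE : e = T * h ^+ 2.
Proof. by rewrite /e -rr exprVn. Qed.
Let eC : e <= C * h ^+ 2.
Proof. by rewrite eE ler_wpM2r ?sqr_ge0 //; exact: le_trans Tc step_const_ge. Qed.
Let e0 : 0 < e. Proof. exact: divr_gt0. Qed.

Lemma fast_input_bound ta : `|g ta| <= C * r.
Proof. by rewrite normrZ gtr0_norm // mulrC ler_wpM2r ?(ltW r0) //; exact: uvec_bound. Qed.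

Lemma fast_input_bmeas i s t : bmeas s t (fun ta => g ta 0 i).
Proof.
have [hb _] := @Lint_affine R w 0 s t (u i a) w0 (u_bmeas i a _ _).
rewrite (_ : (fun ta => _) = fun ta => r * u i a (w * ta + 0)).
  by apply: bmeasM => //; exact: bmeas_cst.
by apply/funext => ta; rewrite !mxE addr0.
Qed.

Let g_int s t : VLintegrable s t g.
Proof. by apply: bmeas_VLintegrable => i; exact: fast_input_bmeas. Qed.

Lemma fast_primitiveB s t : a <= s -> s <= t -> Vp t - Vp s = VLint s t g.
Proof. by move=> as_ st; rewrite /Vp (@VLint_chasles _ _ a s t) // addrC addKr. Qed.

Lemma fast_primitive_lip s t : a <= s -> s <= t -> `|Vp t - Vp s| <= C * r * (t - s).
Proof.
move=> as_ st; rewrite fast_primitiveB //; apply: VLint_le => // ta _.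
exact: fast_input_bound.
Qed.

Lemma fast_primitive_start : Vp a = 0.
Proof. exact: VLint_point. Qed.

Lemma fast_primitive_bound s : a <= s <= a + e -> `|Vp s| <= C ^+ 2 * h.
Proof.
case/andP => as_ se; have := fast_primitive_lip (lexx a) as_.
rewrite fast_primitive_start subr0 => /le_trans; apply.
have -> : C ^+ 2 * h = C * r * (C * h ^+ 2).
  by transitivity (C ^+ 2 * h * (h * r)); [rewrite hr mulr1|ring].
rewrite ler_wpM2l ?mulr_ge0 ?(ltW r0) //; apply: le_trans eC; lra.
Qed.

Lemma fast_primitive_end : Vp (a + e) = 0.
Proof.
apply/rowP => i; rewrite !mxE.
rewrite (@Lint_eq _ _ _ _ (fun ta => r * u i a (w * ta))); last by move=> s _; rewrite !mxE.
have per s : u i a (s + T) = u i a s by case: (u_mean i a).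
have mean : Lint 0 T (u i a) = 0 by case: (u_mean i a).
rewrite LintZ; last first.
  have [hb _] := @Lint_affine R w 0 a (a + e) (u i a) w0 (u_bmeas i a _ _).
  apply: Lintegrable_eq (bmeas_Lintegrable hb) => s _; by rewrite addr0.
rewrite (@Lint_fast_mean0 R T (u i a)) ?mulr0 // => *; exact: u_bmeas.
Qed.

Lemma step_speed s t : a <= s -> s <= t -> t <= a + e ->
  `|x t - x s| <= 2 * C ^+ 2 * r * (t - s).
Proof.
move=> as_ st te; have [hi ->] := x_int as_ st te.
apply: VLint_le => // ta /andP[sta tat].
apply: input_affine_bound => //; apply: x_cube.
by rewrite (le_trans as_ sta) (le_trans tat te).
Qed.

Lemma step_range s : a <= s <= a + e -> `|x s - x a| <= 2 * C ^+ 3 * h.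
Proof.
case/andP => as_ se; apply: le_trans (step_speed (lexx a) as_ se) _.
have -> : 2 * C ^+ 3 * h = 2 * C ^+ 2 * r * (C * h ^+ 2).
  by transitivity (2 * C ^+ 3 * h * (h * r)); [rewrite hr mulr1|ring].
rewrite ler_wpM2l ?mulr_ge0 ?exprn_ge0 ?(ltW r0) //; apply: le_trans eC; lra.
Qed.

Let near_cube y : `|y - x a| <= 1 -> cube rho y.
Proof.
move=> hy; rewrite /cube /= -[y](subrK (x a)); apply: le_trans (ler_normD _ _) _.
move: hy xa; lra.
Qed.

(** From [polygon_variation]: the factor C r comes from the increment of the control, C^4 h^2 from
    |v|^2, and the final 1 from the choice of N. *)
Let A0 : R := C * (2 * (C ^+ 2 + C ^+ 3) * C ^+ 4 + 1).

(* The reference path: the time-one polygon of the frozen control fields, driven by the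
   primitive of the fast input, which returns to its start at the end of the period. *)
Lemma reference_path : exists P : R -> V, [/\
  P a = x a, P (a + e) = x a,
  forall s, a <= s <= a + e -> `|P s - x a| <= C ^+ 3 * h
  & exists2 K, 0 <= K & forall s t, a <= s -> s <= t -> t <= a + e ->
    `|P t - P s - control b a (Vp t - Vp s) (P s) - 2^-1 *: brk b a (x a) (Vp s) (Vp t - Vp s)|
      <= (A0 * h + K * (t - s)) * (t - s)].
Proof.
have [K K0 taylor] := @control_taylor R n m b rho a b_C2.
pose K' := 8 * K * C ^+ 2 + 4 * C ^+ 2.
have K'0 : 0 <= K' by rewrite addr_ge0 ?mulr_ge0 ?exprn_ge0.
(* K depends on the time a, hence so does N, chosen so that K' / N <= h^2. The other term K' |dv|
   gives a contribution quadratic in t - s. *)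
pose N := (Num.truncn (K' / h ^+ 2)).+1.
have N0 : (0 < N)%N by [].
have KN : K' * N%:R^-1 <= h ^+ 2.
  rewrite ler_pdivrMr ?ltr0n // mulrC -ler_pdivrMr ?exprn_gt0 //.
  by apply: ltW; exact: truncnS_gt.
have Cv s : a <= s <= a + e -> C * `|Vp s| <= 2^-1.
  move=> /fast_primitive_bound hv; apply: le_trans (ler_wpM2l C0 hv) _; move: hC.
  have -> : C * (C ^+ 2 * h) = C ^+ 3 * h by ring.
  lra.
have Cv1 s : a <= s <= a + e -> C * `|Vp s| <= 1 by move=> /Cv; lra.
have aa : a <= a <= a + e by rewrite lexx lerDl ltW.
have ee : a <= a + e <= a + e by rewrite lexx lerDl ltW.
have X_bd v y : `|y - x a| <= 1 -> `|control b a v y| <= C * `|v|.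
  by move=> /near_cube; exact: control_bound.
have pz : polygon (control b a) (x a) N 0 N = x a.
  suff : forall k, polygon (control b a) (x a) N 0 k = x a by apply.
  by elim=> //= k ->; rewrite /control lincomb0 scaler0 addr0.
exists (fun s => polygon (control b a) (x a) N (Vp s) N); split.
- by rewrite fast_primitive_start.
- by rewrite fast_primitive_end.
- move=> s hs.
  have [hp _] := @polygon_near R W n (control b a) (x a) 1 C C1 X_bd N N0 (Vp s) N (Cv1 s hs) (leqnn N).
  apply: le_trans hp _; rewrite divff ?mul1r ?pnatr_eq0 //.
  have -> : C ^+ 3 * h = C * (C ^+ 2 * h) by ring.
  by rewrite ler_wpM2l //; exact: fast_primitive_bound.
exists (K' * (C * r) ^+ 2); first by rewrite mulr_ge0 ?sqr_ge0.
move=> s t as_ st te.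
have hs : a <= s <= a + e by rewrite as_ (le_trans st te).
have ht : a <= t <= a + e by rewrite (le_trans as_ st).
set v := Vp s; set dv := Vp t - Vp s.
have vdv : v + dv = Vp t by rewrite /v /dv addrC subrK.
have br_lip v' w' y : `|y - x a| <= 1 ->
   `|bracket (control b a) (dcontrol b a) v' w' y - bracket (control b a) (dcontrol b a) v' w' (x a)|
    <= C * `|v'| * `|w'| * `|y - x a|.
  move=> hy; rewrite !bracket_control; apply: (brk_lip c1 lie_lip) => //; first exact: near_cube.
  by apply: near_cube; rewrite subrr normr0.
have := @polygon_variation R W n (control b a) (dcontrol b a) (x a) 1 C K C1 K0
  (fun v w y => lincombD _ _ _)
  (fun v y z z' => etrans (lincomb_eq _ (fun i => mulmxDl _ _ _)) (lincombDr _ _ _))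
  (fun v y k z => etrans (lincomb_eq _ (fun i => esym (scalemxAl _ _ _))) (lincombZr _ _ _))
  X_bd
  (fun v y y' hy hy' => ltac:(have := control_lip c1 b_lip a a v (near_cube hy) (near_cube hy');
     rewrite (subrr a) normr0 add0r; exact))
  (fun v y z hy => dcontrol_bound c1 b_jac a v z (near_cube hy))
  (fun v y y' hy hy' => taylor v y y' (near_cube hy) (near_cube hy'))
  br_lip N N0 v dv (Cv1 s hs) (ltac:(rewrite vdv; exact: Cv1)) (Cv s hs).
rewrite bracket_control vdv; have -> : 8 * K * C ^+ 2 + 4 * C ^+ 2 = K' by [].
move=> H.
have v1 : `|v| <= 1.
  by apply: le_trans (Cv1 s hs); rewrite ler_peMl.
apply: le_trans (H v1) _.
have dvb := fast_primitive_lip as_ st; rewrite -/dv in dvb.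
have vb := fast_primitive_bound hs; rewrite -/v in vb.
have ts0 : 0 <= t - s by rewrite subr_ge0.
have -> : (A0 * h + K' * (C * r) ^+ 2 * (t - s)) * (t - s) =
   C * r * (t - s) * ((2 * (C ^+ 2 + C ^+ 3) * (C ^+ 2 * h) ^+ 2 + h ^+ 2) + K' * (C * r * (t - s))).
  transitivity ((A0 * (h * (h * r)) + K' * (C * r) ^+ 2 * (t - s)) * (t - s)).
    by rewrite hr mulr1.
  by rewrite /A0; ring.
apply: ler_pM => //.
  apply: addr_ge0; last first.
    by apply: (mulr_ge0 K'0); apply: addr_ge0 => //; rewrite invr_ge0 ler0n.
  by rewrite !mulr_ge0 ?exprn_ge0 // addr_ge0 ?exprn_ge0.
rewrite [K' * (_ + _)]mulrDr [K' * `|dv| + _]addrC addrA; apply: lerD; last by rewrite ler_wpM2l.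
apply: lerD => //; rewrite ler_wpM2l ?mulr_ge0 ?addr_ge0 ?exprn_ge0 //.
by rewrite lerXn2r ?nnegrE ?mulr_ge0 ?exprn_ge0 ?(ltW h0).
Qed.

(** C (C + 2 C^3) comes from freezing the drift, one C^3 each from freezing the slow time in the
    control fields and in the inputs, A0 from the reference path. *)
Let A1 : R := C * (C + 2 * C ^+ 3) + 2 * C ^+ 3 + A0.

(** The a priori bound E0 on x - P enters only through the Lipschitz error C^2 r E0 of the control
    term. Over a time O(h^2) this contributes O(h E0), so any bound can be fed back in improved
    form; hence the statement for an arbitrary E0. *)
Lemma step_increment (P : R -> V) (K E0 : R) : 0 <= K -> 0 <= E0 ->
  P a = x a ->
  (forall s, a <= s <= a + e -> `|P s - x a| <= C ^+ 3 * h) ->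
  (forall s t, a <= s -> s <= t -> t <= a + e ->
    `|P t - P s - control b a (Vp t - Vp s) (P s) - 2^-1 *: brk b a (x a) (Vp s) (Vp t - Vp s)|
      <= (A0 * h + K * (t - s)) * (t - s)) ->
  (forall s, a <= s <= a + e -> `|x s - P s| <= E0) ->
  forall s, a <= s <= a + e ->
  `|x s - P s - (s - a) *: b ord0 a (x a) +
     2^-1 *: VLint a s (fun ta => brk b a (x a) (Vp ta) (g ta))| <=
  (A1 * h + C ^+ 2 * r * E0) * (s - a).
Proof.
move=> K0 E00 Pa Pb Pinc xP s hs.
pose B ta := brk b a (x a) (Vp ta) (g ta).
have aa : a <= a <= a + e by rewrite lexx lerDl ltW.
have xac : cube rho (x a) by exact: x_cube.
have x0c : cube rho (x a) := xac.
have rC0 : 0 <= C * r by rewrite mulr_ge0 // ltW.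
have Vp_bmeas i : bmeas a (a + e) (fun ta => Vp ta 0 i).
  apply: (bmeas_lip (K := C * r)) => s1 t1 h2 h3 h4.
  apply: le_trans (_ : `|Vp t1 - Vp s1| <= _); last exact: fast_primitive_lip.
  by apply: le_trans (coord_le_mxnorm _ i); rewrite !mxE.
have B_bmeas k : bmeas a (a + e) (fun ta => B ta 0 k).
  apply: bmeas_lincomb => [i|i k']; first exact: fast_input_bmeas.
  apply: bmeas_lincomb => [j|j k'']; first exact: Vp_bmeas.
  exact: bmeas_cst.
have B_int s1 t1 : a <= s1 -> t1 <= a + e -> VLintegrable s1 t1 B.
  by move=> h2 h3 k; apply: bmeas_Lintegrable; apply: bmeasS (B_bmeas k).
pose G s := x s - P s - (s - a) *: b ord0 a (x a) + 2^-1 *: VLint a s B.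
have Ga : G a = 0.
  rewrite /G Pa !subrr scale0r subr0 VLint_point ?scaler0 ?addr0 //.
  by apply: B_int => //; rewrite lerDl ltW.
case/andP: hs => as_ se.
suff : `|G s - G a| <= (A1 * h + C ^+ 2 * r * E0) * (s - a) by rewrite Ga subr0.
(* Coefficients of the quadratic terms: motion of x during the substep, variation of the primitive
   inside the bracket, and the remainder of the reference path. They may be large in w, since
   [increment_bound] discards them. *)
pose K2 := 2 * C ^+ 4 * r ^+ 2 + C * (C * r) ^+ 2 / 2 + K.
apply: (@increment_bound _ _ _ _ _ _ K2) => // s1 t1 h2 h3 h4.
have t1e : t1 <= a + e by exact: le_trans se.
have hs1 : a <= s1 <= a + e by rewrite h2 (le_trans h3 t1e).
set dv := Vp t1 - Vp s1.
have [F_int Fx] := x_int h2 h3 t1e.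
(* The terms linear in the fast input integrate exactly to the terms in dv of the expansion of P, so
   the integral of I is the increment of G up to the remainder of P. *)
pose I ta := input_affine b u w ta (x ta) - b ord0 a (x a) - control b a (g ta) (P s1)
  + 2^-1 *: (B ta - brk b a (x a) (Vp s1) (g ta)).
pose F ta := input_affine b u w ta (x ta).
have cst_int (z : V) : VLintegrable s1 t1 (fun _ => z).
  by move=> k; apply/bmeas_Lintegrable/bmeas_cst.
have [c_int cE] := @VLint_lincomb R n m s1 t1 g (fun i => bu b i a (P s1)) h3 (g_int _ _).
have [k_int kE] := @VLint_lincomb R n m s1 t1 g
  (fun j => lincomb (Vp s1) (fun i => lie (bu b j) (bu b i) a (x a))) h3 (g_int _ _).
rewrite -fast_primitiveB // -/dv in cE kE.
have Bst : VLintegrable s1 t1 B by exact: B_int.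
have q1 : VLintegrable s1 t1 (fun ta => F ta - b ord0 a (x a)) := VLintegrableB F_int (cst_int _).
have q2 := VLintegrableB q1 c_int.
have q3 := VLintegrableB Bst k_int.
have q4 := VLintegrableZ (2^-1) q3.
have I_int : VLintegrable s1 t1 I := VLintegrableD q2 q4.
have II : VLint s1 t1 I = (x t1 - x s1) - (t1 - s1) *: b ord0 a (x a) - control b a dv (P s1)
    + 2^-1 *: (VLint s1 t1 B - brk b a (x a) (Vp s1) dv).
  have -> : VLint s1 t1 I = _ := VLintD q2 q4.
  rewrite (VLintB q1 c_int) (VLintB F_int (cst_int _)) (VLintZ (2^-1) q3) (VLintB Bst k_int).
  congr (_ - _ - _ + _ *: (_ - _)).
  - exact: esym Fx.
  - exact: VLint_cst.
  - exact: cE.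
  - exact: kE.
have Bch : VLint a t1 B = VLint a s1 B + VLint s1 t1 B.
  by apply: (VLint_chasles h2 h3); exact: B_int.
have GE : G t1 - G s1 = VLint s1 t1 I -
   (P t1 - P s1 - control b a dv (P s1) - 2^-1 *: brk b a (x a) (Vp s1) dv).
  rewrite II /G Bch; by apply/rowP => i; rewrite !mxE; field.
rewrite GE; apply: le_trans (ler_normB _ _) _.
have ts0 : 0 <= t1 - s1 by rewrite subr_ge0.
pose E1 := E0 + 2 * C ^+ 2 * r * (t1 - s1).
have -> : (A1 * h + C ^+ 2 * r * E0 + K2 * (t1 - s1)) * (t1 - s1) =
  ((C * (C + 2 * C ^+ 3) + 2 * C ^+ 3) * h + C ^+ 2 * r * E1 + C * (C * r) ^+ 2 / 2 * (t1 - s1)) * (t1 - s1) +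
  (A0 * h + K * (t1 - s1)) * (t1 - s1) by rewrite /A1 /E1 /K2; field.
apply: lerD; last exact: Pinc.
apply: (VLint_le h3 I_int) => ta /andP[s1ta tat1].
have hta : a <= ta <= a + e by rewrite (le_trans h2 s1ta) (le_trans tat1 t1e).
have xc := x_cube hta.
have Pc : cube rho (P s1).
  apply: near_cube; apply: le_trans (Pb s1 hs1) _; move: hC; rewrite -mulrA.
  have : 0 <= C ^+ 3 * h by rewrite mulr_ge0 ?exprn_ge0 // ltW.
  lra.
have tae : `|ta - a| <= C * h ^+ 2.
  case/andP: hta => ? ?; rewrite ger0_norm ?subr_ge0 //; apply: le_trans eC; lra.
have tas : `|ta - s1| <= t1 - s1 by rewrite ger0_norm ?subr_ge0 // lerB.
have Ch2 : C * h ^+ 2 <= C * h.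
  by rewrite ler_wpM2l // expr2 ler_piMr // ltW.
have xP1 : `|x ta - P s1| <= E1.
  have -> : x ta - P s1 = (x s1 - P s1) + (x ta - x s1) by rewrite [RHS]addrC subrKA.
  apply: le_trans (ler_normD _ _) _; apply: lerD; first exact: xP.
  apply: le_trans (step_speed h2 s1ta (le_trans tat1 t1e)) _.
  by rewrite ler_wpM2l ?mulr_ge0 ?exprn_ge0 ?(ltW r0) // lerB.
pose U1 := uvec u ta (w * ta); pose U0 := uvec u a (w * ta).
(* Four errors: freezing the drift, comparing the control fields at x and at P, freezing the slow
   time in the input, and the change of the primitive inside the bracket. *)
have -> : I ta = (b ord0 ta (x ta) - b ord0 a (x a)) +
   r *: (control b ta U1 (x ta) - control b a U1 (P s1)) +
   r *: control b a (U1 - U0) (P s1) + 2^-1 *: brk b a (x a) (Vp ta - Vp s1) (g ta).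
  rewrite /I input_affineE /B.
  have -> : brk b a (x a) (Vp ta - Vp s1) (g ta) =
     brk b a (x a) (Vp ta) (g ta) - brk b a (x a) (Vp s1) (g ta).
    by rewrite /brk -lincombBr; apply: lincomb_eq => j; rewrite lincombB.
  rewrite /control lincombB lincombZ -/U1 -/U0 -/r.
  have regroup (p q z1 z2 z3 z4 : V) :
      p + r *: z1 - q - r *: z3 + z4 = p - q + r *: (z1 - z2) + r *: (z2 - z3) + z4.
    by apply/rowP => i; rewrite !mxE; ring.
  exact: regroup.
have k1 : `|b ord0 ta (x ta) - b ord0 a (x a)| <= C * (C + 2 * C ^+ 3) * h.
  apply: le_trans ((b_lip ord0).2 _ _ _ _ x0c xc) _.
  apply: le_trans (_ : C * (`|ta - a| + `|x ta - x a|) <= _).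
    by rewrite ler_wpM2r ?addr_ge0 //; exact: step_const_ge.
  rewrite -mulrA ler_wpM2l // mulrDl; apply: lerD; first exact: le_trans tae Ch2.
  exact: step_range.
have k2 : `|r *: (control b ta U1 (x ta) - control b a U1 (P s1))| <= C ^+ 3 * h + C ^+ 2 * r * E1.
  rewrite normrZ gtr0_norm //.
  have h5 := control_lip c1 b_lip a ta U1 Pc xc.
  have h6 : `|control b ta U1 (x ta) - control b a U1 (P s1)| <= C * C * (C * h ^+ 2 + E1).
    apply: le_trans h5 _; apply: ler_pM; rewrite ?mulr_ge0 ?addr_ge0 //.
      by rewrite ler_wpM2l //; exact: uvec_bound.
    exact: lerD.
  apply: le_trans (ler_wpM2l (ltW r0) h6) _.
  have -> : C ^+ 3 * h + C ^+ 2 * r * E1 = C ^+ 3 * (h * (h * r)) + C ^+ 2 * r * E1 by rewrite hr mulr1.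
  by rewrite le_eqVlt; apply/orP; left; apply/eqP; ring.
have k3 : `|r *: control b a (U1 - U0) (P s1)| <= C ^+ 3 * h.
  rewrite normrZ gtr0_norm //.
  have h6 : `|control b a (U1 - U0) (P s1)| <= C * (C * (C * h ^+ 2)).
    apply: le_trans (control_bound c1 b_lip _ _ Pc) _; rewrite ler_wpM2l //.
    by apply: le_trans (uvec_lip _ _ _) _; rewrite ler_wpM2l.
  apply: le_trans (ler_wpM2l (ltW r0) h6) _.
  have -> : C ^+ 3 * h = C ^+ 3 * (h * (h * r)) by rewrite hr mulr1.
  by rewrite le_eqVlt; apply/orP; left; apply/eqP; ring.
have k4 : `|2^-1 *: brk b a (x a) (Vp ta - Vp s1) (g ta)| <= C * (C * r) ^+ 2 / 2 * (t1 - s1).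
  rewrite normrZ gtr0_norm ?invr_gt0 //.
  have h6 : `|brk b a (x a) (Vp ta - Vp s1) (g ta)| <= C * (C * r * (t1 - s1)) * (C * r).
    apply: le_trans (brk_bound c1 lie_lip _ _ _ x0c) _.
    apply: ler_pM; rewrite ?mulr_ge0 //; last exact: fast_input_bound.
    rewrite ler_wpM2l //; apply: le_trans (fast_primitive_lip h2 s1ta) _.
    by rewrite ler_wpM2l // lerB.
  apply: le_trans (ler_wpM2l _ h6) _; first by rewrite invr_ge0.
  by rewrite le_eqVlt; apply/orP; left; apply/eqP; ring.
apply: le_trans (ler_normD _ _) _; apply: lerD => //.
apply: le_trans (ler_normD _ _) _; apply: le_trans (lerD (ler_normD _ _) k3) _.
apply: le_trans (lerD (lerD k1 k2) (lexx _)) _.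
by rewrite le_eqVlt; apply/orP; left; apply/eqP; ring.
Qed.

(** A2 bounds the first pass with E0 = 3 C^3 h, for which C^2 r E0 = 3 C^5. A3 adds the drift and
    bracket terms to obtain |x - P| <= A3 h^2. *)
Let A2 : R := A1 + 3 * C ^+ 5.
Let A3 : R := A2 * C + C ^+ 2 + C ^+ 6.

(** The primitive vanishes at both ends, so integration by parts makes the iterated integrals q
    antisymmetric, and each equals e nu. The minus sign reflects that [brk] pairs the derivative of
    the control with the first entry of the bracket. *)
Lemma brk_average : 2^-1 *: VLint a (a + e) (fun ta => brk b a (x a) (Vp ta) (g ta)) =
  - (e *: \sum_(i < m) \sum_(j < m | (i < j)%N) nu u T j i a *: lie (bu b i) (bu b j) a (x a)).
Proof.
have ae : a <= a + e by rewrite lerDl ltW.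
pose gi i ta := g ta 0 i.
have gb i : bmeas a (a + e) (gi i) := fast_input_bmeas i _ _.
have VpE ta i : Vp ta 0 i = Lint a ta (gi i) by rewrite mxE.
pose q i j := Lint a (a + e) (fun ta => gi j ta * Lint a ta (gi i)).
have qb i j : bmeas a (a + e) (fun ta => gi j ta * Lint a ta (gi i)).
  by apply: bmeasM; [exact: gb|apply: primitive_bmeas; exact: gb].
have parts i j : q i j = - q j i.
  have := integration_by_parts_Lint ae (gb j) (gb i).
  have -> : Lint a (a + e) (gi j) = 0.
    by have := VpE (a + e) j; rewrite fast_primitive_end mxE => <-.
  by rewrite mul0r => /eqP; rewrite addr_eq0 => /eqP.
have qE i j : q i j = e * nu u T j i a.
  have per k s : u k a (s + T) = u k a s by case: (u_mean k a).
  have mean k : Lint 0 T (u k a) = 0 by case: (u_mean k a).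
  have := @Lint_fast_bracket R T (u i a) (u j a) T0 (fun _ _ => u_bmeas i a _ _)
     (fun _ _ => u_bmeas j a _ _) (per i) (per j) (mean i) (mean j) w a w0.
  rewrite -/e => H.
  transitivity (r ^+ 2 * Lint a (a + e) (fun s => u j a (w * s) * Lint a s (fun s => u i a (w * s)))).
    have ub k s t : bmeas s t (fun ta => u k a (w * ta)).
      have [hb _] := @Lint_affine R w 0 s t (u k a) w0 (u_bmeas k a _ _).
      by apply: bmeas_eq hb => ta _; rewrite addr0.
    rewrite -LintZ; last first.
      by apply: bmeas_Lintegrable; apply: bmeasM; [exact: ub|apply: primitive_bmeas; exact: ub].
    apply: Lint_eq => s _; rewrite /gi !mxE.
    rewrite (@Lint_eq _ a s (gi i) (fun ta => r * u i a (w * ta))); last first.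
      by move=> ta _; rewrite /gi !mxE.
    rewrite LintZ; last exact: bmeas_Lintegrable.
    by ring.
  rewrite H rr /nu /e; field; by rewrite !gt_eqF.
have LE : VLint a (a + e) (fun ta => brk b a (x a) (Vp ta) (g ta)) =
   \sum_(j < m) \sum_(i < m) q i j *: lie (bu b j) (bu b i) a (x a).
  apply/rowP => k; rewrite mxE.
  rewrite (@Lint_eq _ _ _ _ (fun ta => \sum_(j < m) \sum_(i < m)
     lie (bu b j) (bu b i) a (x a) 0 k * (gi j ta * Lint a ta (gi i)))); last first.
    move=> ta _; rewrite /brk /lincomb summxE; apply: eq_bigr => j _.
    rewrite mxE summxE mulr_sumr; apply: eq_bigr => i _.
    by rewrite [X in _ * X]mxE VpE /gi; ring.
  have inner j := @Lint_sum R a (a + e) _ (index_enum 'I_m)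
    (fun (i : 'I_m) ta => lie (bu b j) (bu b i) a (x a) 0 k * (gi j ta * Lint a ta (gi i))) ae
    (fun i => LintegrableZ _ (bmeas_Lintegrable (qb i j))).
  have [_ ->] := @Lint_sum R a (a + e) _ (index_enum 'I_m) _ ae (fun j => (inner j).1).
  rewrite summxE; apply: eq_bigr => j _; rewrite (inner j).2 summxE.
  apply: eq_bigr => i _; rewrite LintZ; last exact: bmeas_Lintegrable.
  by rewrite [RHS]mxE mulrC.
rewrite LE (sum_antisym (L := fun i j => lie (bu b i) (bu b j) a (x a))) //; last first.
  by move=> i j; exact: lie_anti.
congr (- _); rewrite scaler_sumr; apply: eq_bigr => i _.
by rewrite scaler_sumr; apply: eq_bigr => j _; rewrite qE scalerA.
Qed.

(** Two passes of [step_increment]. The range of x gives E0 = O(h), hence x - P = O(h^2), drift and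
    bracket integral being of that order as well. In the second pass these two are kept, and the
    error is O(h^3); at the end of the period P is back at x(a). *)
Lemma one_step : `|x (a + e) - x a - e *: lie_bracket_system b u T a (x a)| <=
  (A1 * C + C ^+ 3 * A3) * h ^+ 3.
Proof.
have [P [Pa Pe Pb [K K0 Pinc]]] := reference_path.
have h0' := ltW h0; have r0' := ltW r0.
have ee : a <= a + e <= a + e by rewrite lexx lerDl ltW.
have aa : a <= a <= a + e by rewrite lexx lerDl ltW.
have A10 : 0 <= A1 by rewrite /A1 /A0 !(addr_ge0, mulr_ge0, exprn_ge0).
have sa s : a <= s <= a + e -> 0 <= s - a <= C * h ^+ 2.
  case/andP => h2 h3; rewrite subr_ge0 h2 /=; apply: le_trans eC; lra.
have first s : a <= s <= a + e -> `|x s - P s| <= 3 * C ^+ 3 * h.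
  move=> hs; have -> : x s - P s = (x s - x a) - (P s - x a) by rewrite opprB addrA subrK.
  apply: le_trans (ler_normB _ _) _.
  have -> : 3 * C ^+ 3 * h = 2 * C ^+ 3 * h + C ^+ 3 * h by ring.
  by apply: lerD; [exact: step_range|exact: Pb].
have E00 : 0 <= 3 * C ^+ 3 * h by rewrite !mulr_ge0 ?exprn_ge0.
have G1 := step_increment K0 E00 Pa Pb Pinc first.
have second s : a <= s <= a + e -> `|x s - P s| <= A3 * h ^+ 2.
  move=> hs; have := G1 s hs; have /andP[s0 s1] := sa s hs.
  set Y := VLint _ _ _; set D := _ - _ - _ + _ => hD.
  have hY : `|Y| <= C ^+ 5 * r * h * (s - a).
    case/andP: hs => h2 h3; apply: VLint_le => // [|ta /andP[h4 h5]].
      apply: bmeas_VLintegrable => k.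
      apply: bmeas_lincomb => [i|i k']; first exact: fast_input_bmeas.
      apply: bmeas_lincomb => [j|j k'']; last exact: bmeas_cst.
      apply: (bmeas_lip (K := C * r)) => s2 t2 h6 h7 h8.
      apply: le_trans (_ : `|Vp t2 - Vp s2| <= _); last exact: fast_primitive_lip.
      by apply: le_trans (coord_le_mxnorm _ j); rewrite !mxE.
    apply: le_trans (brk_bound c1 lie_lip _ _ _ (x_cube aa)) _.
    have hv : `|Vp ta| <= C ^+ 2 * h by apply: fast_primitive_bound; rewrite h4 (le_trans h5).
    apply: le_trans (_ : C * (C ^+ 2 * h) * (C * r) <= _).
      apply: ler_pM; rewrite ?mulr_ge0 //; last exact: fast_input_bound.
      by rewrite ler_wpM2l.
    have -> : C ^+ 5 * r * h = C ^+ 4 * (h * r) * C by ring.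
    have -> : C * (C ^+ 2 * h) * (C * r) = C ^+ 4 * (h * r) by ring.
    by rewrite hr mulr1 ler_peMr ?exprn_ge0.
  have hb : `|b ord0 a (x a)| <= C.
    by apply: le_trans ((b_lip ord0).1 _ _ (x_cube aa)) _; exact: step_const_ge.
  have -> : x s - P s = D + (s - a) *: b ord0 a (x a) - 2^-1 *: Y.
    by rewrite /D; apply/rowP => k; rewrite !mxE; ring.
  apply: le_trans (ler_normB _ _) _.
  apply: le_trans (lerD (ler_normD _ _) (lexx _)) _.
  rewrite !normrZ (ger0_norm s0) gtr0_norm ?invr_gt0 //.
  have q1 : `|D| <= A2 * C * h ^+ 2.
    apply: le_trans hD _.
    have -> : A1 * h + C ^+ 2 * r * (3 * C ^+ 3 * h) = A1 * h + 3 * C ^+ 5.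
      by transitivity (A1 * h + 3 * C ^+ 5 * (h * r)); [ring|rewrite hr mulr1].
    rewrite -mulrA; apply: ler_pM => //.
      by rewrite !(addr_ge0, mulr_ge0, exprn_ge0).
    by rewrite /A2 lerD2r ler_piMr.
  have q2 : (s - a) * `|b ord0 a (x a)| <= C ^+ 2 * h ^+ 2.
    have -> : C ^+ 2 * h ^+ 2 = (C * h ^+ 2) * C by ring.
    exact: ler_pM.
  have q3 : 2^-1 * `|Y| <= C ^+ 6 * h ^+ 2.
    apply: le_trans (_ : 1 * (C ^+ 5 * r * h * (s - a)) <= _).
      by apply: ler_pM => //; rewrite ?invr_ge0 // invf_le1 // ler1n.
    have -> : 1 * (C ^+ 5 * r * h * (s - a)) = C ^+ 5 * (h * r) * (s - a) by ring.
    rewrite hr mulr1; have -> : C ^+ 6 * h ^+ 2 = C ^+ 5 * (C * h ^+ 2) by ring.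
    by rewrite ler_wpM2l ?exprn_ge0.
  have -> : A3 * h ^+ 2 = A2 * C * h ^+ 2 + C ^+ 2 * h ^+ 2 + C ^+ 6 * h ^+ 2 by rewrite /A3; ring.
  by apply: lerD => //; apply: lerD.
have A20 : 0 <= A2 by rewrite /A2 addr_ge0 ?mulr_ge0 ?exprn_ge0.
have A30 : 0 <= A3 by rewrite /A3 !(addr_ge0, mulr_ge0, exprn_ge0).
have E10 : 0 <= A3 * h ^+ 2 by rewrite mulr_ge0 ?exprn_ge0.
have := step_increment K0 E10 Pa Pb Pinc second ee.
rewrite Pe brk_average [a + e - a]addrAC subrr add0r.
have -> : x (a + e) - x a - e *: b ord0 a (x a) +
  - (e *: \sum_(i < m) \sum_(j < m | (i < j)%N) nu u T j i a *: lie (bu b i) (bu b j) a (x a)) =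
  x (a + e) - x a - e *: lie_bracket_system b u T a (x a).
  by rewrite /lie_bracket_system scalerDr opprD addrA.
move=> /le_trans; apply.
have -> : (A1 * C + C ^+ 3 * A3) * h ^+ 3 = (A1 * h + C ^+ 2 * A3 * h) * (C * h ^+ 2) by ring.
have -> : C ^+ 2 * r * (A3 * h ^+ 2) = C ^+ 2 * A3 * h * (h * r) by ring.
rewrite hr mulr1 ler_wpM2l //.
by rewrite !(addr_ge0, mulr_ge0, exprn_ge0).
Qed.

End Fixed.
End OneStep.

(** * Existence of solutions *)

Section Picard.
Context {R : realType}.

Lemma geometric_limit (V : completeNormedModType R) (y : nat -> V) (B : R) : 0 <= B ->
  (forall k, `|y k.+1 - y k| <= B * 2^-1 ^+ k) ->
  exists l, forall k, `|l - y k| <= 2 * B * 2^-1 ^+ k.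
Proof.
move=> B0 H.
have H2 k p : `|y (k + p)%N - y k| <= 2 * B * 2^-1 ^+ k * (1 - 2^-1 ^+ p).
  elim: p => [|p IH]; first by rewrite addn0 subrr normr0 expr0 subrr mulr0.
  have -> : y (k + p.+1)%N - y k = (y (k + p).+1 - y (k + p)%N) + (y (k + p)%N - y k).
    by rewrite addrA subrK addnS.
  apply: le_trans (ler_normD _ _) _; apply: le_trans (lerD (H _) IH) _.
  by rewrite exprD exprS le_eqVlt; apply/orP; left; apply/eqP; field.
have H3 k p : (k <= p)%N -> `|y p - y k| <= 2 * B * 2^-1 ^+ k.
  move=> kp; rewrite -(subnKC kp); apply: le_trans (H2 _ _) _.
  apply: ler_piMr; first by rewrite !mulr_ge0 ?exprn_ge0 ?invr_ge0.
  by rewrite gerBl exprn_ge0 ?invr_ge0.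
have small (e : R) : 0 < e -> exists k, 2 * B * 2^-1 ^+ k < e.
  move=> e0; pose M := 2 * B / e; exists (Num.truncn M).+1.
  set k := (Num.truncn M).+1; have k2 : k%:R < 2 ^+ k :> R by rewrite -natrX ltr_nat ltn_expl.
  have : M < 2 ^+ k by apply: lt_trans k2; exact: truncnS_gt.
  rewrite /M ltr_pdivrMr // => h.
  by rewrite exprVn ltr_pdivrMr ?exprn_gt0 // [e * _]mulrC.
have cy : cvg (y @ \oo).
  apply/cauchy_cvgP/cauchy_exP => e e0; have [k hk] := small e e0; exists (y k).
  exists k => // p /= kp; rewrite -ball_normE /= distrC.
  exact: le_lt_trans (H3 _ _ kp) hk.
exists (lim (y @ \oo)) => k; apply/ler_addgt0Pr => e e0.
have /cvgrPdist_lt/(_ e e0)[N _ hN] := cy.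
pose p := maxn N k.
have -> : lim (y @ \oo) - y k = (lim (y @ \oo) - y p) + (y p - y k) by rewrite addrA subrK.
apply: le_trans (ler_normD _ _) _; rewrite addrC; apply: lerD.
  by apply: H3; exact: leq_maxr.
by apply/ltW/hN; exact: leq_maxl.
Qed.

Variable n : nat.
Notation V := 'rV[R]_n.

Lemma VLint_before (a b : R) (f : R -> V) : b < a -> VLint a b f = 0.
Proof.
by move=> ba; apply/rowP => k; rewrite !mxE /Lint set_itv_ge ?Rintegral_set0 // bnd_simp -ltNge.
Qed.

(** The bound on f is the derivative of K exp(l (s - a)). Instead of integrating it, the increments
    of |VLint a s f| - K exp(l (s - a)) are shown to be at most quadratic, using 1 + y <= exp y. *)
Lemma VLint_exp (a b K l : R) (f : R -> V) : a <= b -> 0 <= K -> 0 <= l ->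
  VLintegrable a b f ->
  (forall s, a <= s <= b -> `|f s| <= l * K * expR (l * (s - a))) ->
  `|VLint a b f| <= K * expR (l * (b - a)).
Proof.
move=> ab K0 l0 fi hf; pose E s := expR (l * (s - a)).
have Einc s t : s <= t -> E s <= E t.
  by move=> st; rewrite ler_expR ler_wpM2l // lerB.
have Elow s t : E s * (1 + l * (t - s)) <= E t.
  have -> : E t = E s * expR (l * (t - s)) by rewrite -expRD; congr expR; ring.
  by rewrite ler_wpM2l ?expR_ge0 // expR_ge1Dx.
have Elip s t : s <= t -> t <= b -> E t - E s <= l * E b * (t - s).
  move=> st tb; have := Elow t s; rewrite mulrDr mulr1.
  have : E t * (l * (t - s)) <= E b * (l * (t - s)).
    by rewrite ler_wpM2r ?mulr_ge0 ?subr_ge0 // Einc.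
  have -> : l * (s - t) = - (l * (t - s)) by ring.
  by rewrite mulrN [l * E b * _]mulrAC [l * _ * E b]mulrC; lra.
have sub s t : a <= s -> t <= b -> VLintegrable s t f.
  by move=> h1 h2; apply: VLintegrableS fi.
have := @increment_le R (fun s => `|VLint a s f| - K * E s) a b 0 (l * K * (l * E b)) ab.
rewrite mul0r VLint_point; last exact: sub.
rewrite normr0 sub0r opprK => H.
suff : `|VLint a b f| - K * E b + K * E a <= 0.
  rewrite /E; have : 0 <= K * expR (l * (a - a)) by rewrite mulr_ge0 ?expR_ge0.
  lra.
apply: H => s t as_ st tb; rewrite add0r.
have ts0 : 0 <= t - s by rewrite subr_ge0.
have [st1 st2] : VLintegrable s t f /\ VLint a t f = VLint a s f + VLint s t f.
  by split; [exact: sub|apply: (VLint_chasles as_ st); exact: sub].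
have h1 : `|VLint s t f| <= l * K * E t * (t - s).
  apply: (VLint_le st st1) => x /andP[sx xt].
  apply: le_trans (hf x _) _; first by rewrite (le_trans as_ sx) (le_trans xt tb).
  by rewrite ler_wpM2l ?mulr_ge0 //; exact: Einc.
have h2 : `|VLint a t f| <= `|VLint a s f| + `|VLint s t f| by rewrite st2; exact: ler_normD.
have h3 : l * K * (t - s) * (E t - E s) <= l * K * (t - s) * (l * E b * (t - s)).
  by rewrite ler_wpM2l ?mulr_ge0 //; exact: Elip.
have h4 : K * (E s * (1 + l * (t - s))) <= K * E t by rewrite ler_wpM2l.
move: h1 h2 h3 h4; move: (E t) (E s) (E b) `|VLint s t f| `|VLint a t f| `|VLint a s f|.
move=> p q eb z1 z2 z3 h1 h2 h3 h4.
have -> : l * K * (l * eb) * (t - s) * (t - s) = l * K * (t - s) * (l * eb * (t - s)) by ring.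
move: h1 h2 h3 h4; set z4 := l * K * (t - s) * (l * eb * (t - s)); lra.
Qed.

Variables (F : R -> V -> V) (L A : R).
Hypotheses (L1 : 1 <= L) (A0 : 0 <= A).
Hypothesis F_lip : forall t x y, `|F t x - F t y| <= L * `|x - y|.
Hypothesis F_bound : forall t x, `|F t x| <= A.
Hypothesis F_int : forall (y : R -> V),
  (forall s t, `|y s - y t| <= A * `|s - t|) ->
  forall s t, VLintegrable s t (fun ta => F ta (y ta)).

(** All iterates are A-Lipschitz because F is bounded, which is what [F_int] requires. Before t0
    integrals over reversed bounds vanish, so the iterates are constant there and Lipschitz on the
    whole line. *)
Lemma picard (t0 : R) (x0 : V) : exists x : R -> V,
  [/\ x t0 = x0, forall s t, `|x s - x t| <= A * `|s - t|
    & forall s t, t0 <= s -> s <= t -> x t - x s = VLint s t (fun ta => F ta (x ta))].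
Proof.
pose I (y : R -> V) t := x0 + VLint t0 t (fun ta => F ta (y ta)).
pose lip (y : R -> V) := forall s t, `|y s - y t| <= A * `|s - t|.
have I_incr y s t : lip y -> t0 <= s -> s <= t -> I y t - I y s = VLint s t (fun ta => F ta (y ta)).
  move=> ly h1 h2; rewrite /I (@VLint_chasles R n t0 s t) //; last exact: F_int.
  by rewrite opprD addrACA subrr add0r addrAC subrr add0r.
have I_before y t : t < t0 -> I y t = x0 by move=> h; rewrite /I VLint_before // addr0.
have I_start y : lip y -> I y t0 = x0 by move=> ly; rewrite /I VLint_point ?addr0 //; exact: F_int.
have I_lip y : lip y -> lip (I y).
  move=> ly.
  have main s t : s <= t -> `|I y t - I y s| <= A * (t - s).
    move=> st; have [ts|ts] := leP t0 s.
      by rewrite I_incr //; apply: VLint_le => //; exact: F_int.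
    rewrite (I_before _ _ ts); have [tt|tt] := leP t0 t; last first.
      by rewrite I_before // subrr normr0 mulr_ge0 ?subr_ge0.
    rewrite -(I_start y ly) I_incr //.
    apply: le_trans (_ : A * (t - t0) <= _).
      by apply: VLint_le => //; exact: F_int.
    by rewrite ler_wpM2l //; lra.
  move=> s t; have [st|/ltW ts] := leP s t.
    by rewrite distrC [`|s - t|]distrC [`|t - s|]ger0_norm ?subr_ge0 //; exact: main.
  by rewrite [`|s - t|]ger0_norm ?subr_ge0 //; exact: main.
pose y k := iter k I (fun=> x0).
have ly k : lip (y k).
  elim: k => [|k IH]; last exact: I_lip.
  by move=> s t; rewrite /y /= subrr normr0 mulr_ge0.
(* With this weight each iteration halves the distance, which gives existence for all times at
   once. *)
pose E t := expR (2 * L * (t - t0)).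
have L0 : 0 <= L by exact: le_trans L1.
have dist k t : `|y k.+1 t - y k t| <= A * E t * 2^-1 ^+ k.
  elim: k t => [|k IH] t.
    rewrite expr0 mulr1 /= /I [_ - x0]addrC addKr.
    have [tt|tt] := leP t0 t; last by rewrite VLint_before // normr0 mulr_ge0 ?expR_ge0.
    apply: le_trans (_ : A * (t - t0) <= _).
      by apply: VLint_le => //; apply: F_int; exact: (ly 0).
    rewrite ler_wpM2l //; apply: le_trans (expR_ge1Dx _).
    have : (t - t0) <= L * (t - t0) by rewrite ler_peMl // subr_ge0.
    have : 0 <= t - t0 by rewrite subr_ge0.
    lra.
  have [tt|tt] := leP t0 t; last first.
    by rewrite /y !iterS !I_before // subrr normr0 !mulr_ge0 ?expR_ge0 ?exprn_ge0 ?invr_ge0.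
  have i1 := F_int (ly k.+1) t0 t; have i0 := F_int (ly k) t0 t.
  have -> : y k.+2 t - y k.+1 t = VLint t0 t (fun ta => F ta (y k.+1 ta) - F ta (y k ta)).
    rewrite (VLintB i1 i0) /y [iter k.+2 _ _]iterS [in X in _ - X]iterS /I.
    by rewrite opprD addrACA subrr add0r.
  have -> : A * E t * 2^-1 ^+ k.+1 = (A * 2^-1 ^+ k.+1) * E t by ring.
  apply: VLint_exp => //; rewrite ?mulr_ge0 ?exprn_ge0 ?invr_ge0 //.
    exact: VLintegrableB.
  move=> s hs; apply: le_trans (F_lip _ _ _) _.
  have -> : 2 * L * (A * 2^-1 ^+ k.+1) * expR (2 * L * (s - t0)) = L * (A * E s * 2^-1 ^+ k).
    by rewrite /E exprS; field.
  by rewrite ler_wpM2l.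
have lim t : exists l, forall k, `|l - y k t| <= 2 * (A * E t) * 2^-1 ^+ k.
  have coord i : exists l : R, forall k, `|l - y k t 0 i| <= 2 * (A * E t) * 2^-1 ^+ k.
    apply: (@geometric_limit R (fun k => y k t 0 i)) => [|k]; first by rewrite mulr_ge0 ?expR_ge0.
    apply: le_trans (dist k t); apply: le_trans (coord_le_mxnorm _ i); by rewrite !mxE.
  have [l hl] := choice coord; exists (\row_i l i) => k; apply: mxnorm_leP => [|i].
    by rewrite !mulr_ge0 ?expR_ge0 ?exprn_ge0 ?invr_ge0.
  by rewrite !mxE; have := hl i k; rewrite /y.
have [x hx] := choice lim.
have small (B : R) : 0 <= B -> (forall q : R, (forall k, q <= B * 2^-1 ^+ k) -> q <= 0).
  move=> B0 q hq; apply/ler_addgt0Pr => e e0; rewrite add0r.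
  apply: le_trans (hq (Num.truncn (B / e)).+1) _.
  set k := (Num.truncn (B / e)).+1; have k2 : k%:R < 2 ^+ k :> R by rewrite -natrX ltr_nat ltn_expl.
  have : B / e < 2 ^+ k by apply: lt_trans k2; exact: truncnS_gt.
  rewrite ltr_pdivrMr // => h.
  by rewrite exprVn ler_pdivrMr ?exprn_gt0 // mulrC ltW.
have E0 t : 0 <= E t by exact: expR_ge0.
have lx : lip x.
  move=> s t; rewrite -subr_le0; apply: (small (2 * (A * E s) + 2 * (A * E t))).
    by rewrite addr_ge0 ?mulr_ge0.
  move=> k; rewrite lerBlDr.
  have -> : x s - x t = (x s - y k s) + (y k s - y k t) - (x t - y k t).
    by apply/rowP => i; rewrite !mxE; ring.
  apply: le_trans (ler_normB _ _) _; apply: le_trans (lerD (ler_normD _ _) (lexx _)) _.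
  move: (hx s k) (hx t k) (ly k s t); rewrite mulrDl; lra.
have fix_x t : t0 <= t -> x t = I x t.
  move=> tt; apply/eqP; rewrite -subr_eq0 -normr_le0.
  have [B [B0 hB]] : exists B, 0 <= B /\ forall s, t0 <= s <= t -> 2 * (A * E s) <= B.
    exists (2 * (A * E t)); split; first by rewrite !mulr_ge0.
    move=> s /andP[_ st]; rewrite ler_wpM2l // ler_wpM2l // ler_expR ler_wpM2l ?mulr_ge0 //; lra.
  apply: (small (B + L * B * (t - t0))).
    by rewrite addr_ge0 // !mulr_ge0 // subr_ge0.
  move=> k; have i1 := F_int lx t0 t; have i0 := F_int (ly k) t0 t.
  have -> : x t - I x t = (x t - y k.+1 t) - VLint t0 t (fun ta => F ta (x ta) - F ta (y k ta)).
    by rewrite (VLintB i1 i0) /y iterS /I; apply/rowP => i; rewrite !mxE; ring.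
  apply: le_trans (ler_normB _ _) _; rewrite mulrDl; apply: lerD.
    apply: le_trans (hx t k.+1) _; apply: ler_pM; rewrite ?mulr_ge0 ?exprn_ge0 ?invr_ge0 //.
      by apply: hB; rewrite tt lexx.
    by rewrite exprS ler_piMl ?exprn_ge0 ?invr_ge0 // invf_le1 // ler1n.
  rewrite mulrAC; apply: (VLint_le tt); first exact: VLintegrableB.
  move=> s hs; apply: le_trans (F_lip _ _ _) _; rewrite -mulrA ler_wpM2l //.
  by apply: le_trans (hx s k) _; rewrite ler_wpM2r ?exprn_ge0 ?invr_ge0 //; exact: hB.
exists x; split=> //; first by rewrite fix_x // I_start.
by move=> s t h1 h2; rewrite (fix_x t) ?(fix_x s) ?(le_trans h1) // I_incr.
Qed.

End Picard.

(** * Trajectories in a cube *)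

Section Clip.
Context {R : realType} {n : nat}.
Notation V := 'rV[R]_n.

(** A retraction onto the cube, 1-Lipschitz for the sup norm; composing with it makes the fields
    bounded and globally Lipschitz. *)
Definition clip (rho : R) (x : V) : V := \row_i Num.max (- rho) (Num.min rho (x 0 i)).

Lemma clip_cube rho x : 0 <= rho -> cube rho (clip rho x).
Proof.
move=> r0; apply: mxnorm_leP => // i; rewrite mxE ler_norml le_max lexx /= ge_max.
by rewrite ge_min lexx /=; lra.
Qed.

Lemma clip_id rho x : cube rho x -> clip rho x = x.
Proof.
move=> hx; apply/rowP => i; rewrite mxE.
have := le_trans (coord_le_mxnorm x i) hx; rewrite ler_norml => /andP[h1 h2].
by rewrite min_r // max_r.
Qed.

Lemma clip_lip rho x y : 0 <= rho -> `|clip rho x - clip rho y| <= `|x - y|.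
Proof.
move=> r0; apply: mxnorm_leP => // i; rewrite !mxE.
apply: le_trans (coord_le_mxnorm (x - y) i); rewrite !mxE.
set p := x 0 i; set q := y 0 i.
have h1 := ler_norm (p - q); have h2 := ler_norm (q - p); rewrite distrC in h2.
rewrite ler_norml; have [?|?] := leP rho p; have [?|?] := leP rho q.
- by have [?|?] := leP (- rho) rho; apply/andP; split; lra.
- by have [?|?] := leP (- rho) rho; have [?|?] := leP (- rho) q; apply/andP; split; lra.
- by have [?|?] := leP (- rho) p; have [?|?] := leP (- rho) rho; apply/andP; split; lra.
- by have [?|?] := leP (- rho) p; have [?|?] := leP (- rho) q; apply/andP; split; lra.
Qed.

End Clip.

Section Trajectory.
Context {R : realType} {n : nat}.
Notation V := 'rV[R]_n.
Implicit Types (F : R -> V -> V) (x : R -> V).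

(* Covers at once the solutions of the true equation, as long as they stay in the cube,
   and those of the equation modified outside it. *)
Definition trajectory F (rho t0 t1 : R) x : Prop :=
  (forall t, t0 <= t <= t1 -> forall e, 0 < e -> exists2 d, 0 < d &
     forall s, t0 <= s <= t1 -> `|s - t| < d -> `|x s - x t| < e) /\
  (forall s t, t0 <= s -> s <= t -> t <= t1 -> (forall ta, s <= ta <= t -> cube rho (x ta)) ->
     VLintegrable s t (fun ta => F ta (x ta)) /\
     x t - x s = VLint s t (fun ta => F ta (x ta))).

Lemma trajectoryS F rho t0 t1 s0 s1 x : t0 <= s0 -> s1 <= t1 ->
  trajectory F rho t0 t1 x -> trajectory F rho s0 s1 x.
Proof.
move=> h0 h1 [cx ix]; split=> [t /andP[ht1 ht2] e e0|s t hs st ht]; last first.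
  by apply: ix => //; [exact: le_trans hs|exact: le_trans h1].
have [d d0 hd] := cx t ltac:(by rewrite (le_trans h0 ht1) (le_trans ht2 h1)) e e0.
exists d => // s /andP[hs1 hs2]; apply: hd.
by rewrite (le_trans h0 hs1) (le_trans hs2 h1).
Qed.

(** A continuation argument: a bound r < rho, known only as long as the trajectory has not left the
    cube, holds up to t1. At the last time reached, continuity first carries the bound over and then
    leaves room rho - r to go further. *)
Lemma exit_time F (rho r t0 t1 : R) x : trajectory F rho t0 t1 x -> t0 <= t1 -> r < rho ->
  `|x t0| <= r ->
  (forall t, t0 <= t <= t1 -> (forall ta, t0 <= ta <= t -> cube rho (x ta)) -> `|x t| <= r) ->
  forall t, t0 <= t <= t1 -> `|x t| <= r.
Proof.
move=> [cx _] t01 rr x0r H.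
pose A := [set t | t0 <= t <= t1 /\ forall ta, t0 <= ta <= t -> cube rho (x ta)].
have At0 : A t0.
  split; first by rewrite lexx t01.
  by move=> ta; rewrite -eq_le => /eqP <-; apply: le_trans x0r (ltW rr).
have ubA : ubound A t1 by move=> t [/andP[_ ?] _].
have supA : has_sup A by split; [exists t0|exists t1].
pose s := sup A.
have s0 : t0 <= s by apply: ub_le_sup => //; exists t1.
have s1 : s <= t1 by apply: ge_sup => //; exists t0.
have down t : A t -> forall ta, t0 <= ta <= t -> A ta.
  move=> [/andP[h1 h2] h3] ta /andP[h4 h5]; split; first by rewrite h4 (le_trans h5).
  by move=> tb /andP[h6 h7]; apply: h3; rewrite h6 (le_trans h7).
have below t : t0 <= t -> t < s -> A t.
  move=> h1 h2; have e0 : 0 < s - t by rewrite subr_gt0.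
  have [a Aa ha] := sup_adherent e0 supA.
  by apply: (down a Aa); rewrite h1 /=; move: ha; rewrite -/s; lra.
have xr t : A t -> `|x t| <= r by move=> [h1 h2]; exact: H.
have xs : `|x s| <= r.
  have [->//|ns] := eqVneq s t0.
  have ts : t0 < s by rewrite lt_neqAle eq_sym ns.
  apply/ler_addgt0Pr => e e0.
  have [d d0 hd] := cx s ltac:(by rewrite s0 s1) e e0.
  pose t := Num.max t0 (s - d / 2).
  have tt0 : t0 <= t by rewrite le_max lexx.
  have tts : t < s by rewrite gt_max ts /=; lra.
  have tsd : s - d / 2 <= t by rewrite le_max lexx orbT.
  have xt := xr t (below t tt0 tts).
  have : `|x t - x s| < e.
    apply: hd; first by rewrite tt0 (le_trans (ltW tts)).
    by rewrite distrC gtr0_norm ?subr_gt0 //; lra.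
  have : `|x s| <= `|x t| + `|x t - x s|.
    by rewrite -{1}[x s](subKr (x t)); exact: ler_normB.
  lra.
have As : A s.
  split=> [|ta /andP[h1 h2]]; first by rewrite s0 s1.
  move: h2; rewrite le_eqVlt => /predU1P[->|h2]; first exact: le_trans xs (ltW rr).
  by have [h3 h4] := below ta h1 h2; apply: h4; rewrite h1 lexx.
have st1 : s = t1.
  apply/eqP; rewrite eq_le s1 /= leNgt; apply/negP => lt.
  have [d d0 hd] := cx s ltac:(by rewrite s0 s1) (rho - r) ltac:(by rewrite subr_gt0).
  pose t := Num.min t1 (s + d / 2).
  have tt1 : t <= t1 by rewrite ge_min lexx.
  have tts : s < t by rewrite lt_min lt /=; lra.
  have tsd : t <= s + d / 2 by rewrite ge_min lexx orbT.
  have At : A t.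
    split=> [|ta /andP[h1 h2]]; first by rewrite (le_trans s0 (ltW tts)) tt1.
    have [h3|h3] := leP ta s; first by case: As => _; apply; rewrite h1 h3.
    have : `|x ta - x s| < rho - r.
      apply: hd; first by rewrite h1 (le_trans h2).
      by rewrite gtr0_norm ?subr_gt0 //; lra.
    have : `|x ta| <= `|x s| + `|x ta - x s|.
      by rewrite -{1}[x ta](subrK (x s)) addrC; exact: ler_normD.
    by rewrite /cube /=; lra.
  have : t <= s by apply: ub_le_sup => //; exists t1.
  by rewrite leNgt tts.
by move=> t ht; apply/xr/(down s As); rewrite st1.
Qed.

End Trajectory.

(** * Trajectories track the Lie bracket system *)

Section Tracking.
Context {R : realType} {n m : nat}.
Notation V := 'rV[R]_n.
Variables (b : 'I_m.+1 -> R -> V -> V) (u : 'I_m -> R -> R -> R) (T rho c : R).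
Hypotheses (c1 : 1 <= c) (T0 : 0 < T) (Tc : T <= c).
Hypothesis b_C2 : forall i, C2 (joint (b i)).
Hypothesis b_lip : forall i, lipschitz_on (b i) rho c.
Hypothesis b_jac : forall i t x (z : V), cube rho x -> `|z *m 'J (b i t) x| <= c * `|z|.
Hypothesis lie_lip : forall j k : 'I_m, lipschitz_on (lie (bu b j) (bu b k)) rho c.
Hypothesis u_meas : forall i, lebesgue_measurable_fun2 (fun p => u i p.1 p.2).
Hypothesis u_lip : forall i t1 t2 th, `|u i t1 th - u i t2 th| <= c * `|t1 - t2|.
Hypothesis u_bound : forall i t th, `|u i t th| <= c.
Hypothesis u_mean : assumption_A4 u T.

Let c0 : 0 <= c. Proof. exact: le_trans c1. Qed.
Notation C := (@step_const R m c).
Let C1 : 1 <= C. Proof. by apply: le_trans c1 _; exact: step_const_ge. Qed.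
Let C0 : 0 <= C. Proof. exact: le_trans C1. Qed.

Let ub i t s0 s1 : bmeas s0 s1 (u i t). Proof. exact: u_bmeas u_meas u_lip u_bound _ _ _ _. Qed.

Let prod_bmeas i j t : bmeas 0 T (fun th => u j t th * Lint 0 th (u i t)).
Proof. by apply: bmeasM => //; exact: primitive_bmeas. Qed.

Let prim_bound i t th : 0 <= th <= T -> `|Lint 0 th (u i t)| <= c * T.
Proof.
move=> hth; apply: le_trans (@primitive_bound R 0 T c (u i t) th (ub _ _ _ _) _ hth) _.
  by move=> s _; exact: u_bound.
by rewrite ler_wpM2l // subr0; case/andP: hth.
Qed.

Lemma nu_bound i j t : `|nu u T j i t| <= c ^+ 3.
Proof.
rewrite /nu normrM gtr0_norm ?invr_gt0 //.
have h : `|Lint 0 T (fun th => u j t th * Lint 0 th (u i t))| <= c * (c * T) * (T - 0).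
  apply: Lint_le; [exact: ltW|exact: bmeas_Lintegrable|move=> s hs].
  by rewrite normrM; apply: ler_pM => //; exact: prim_bound.
apply: le_trans (ler_wpM2l _ h) _; first by rewrite invr_ge0 ltW.
have -> : T^-1 * (c * (c * T) * (T - 0)) = c ^+ 2 * T by field; rewrite gt_eqF.
by rewrite [leRHS]exprSr ler_wpM2l // exprn_ge0.
Qed.

Lemma nu_lip i j s t : `|nu u T j i t - nu u T j i s| <= 2 * c ^+ 3 * `|t - s|.
Proof.
rewrite /nu -mulrBr normrM gtr0_norm ?invr_gt0 // -LintB; try exact: bmeas_Lintegrable.
have h : `|Lint 0 T (fun th => u j t th * Lint 0 th (u i t) - u j s th * Lint 0 th (u i s))|
    <= 2 * c ^+ 2 * T * `|t - s| * (T - 0).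
  apply: Lint_le; [exact: ltW| |move=> th hth].
    by apply: bmeas_Lintegrable; apply: bmeasD => //; exact: bmeasN.
  have -> : u j t th * Lint 0 th (u i t) - u j s th * Lint 0 th (u i s) =
     (u j t th - u j s th) * Lint 0 th (u i t) + u j s th * (Lint 0 th (u i t) - Lint 0 th (u i s)).
    by ring.
  have h1 : `|(u j t th - u j s th) * Lint 0 th (u i t)| <= c * `|t - s| * (c * T).
    by rewrite normrM; apply: ler_pM => //; exact: prim_bound.
  have h2 : `|u j s th * (Lint 0 th (u i t) - Lint 0 th (u i s))| <= c * (c * `|t - s| * T).
    rewrite normrM; apply: ler_pM => //.
    rewrite -LintB; try exact: bmeas_Lintegrable.
    case/andP: hth => th0 thT; apply: le_trans (_ : c * `|t - s| * (th - 0) <= _).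
      apply: Lint_le => //; by apply: bmeas_Lintegrable; apply: bmeasD => //; exact: bmeasN.
    by rewrite subr0 ler_wpM2l // mulr_ge0.
  apply: le_trans (ler_normD _ _) _; apply: le_trans (lerD h1 h2) _.
  by rewrite le_eqVlt; apply/orP; left; apply/eqP; ring.
apply: le_trans (ler_wpM2l _ h) _; first by rewrite invr_ge0 ltW.
have -> : T^-1 * (2 * c ^+ 2 * T * `|t - s| * (T - 0)) = 2 * c ^+ 2 * T * `|t - s|.
  by field; rewrite gt_eqF.
by rewrite ler_wpM2r // [c ^+ 3]exprSr mulrA ler_wpM2l // mulr_ge0 // exprn_ge0.
Qed.

Lemma sum_norm_bound (I : finType) (P : pred I) (f : I -> V) (B : R) : 0 <= B ->
  (forall i, P i -> `|f i| <= B) -> `|\sum_(i | P i) f i| <= #|I|%:R * B.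
Proof.
move=> B0 h; apply: le_trans (ler_norm_sum _ _ _) _.
apply: le_trans (_ : \sum_(i | P i) B <= _); first exact: ler_sum.
by rewrite sumr_const -[leLHS]mulr_natl ler_wpM2r // ler_nat max_card.
Qed.

Lemma lie_bracket_lipschitz : exists2 K, 1 <= K & lipschitz_on (lie_bracket_system b u T) rho K.
Proof.
(* Each pair i < j contributes 3 c^4: c^3 c from the bracket and 2 c^3 c from its coefficient nu. *)
pose K := c + m%:R * (m%:R * (3 * c ^+ 4)).
have K30 : 0 <= 3 * c ^+ 4 by rewrite mulr_ge0 ?exprn_ge0.
exists K.
  apply: le_trans c1 _; rewrite /K lerDl !mulr_ge0 ?exprn_ge0 //.
split=> [t x hx|s t x y hx hy].
  rewrite /lie_bracket_system; apply: le_trans (ler_normD _ _) _.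
  apply: lerD; first by have [h _] := b_lip ord0; exact: h.
  have := @sum_norm_bound 'I_m xpredT (fun i => \sum_(j < m | (i < j)%N)
    nu u T j i t *: lie (bu b i) (bu b j) t x) (m%:R * (3 * c ^+ 4)).
  rewrite card_ord; apply=> [|i _]; first by rewrite mulr_ge0.
  have := @sum_norm_bound 'I_m (fun j => (i < j)%N) (fun j =>
    nu u T j i t *: lie (bu b i) (bu b j) t x) (3 * c ^+ 4).
  rewrite card_ord; apply=> // j _; rewrite normrZ.
  apply: le_trans (_ : c ^+ 3 * c <= _).
    by apply: ler_pM => //; [exact: nu_bound|have [h _] := lie_lip i j; exact: h].
  by rewrite -exprSr ler_peMl ?exprn_ge0 // ler1n.
set d := `|t - s| + `|y - x|.
have d0 : 0 <= d by rewrite addr_ge0.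
rewrite /lie_bracket_system.
have -> : b ord0 t y + (\sum_(i < m) \sum_(j < m | (i < j)%N) nu u T j i t *: lie (bu b i) (bu b j) t y) -
  (b ord0 s x + \sum_(i < m) \sum_(j < m | (i < j)%N) nu u T j i s *: lie (bu b i) (bu b j) s x) =
  (b ord0 t y - b ord0 s x) + \sum_(i < m) \sum_(j < m | (i < j)%N)
   (nu u T j i t *: lie (bu b i) (bu b j) t y - nu u T j i s *: lie (bu b i) (bu b j) s x).
  rewrite opprD addrACA; congr (_ + _); rewrite -sumrB; apply: eq_bigr => i _.
  by rewrite -sumrB.
apply: le_trans (ler_normD _ _) _; rewrite /K mulrDl.
apply: lerD; first by have [_ h] := b_lip ord0; exact: h.
have E4 : m%:R * (m%:R * (3 * c ^+ 4)) * d = m%:R * (m%:R * (3 * c ^+ 4 * d)) by ring.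
have K4 : 0 <= 3 * c ^+ 4 * d by rewrite mulr_ge0.
rewrite E4.
have := @sum_norm_bound 'I_m xpredT (fun i => \sum_(j < m | (i < j)%N)
  (nu u T j i t *: lie (bu b i) (bu b j) t y - nu u T j i s *: lie (bu b i) (bu b j) s x))
   (m%:R * (3 * c ^+ 4 * d)).
rewrite card_ord; apply=> [|i _]; first by rewrite mulr_ge0.
have := @sum_norm_bound 'I_m (fun j => (i < j)%N) (fun j =>
  nu u T j i t *: lie (bu b i) (bu b j) t y - nu u T j i s *: lie (bu b i) (bu b j) s x)
  (3 * c ^+ 4 * d).
rewrite card_ord; apply=> // j _.
have [l1 l2] := lie_lip i j.
have -> : nu u T j i t *: lie (bu b i) (bu b j) t y - nu u T j i s *: lie (bu b i) (bu b j) s x =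
  nu u T j i t *: (lie (bu b i) (bu b j) t y - lie (bu b i) (bu b j) s x) +
  (nu u T j i t - nu u T j i s) *: lie (bu b i) (bu b j) s x.
  have gen (p q : R) (Y Z : V) : p *: Y - q *: Z = p *: (Y - Z) + (p - q) *: Z.
    by rewrite scalerBr scalerBl addrA subrK.
  exact: gen.
apply: le_trans (ler_normD _ _) _; rewrite (normrZ (nu u T j i t)) (normrZ (nu u T j i t - _)).
have h1 : `|nu u T j i t| * `|lie (bu b i) (bu b j) t y - lie (bu b i) (bu b j) s x| <= c ^+ 3 * (c * d).
  by apply: ler_pM => //; [exact: nu_bound|exact: l2].
have h2 : `|nu u T j i t - nu u T j i s| * `|lie (bu b i) (bu b j) s x| <= 2 * c ^+ 3 * d * c.
  apply: ler_pM => //; last exact: l1.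
  apply: le_trans (nu_lip _ _ _ _) _; rewrite ler_wpM2l ?mulr_ge0 ?exprn_ge0 //.
  by rewrite lerDl.
apply: le_trans (lerD h1 h2) _.
by rewrite le_eqVlt; apply/orP; left; apply/eqP; ring.
Qed.

(** At fixed w the modified right-hand side is bounded and globally Lipschitz in space with constant
    A; 1 <= sqrt w lets the drift be absorbed in a multiple of sqrt w. Measurability in time rests
    on [diagonal_measurable]. *)
Lemma clipped_solution (w t0 : R) (x0 : V) : 0 <= rho -> 1 <= Num.sqrt w ->
  exists x : R -> V, [/\ x t0 = x0,
    exists2 A, 0 <= A & forall s t, `|x s - x t| <= A * `|s - t|
  & forall s t, t0 <= s -> s <= t ->
     VLintegrable s t (fun ta => input_affine b u w ta (clip rho (x ta))) /\
     x t - x s = VLint s t (fun ta => input_affine b u w ta (clip rho (x ta)))].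
Proof.
move=> rho0 r1; have r0 : 0 <= Num.sqrt w by exact: sqrtr_ge0.
have w0 : 0 < w by rewrite -sqrtr_gt0; exact: lt_le_trans r1.
pose A := 2 * C ^+ 2 * Num.sqrt w.
have A0 : 0 <= A by rewrite !mulr_ge0 ?exprn_ge0.
have CC : 1 <= C ^+ 2 by exact: exprn_ege1.
have A1 : 1 <= A.
  rewrite /A -mulrA; apply: le_trans (_ : 2 <= _); first by rewrite ler1n.
  by rewrite ler_peMr // mulr_ege1.
pose F ta y := input_affine b u w ta (clip rho y).
have F_lip t x y : `|F t x - F t y| <= A * `|x - y|.
  have hx := clip_cube x rho0; have hy := clip_cube y rho0.
  have hxy := clip_lip x y rho0.
  have -> : F t x - F t y = (b ord0 t (clip rho x) - b ord0 t (clip rho y)) +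
     Num.sqrt w *: (control b t (uvec u t (w * t)) (clip rho x) -
                    control b t (uvec u t (w * t)) (clip rho y)).
    by rewrite /F !input_affineE opprD addrACA scalerBr.
  apply: le_trans (ler_normD _ _) _; rewrite normrZ ger0_norm //.
  have h1 : `|b ord0 t (clip rho x) - b ord0 t (clip rho y)| <= C ^+ 2 * Num.sqrt w * `|x - y|.
    apply: le_trans ((b_lip ord0).2 _ _ _ _ hy hx) _; rewrite (subrr t) normr0 add0r.
    have cCr : c <= C ^+ 2 * Num.sqrt w.
      apply: (@le_trans _ _ C); first exact: step_const_ge.
      by rewrite expr2 -mulrA ler_peMr // mulr_ege1.
    by apply: ler_pM.
  have h2 : `|control b t (uvec u t (w * t)) (clip rho x) - control b t (uvec u t (w * t)) (clip rho y)|
     <= C ^+ 2 * `|x - y|.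
    apply: le_trans (control_lip c1 b_lip _ _ _ hy hx) _; rewrite (subrr t) normr0 add0r.
    apply: ler_pM => //; rewrite ?mulr_ge0 // expr2 ler_wpM2l //.
    exact: uvec_bound.
  have h3 := ler_wpM2l r0 h2.
  apply: le_trans (lerD h1 h3) _.
  by rewrite le_eqVlt; apply/orP; left; apply/eqP; rewrite /A; ring.
have F_bound t x : `|F t x| <= A.
  by apply: input_affine_bound => //; exact: clip_cube.
have F_int (y : R -> V) : (forall s t, `|y s - y t| <= A * `|s - t|) ->
    forall s t, VLintegrable s t (fun ta => F ta (y ta)).
  move=> ly s t; apply: bmeas_VLintegrable => k.
  have bl i : bmeas s t (fun ta => b i ta (clip rho (y ta)) 0 k).
    apply: (bmeas_lip (K := c * (1 + A))) => s1 t1 _ st _.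
    apply: le_trans (_ : `|b i t1 (clip rho (y t1)) - b i s1 (clip rho (y s1))| <= _).
      by apply: le_trans (coord_le_mxnorm _ k); rewrite !mxE.
    apply: le_trans ((b_lip i).2 _ _ _ _ (clip_cube _ rho0) (clip_cube _ rho0)) _.
    rewrite -mulrA ler_wpM2l // mulrDl mul1r.
    have e1 : `|t1 - s1| = t1 - s1 by rewrite ger0_norm // subr_ge0.
    apply: lerD; first by rewrite e1.
    by apply: le_trans (clip_lip _ _ rho0) _; rewrite -e1; exact: ly.
  rewrite (_ : (fun ta => F ta (y ta) 0 k) = fun ta => b ord0 ta (clip rho (y ta)) 0 k +
    \sum_(i < m) Num.sqrt w * u i ta (w * ta) * bu b i ta (clip rho (y ta)) 0 k); last first.
    apply/funext => ta; rewrite /F /input_affine mxE summxE; congr (_ + _).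
    by apply: eq_bigr => i _; rewrite mxE.
  apply: bmeasD => //; apply: bmeas_sum => i _; apply: bmeasM; last exact: bl.
  apply: bmeasM; first exact: bmeas_cst.
  apply/bmeasP; split; last by exists c => ta _; exact: u_bound.
  exact/measurable_funTS/(diagonal_measurable (u_meas i) (u_lip i)).
have [x [x1 x2 x3]] := picard A1 A0 F_lip F_bound F_int t0 x0.
exists x; split=> //; first by exists A.
by move=> s t h1 h2; split; [exact: F_int|exact: x3].
Qed.

Lemma clipped_trajectory (w t0 t1 A : R) (x : R -> V) : 0 <= A ->
  (forall s t, `|x s - x t| <= A * `|s - t|) ->
  (forall s t, t0 <= s -> s <= t ->
     VLintegrable s t (fun ta => input_affine b u w ta (clip rho (x ta))) /\
     x t - x s = VLint s t (fun ta => input_affine b u w ta (clip rho (x ta)))) ->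
  trajectory (input_affine b u w) rho t0 t1 x.
Proof.
move=> A0 lx ix; split=> [t _ e e0|s t h1 h2 h3 hc].
  have A1 : 0 < A + 1 by rewrite ltr_wpDl.
  exists (e / (A + 1)); first exact: divr_gt0.
  move=> s _ hs; apply: le_lt_trans (lx s t) _.
  apply: le_lt_trans (_ : (A + 1) * `|s - t| < _); first by rewrite ler_wpM2r // lerDl.
  by rewrite mulrC -ltr_pdivlMr.
have [i1 i2] := ix s t h1 h2.
have E ta : s <= ta <= t -> input_affine b u w ta (clip rho (x ta)) = input_affine b u w ta (x ta).
  by move=> /hc h; rewrite clip_id.
by split; [exact: VLintegrable_eq i1|rewrite i2; exact: VLint_eq].
Qed.

(** Supplies the cube hypothesis of the one-step estimate from the position at the start alone. The
    excursion is at most 1/2 of the available margin 1, which is what [exit_time] needs; the end s0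
    may come before the period is over. *)
Lemma local_range (w t0 t1 : R) (x : R -> V) (a s0 : R) :
  0 < w -> 4 * C ^+ 3 * (Num.sqrt w)^-1 <= 1 ->
  trajectory (input_affine b u w) rho t0 t1 x -> t0 <= a -> `|x a| <= rho - 1 ->
  a <= s0 -> s0 <= t1 -> s0 <= a + T / w ->
  forall t, a <= t <= s0 -> cube rho (x t) /\ `|x t - x a| <= 2 * C ^+ 3 * (Num.sqrt w)^-1.
Proof.
move=> w0 h4 tr ta xa as0 s01 s0e.
set r := Num.sqrt w in h4 *; set h := r^-1 in h4 *.
have r0 : 0 < r by rewrite sqrtr_gt0.
have h0 : 0 < h by rewrite invr_gt0.
have hr : h * r = 1 by rewrite mulVf // gt_eqF.
have C3 : 1 <= C ^+ 3 by exact: exprn_ege1.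
have h1 : h <= 1.
  by apply: le_trans h4; rewrite ler_peMl ?(ltW h0) //; lra.
have r1 : 1 <= r by rewrite -hr ler_piMl // ltW.
have eC : T / w <= C * h ^+ 2.
  have -> : T / w = T * h ^+ 2 by rewrite -(sqr_sqrtr (ltW w0)) -/r exprVn.
  rewrite ler_wpM2r ?sqr_ge0 //; apply: (@le_trans _ _ c) => //; exact: step_const_ge.
have trS := trajectoryS ta s01 tr.
have move t : a <= t <= s0 -> (forall q, a <= q <= t -> cube rho (x q)) ->
    `|x t - x a| <= 2 * C ^+ 3 * h.
  move=> /andP[h5 h6] hc; have [_ ix] := trS.
  have [i1 ->] := ix a t (lexx a) h5 h6 hc.
  apply: le_trans (_ : 2 * C ^+ 2 * r * (t - a) <= _).
    apply: (VLint_le h5 i1) => q hq.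
    by apply: input_affine_bound => //; exact: hc.
  have -> : 2 * C ^+ 3 * h = 2 * C ^+ 2 * r * (C * h ^+ 2).
    by transitivity (2 * C ^+ 3 * h * (h * r)); [rewrite hr mulr1|ring].
  rewrite ler_wpM2l ?mulr_ge0 ?exprn_ge0 ?(ltW r0) //; apply: le_trans eC; lra.
have half : 2 * C ^+ 3 * h <= 2^-1 by move: h4; lra.
have bound t : `|x t - x a| <= 2 * C ^+ 3 * h -> `|x t| <= rho - 2^-1.
  move=> hd; have : `|x t| <= `|x t - x a| + `|x a| by rewrite -{1}[x t](subrK (x a)); exact: ler_normD.
  lra.
have stay : forall t, a <= t <= s0 -> `|x t| <= rho - 2^-1.
  apply: (exit_time trS as0); first by lra.
    by apply: bound; rewrite subrr normr0 mulr_ge0 ?mulr_ge0 ?exprn_ge0 // ltW.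
  by move=> t ht hc; apply: bound; exact: move.
move=> t ht; have /andP[h5 h6] := ht.
have hc q : a <= q <= t -> cube rho (x q).
  move=> /andP[h7 h8]; apply: le_trans (stay q _) _; last by lra.
  by rewrite h7 (le_trans h8).
split; last exact: move.
by apply: hc; rewrite h5 lexx.
Qed.

(** Of the margin 2 between z and the boundary of the cube, 1 is left to the accumulated error and 1
    to the excursion of x within a period. The threshold depends on neither t0 nor the two
    curves. *)
Lemma tracking (tau eta : R) : 0 < tau -> 0 < eta ->
  exists2 h1, 0 < h1 & forall w, 0 < w -> (Num.sqrt w)^-1 <= h1 ->
  forall t0 t1 (z x : R -> V), t1 <= t0 + tau ->
  (forall t, t0 <= t <= t1 -> `|z t| <= rho - 2) ->
  (forall s t, t0 <= s -> s <= t -> t <= t1 ->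
     VLintegrable s t (fun ta => lie_bracket_system b u T ta (z ta)) /\
     z t - z s = VLint s t (fun ta => lie_bracket_system b u T ta (z ta))) ->
  trajectory (input_affine b u w) rho t0 (t1) x -> x t0 = z t0 ->
  forall t, t0 <= t <= t1 -> `|x t - z t| <= eta.
Proof.
move=> tau0 eta0.
have [K K1 [LB_bd LB_lip]] := lie_bracket_lipschitz.
have K0 : 0 <= K by exact: le_trans K1.
have [D [D0 stepD]] : exists D, 0 <= D /\ forall w a (x : R -> V), 0 < w ->
    2 * C ^+ 3 / Num.sqrt w <= 1 -> `|x a| <= rho - 1 ->
    (forall s, a <= s <= a + T / w -> cube rho (x s)) ->
    (forall s t, a <= s -> s <= t -> t <= a + T / w ->
      VLintegrable s t (fun ta => input_affine b u w ta (x ta)) /\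
      x t - x s = VLint s t (fun ta => input_affine b u w ta (x ta))) ->
    `|x (a + T / w) - x a - (T / w) *: lie_bracket_system b u T a (x a)| <= D * (Num.sqrt w)^-1 ^+ 3.
  (* D is read off from [one_step] by unification, which ensures that it depends on neither w, a nor
     x. *)
  eexists; split; last first.
    by move=> w a x h1 h2 h3 h4 h5;
       exact: (one_step c1 T0 Tc b_C2 b_lip b_jac lie_lip u_meas u_lip u_bound u_mean h1 h2 h3 h4 h5).
  by rewrite !(addr_ge0, mulr_ge0, exprn_ge0).
(* The second term is the local error of z itself: K (1 + K) e^2 with e = T h^2 and h <= 1. *)
pose D3 := D + 2 * K ^+ 2 * T ^+ 2.
have D30 : 0 <= D3 by rewrite addr_ge0 // !mulr_ge0 ?exprn_ge0 // ltW.
(* At most tau / (T h^2) periods, each with error D3 h^3, amplified by exp(K tau): the accumulated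
   error is D4 h. *)
pose D4 := D3 * (tau / T) * expR (K * tau).
have D40 : 0 <= D4 by rewrite !mulr_ge0 ?expR_ge0 ?invr_ge0 // ltW.
(* Q h <= 1 yields all smallness conditions; Q h <= eta covers the accumulated error and the motions
   of x and z in the last, incomplete period. *)
pose Q := 4 * C ^+ 3 + D4 + K * T + 1.
have C30 : 0 <= C ^+ 3 by rewrite exprn_ge0.
have C31 : 1 <= C ^+ 3 by exact: exprn_ege1.
have KT0 : 0 <= K * T by rewrite mulr_ge0 // ltW.
have Q0 : 0 < Q by rewrite /Q; lra.
exists (Num.min Q^-1 (eta / Q)); first by rewrite lt_min invr_gt0 Q0 divr_gt0.
move=> w w0; rewrite le_min => /andP[hq1 hq2] t0 t1 z x t1tau zc zi tr xz0.
set h := (Num.sqrt w)^-1 in hq1 hq2 *.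
have r0 : 0 < Num.sqrt w by rewrite sqrtr_gt0.
have h0 : 0 < h by rewrite invr_gt0.
have h0' := ltW h0.
have Qh1 : Q * h <= 1 by rewrite mulrC -ler_pdivlMr // div1r.
have Qh2 : Q * h <= eta by rewrite mulrC -ler_pdivlMr.
have p1 : 0 <= C ^+ 3 * h by rewrite mulr_ge0.
have p2 : 0 <= D4 * h by rewrite mulr_ge0.
have p3 : 0 <= K * T * h by rewrite mulr_ge0.
have QE : Q * h = 4 * (C ^+ 3 * h) + D4 * h + K * T * h + h by rewrite /Q; ring.
have h4 : 4 * C ^+ 3 * h <= 1 by rewrite -mulrA; lra.
have h2 : 2 * C ^+ 3 / Num.sqrt w <= 1 by rewrite -/h -mulrA; lra.
have h1 : h <= 1 by lra.
pose e := T / w.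
have e0 : 0 < e by exact: divr_gt0.
have eE : e = T * h ^+ 2 by rewrite /e -(sqr_sqrtr (ltW w0)) exprVn.
have eT : e <= T * h by rewrite eE ler_wpM2l ?(ltW T0) // expr2 ler_piMr.
have D4h : D4 * h <= 1 by lra.
have zcube t : t0 <= t <= t1 -> cube rho (z t).
  by move=> /zc; rewrite /cube /=; lra.
have zspeed s t : t0 <= s -> s <= t -> t <= t1 -> `|z t - z s| <= K * (t - s).
  move=> k1 k2 k3; have [i1 ->] := zi s t k1 k2 k3; apply: (VLint_le k2 i1) => q /andP[q1 q2].
  by apply/LB_bd/zcube; rewrite (le_trans k1 q1) (le_trans q2).
have zstep a : t0 <= a -> a + e <= t1 ->
    `|z (a + e) - z a - e *: lie_bracket_system b u T a (z a)| <= 2 * K ^+ 2 * T ^+ 2 * h ^+ 3.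
  move=> k1 k2; have ae : a <= a + e by rewrite lerDl ltW.
  have [i1 ->] := zi a (a + e) k1 ae k2.
  have zac : cube rho (z a) by apply: zcube; rewrite k1 (le_trans ae).
  have ci : VLintegrable a (a + e) (fun _ => lie_bracket_system b u T a (z a)).
    by move=> k; apply/bmeas_Lintegrable/bmeas_cst.
  have -> : e *: lie_bracket_system b u T a (z a) =
      VLint a (a + e) (fun _ => lie_bracket_system b u T a (z a)).
    by rewrite (VLint_cst _ ae) addrAC subrr add0r.
  rewrite -(VLintB i1 ci).
  apply: le_trans (_ : K * (e + K * e) * (a + e - a) <= _).
    apply: (VLint_le ae (VLintegrableB i1 ci)) => q /andP[q1 q2].
    have qc : cube rho (z q) by apply: zcube; rewrite (le_trans k1 q1) (le_trans q2).
    apply: le_trans (LB_lip _ _ _ _ zac qc) _; rewrite ler_wpM2l //.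
    have qa : 0 <= q - a by rewrite subr_ge0.
    have qe : q - a <= e by lra.
    apply: lerD; first by rewrite ger0_norm.
    apply: le_trans (zspeed a q k1 q1 (le_trans q2 k2)) _.
    by rewrite ler_wpM2l.
  rewrite [a + e - a]addrAC subrr add0r.
  have -> : K * (e + K * e) * e = (K * (1 + K)) * e ^+ 2 by ring.
  have -> : 2 * K ^+ 2 * T ^+ 2 * h ^+ 3 = (K * (K + K)) * (T ^+ 2 * h ^+ 3) by ring.
  have K20 : 0 <= K * (1 + K) by rewrite mulr_ge0 // addr_ge0.
  apply: (ler_pM K20 (sqr_ge0 e)); first by rewrite ler_wpM2l // lerD2r.
  rewrite eE exprMn ler_wpM2l ?exprn_ge0 ?(ltW T0) // -exprM.
  by rewrite ler_wiXn2l.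
pose ak k := t0 + k%:R * e.
have akS k : ak k.+1 = ak k + e by rewrite /ak -natr1 mulrDl mul1r addrA.
have ak0 k : t0 <= ak k by rewrite lerDl mulr_ge0 // ltW.
have growth k : ak k <= t1 ->
    `|x (ak k) - z (ak k)| <= D3 * h ^+ 3 * k%:R * expR (K * (k%:R * e)) ->
    `|x (ak k) - z (ak k)| <= D4 * h.
  move=> at1 Ek; apply: le_trans Ek _.
  have ket : k%:R * e <= tau by have := le_trans at1 t1tau; rewrite /ak lerD2l.
  have -> : D4 * h = (D3 * (tau / T) * h) * expR (K * tau) by rewrite /D4; ring.
  apply: ler_pM; rewrite ?expR_ge0 ?mulr_ge0 ?exprn_ge0 //; last by rewrite ler_expR ler_wpM2l.
  have -> : D3 * h ^+ 3 * k%:R = D3 * (k%:R * h ^+ 2) * h by ring.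
  rewrite ler_wpM2r // ler_wpM2l // ler_pdivlMr //.
  by move: ket; rewrite eE; set q := k%:R; have -> : q * (T * h ^+ 2) = q * h ^+ 2 * T by ring.
(* The bound at step k, through [growth], places x within the cube of radius rho - 1, which is what
   allows the next step. *)
have main k : ak k <= t1 ->
    `|x (ak k) - z (ak k)| <= D3 * h ^+ 3 * k%:R * expR (K * (k%:R * e)).
  elim: k => [_|k IH kt].
    by rewrite /ak mul0r addr0 xz0 subrr normr0 mulr0 mul0r.
  rewrite akS in kt *; set a := ak k in IH kt *.
  have at1 : a <= t1 by apply: le_trans kt; rewrite lerDl ltW.
  have ta : t0 <= a by exact: ak0.
  have zac : cube rho (z a) by apply: zcube; rewrite ta.
  have Ek := IH at1.
  have EkD := growth k at1 Ek.
  have xa : `|x a| <= rho - 1.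
    have : `|x a| <= `|x a - z a| + `|z a| by rewrite -{1}[x a](subrK (z a)); exact: ler_normD.
    have := zc a ltac:(by rewrite ta at1); lra.
  have ae : a <= a + e by rewrite lerDl ltW.
  have loc := local_range w0 h4 tr ta xa ae kt (lexx _).
  have xcube s : a <= s <= a + T / w -> cube rho (x s) by move=> /loc[].
  have xint s t : a <= s -> s <= t -> t <= a + T / w ->
      VLintegrable s t (fun ta => input_affine b u w ta (x ta)) /\
      x t - x s = VLint s t (fun ta => input_affine b u w ta (x ta)).
    move=> k1 k2 k3; have [_ ix] := tr; apply: ix => //.
    - exact: le_trans k1.
    - exact: le_trans k3 kt.
    - by move=> q /andP[q1 q2]; apply: xcube; rewrite (le_trans k1 q1) (le_trans q2).
  have xs := stepD w a x w0 h2 xa xcube xint.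
  have zs := zstep a ta kt.
  rewrite -/e -/h in xs.
  have LL : `|lie_bracket_system b u T a (x a) - lie_bracket_system b u T a (z a)| <= K * `|x a - z a|.
    have xac : cube rho (x a) by apply: xcube; rewrite lexx ae.
    by have := LB_lip a a _ _ zac xac; rewrite (subrr a) normr0 add0r.
  have E1 : `|x (a + e) - z (a + e)| <= (1 + K * e) * `|x a - z a| + D3 * h ^+ 3.
    move: xs zs LL.
    move: (lie_bracket_system b u T a (x a)) (lie_bracket_system b u T a (z a)) => fx fz xs zs LL.
    have -> : x (a + e) - z (a + e) = (x a - z a) + e *: (fx - fz) +
      (x (a + e) - x a - e *: fx) - (z (a + e) - z a - e *: fz).
      by apply/rowP => i; rewrite !mxE; ring.
    have eLL : `|e *: (fx - fz)| <= e * (K * `|x a - z a|).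
      by rewrite normrZ gtr0_norm // ler_wpM2l // ltW.
    have := ler_normB ((x a - z a) + e *: (fx - fz) + (x (a + e) - x a - e *: fx))
      (z (a + e) - z a - e *: fz).
    have := ler_normD ((x a - z a) + e *: (fx - fz)) (x (a + e) - x a - e *: fx).
    have := ler_normD (x a - z a) (e *: (fx - fz)).
    have -> : D3 * h ^+ 3 = D * h ^+ 3 + 2 * K ^+ 2 * T ^+ 2 * h ^+ 3 by rewrite /D3 mulrDl.
    move: xs zs eLL.
    have -> : (1 + K * e) * `|x a - z a| = `|x a - z a| + e * (K * `|x a - z a|) by ring.
    lra.
  apply: le_trans E1 _.
  have Ke0 : 0 <= K * e by rewrite mulr_ge0 // ltW.
  have eK : expR (K * (k.+1%:R * e)) = expR (K * e) * expR (K * (k%:R * e)).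
    by rewrite -expRD -natr1; congr expR; ring.
  have ge1 : 1 + K * e <= expR (K * e) by exact: expR_ge1Dx.
  have ge2 : 1 <= expR (K * (k.+1%:R * e)).
    have ke0 : 0 <= k.+1%:R * e by rewrite mulr_ge0 // ltW.
    by rewrite -[leLHS]expR0 ler_expR mulr_ge0.
  have -> : D3 * h ^+ 3 * k.+1%:R * expR (K * (k.+1%:R * e)) =
    expR (K * e) * (D3 * h ^+ 3 * k%:R * expR (K * (k%:R * e))) +
    D3 * h ^+ 3 * expR (K * (k.+1%:R * e)) by rewrite eK -natr1; ring.
  have D3h : 0 <= D3 * h ^+ 3 by rewrite mulr_ge0 ?exprn_ge0.
  apply: lerD; last by rewrite ler_peMr.
  have Ke1 : 0 <= 1 + K * e by rewrite addr_ge0.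
  exact: (ler_pM Ke1 (normr_ge0 _) ge1 Ek).
move=> t /andP[tt0 ttau].
pose k := Num.truncn ((t - t0) / e).
have tk : 0 <= (t - t0) / e by rewrite divr_ge0 ?subr_ge0 // ltW.
have kt : ak k <= t.
  rewrite /ak -lerBrDl -ler_pdivlMr //.
  by have := truncn_itv tk => /andP[].
have tk1 : t <= ak k + e.
  rewrite -akS /ak -lerBlDl -ler_pdivrMr //.
  by have := truncn_itv tk => /andP[_ /ltW].
set a := ak k in kt tk1.
have ta : t0 <= a by exact: ak0.
have at1 : a <= t1 by exact: le_trans ttau.
have EkD := growth k at1 (main k at1).
have xa : `|x a| <= rho - 1.
  have : `|x a| <= `|x a - z a| + `|z a| by rewrite -{1}[x a](subrK (z a)); exact: ler_normD.
  have := zc a ltac:(by rewrite ta at1); lra.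
have [_ l1] := local_range w0 h4 tr ta xa kt ttau tk1 (ltac:(by rewrite kt lexx) : a <= t <= t).
rewrite -/h in l1.
have l2 : `|z t - z a| <= K * T * h.
  apply: le_trans (zspeed a t ta kt ttau) _; rewrite -mulrA ler_wpM2l //.
  by apply: le_trans eT; lra.
have -> : x t - z t = (x t - x a) + (x a - z a) - (z t - z a).
  by apply/rowP => i; rewrite !mxE; ring.
have := ler_normB ((x t - x a) + (x a - z a)) (z t - z a).
have := ler_normD (x t - x a) (x a - z a).
move: l1; rewrite -mulrA; lra.
Qed.

End Tracking.

(** * Practical stability *)

Section Neighbourhoods.
Context {R : realType} {n : nat}.
Notation V := 'rV[R]_n.
Implicit Types (S : set V) (a d e : R) (x y : V).

Lemma UnbhdP S a x : Unbhd S a x <-> exists2 y, S y & enorm (x - y) < a.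
Proof.
split=> [/ereal_inf_lt[_ [y Sy <-]]|[y Sy h]]; first by rewrite lte_fin; exists y.
rewrite /Unbhd /=; apply: le_lt_trans (_ : (enorm (x - y))%:E < _)%E; last by rewrite lte_fin.
by apply: ereal_inf_lbound; exists y.
Qed.

Lemma UnbhdW S a a' x : a <= a' -> Unbhd S a x -> Unbhd S a' x.
Proof. by move=> aa /UnbhdP[y Sy h]; apply/UnbhdP; exists y => //; exact: lt_le_trans aa. Qed.

(** Tracking is measured in the sup norm and neighbourhoods in the Euclidean norm; dividing by n.+1
    instead of n covers n = 0. *)
Lemma Unbhd_shift S a e x y : Unbhd S a x -> `|y - x| <= e / n.+1%:R -> 0 <= e ->
  Unbhd S (a + e) y.
Proof.
move=> /UnbhdP[p Sp h] hy e0; apply/UnbhdP; exists p => //.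
have hyx : enorm (y - x) <= e.
  apply: le_trans (enorm_le_mxnorm _) _; apply: le_trans (ler_wpM2l (ler0n _ _) hy) _.
  by rewrite mulrCA ler_piMr // ler_pdivrMr ?ltr0Sn // mul1r ler_nat.
have := enormD (y - x) (x - p); rewrite addrA subrK; lra.
Qed.

Lemma Unbhd_bounded S : compact S -> exists2 M : R, 0 <= M &
  forall a x, Unbhd S a x -> `|x| <= M + a.
Proof.
move=> /compact_bounded[M [_ hM]]; exists (`|M| + 1); first by rewrite addr_ge0.
move=> a x /UnbhdP[y Sy h]; rewrite -[x](subrK y).
apply: le_trans (ler_normD _ _) _; rewrite addrC; apply: lerD.
  by apply: (hM (`|M| + 1)) => //; rewrite ltr_pwDr // ler_norm.
exact: le_trans (mxnorm_le_enorm _) (ltW h).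
Qed.

End Neighbourhoods.

Section SolutionsAsTrajectories.
Context {R : realType} {n : nat}.
Notation V := 'rV[R]_n.
Implicit Types (f : R -> V -> V) (x : R -> V).

Lemma itv_left_sub (t0 s t : R) b : t \in Interval (BLeft t0) b -> t0 <= s -> s <= t ->
  s \in Interval (BLeft t0) b.
Proof.
rewrite !itv_boundlr => /andP[h1 h2] h3 h4; apply/andP; split; first by rewrite bnd_simp.
by apply: le_trans h2; rewrite bnd_simp.
Qed.

Lemma solution_start f t0 (x0 : V) b x t : solution f t0 x0 b x -> t \in Interval (BLeft t0) b ->
  x t0 = x0.
Proof.
move=> sol ht; have t0t : t0 <= t by move: ht; rewrite itv_boundlr bnd_simp => /andP[].
have [_ [i1 ->]] := sol t0 (itv_left_sub ht (lexx _) t0t).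
by rewrite [X in x0 + X](VLint_point i1) addr0.
Qed.

Lemma solution_increment f t0 (x0 : V) b x s t : solution f t0 x0 b x ->
  t \in Interval (BLeft t0) b -> t0 <= s -> s <= t ->
  VLintegrable s t (fun ta => f ta (x ta)) /\ x t - x s = VLint s t (fun ta => f ta (x ta)).
Proof.
move=> sol ht t0s st.
have [_ [i1 xt]] := sol t ht; have [_ [i2 xs]] := sol s (itv_left_sub ht t0s st).
have iS : VLintegrable s t (fun ta => f ta (x ta)) := VLintegrableS t0s (lexx t) i1.
split=> //; rewrite xt xs -!/(VLint _ _ (fun ta => f ta (x ta))).
by rewrite (VLint_chasles t0s st i1) opprD addrACA subrr add0r addrAC subrr add0r.
Qed.

Lemma solution_trajectory f rho t0 (x0 : V) b x t1 : solution f t0 x0 b x ->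
  t1 \in Interval (BLeft t0) b -> trajectory f rho t0 t1 x.
Proof.
move=> sol ht; split=> [t /andP[h1 h2] e e0|s t hs st htt _]; last first.
  by apply: solution_increment sol (itv_left_sub ht (le_trans hs st) htt) hs st.
have [ac _] := sol t1 ht; have [d d0 hd] := ac e e0.
exists d => // s /andP[s1 s2] st.
have key p q : t0 <= p -> p <= q -> q <= t1 -> q - p < d -> `|x q - x p| < e.
  move=> k1 k2 k3 k4; apply: le_lt_trans (mxnorm_le_enorm _) _.
  (* Absolute continuity with a single interval is uniform continuity. *)
  have := hd 1%N (fun _ => p) (fun _ => q); rewrite !big_ord1; apply=> // i j.
  by rewrite !ord1 eqxx.
have [ts|ts] := leP t s.
  by apply: key => //; rewrite ger0_norm ?subr_ge0 in st.
rewrite distrC; apply: key => //; first exact: ltW.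
by rewrite distrC ger0_norm ?subr_ge0 // ltW in st.
Qed.

Lemma lipschitz_solution f t0 (x0 : V) x A : 0 <= A -> x t0 = x0 ->
  (forall s t, `|x s - x t| <= A * `|s - t|) ->
  (forall t, t0 <= t -> VLintegrable t0 t (fun ta => f ta (x ta)) /\
     x t - x t0 = VLint t0 t (fun ta => f ta (x ta))) ->
  solution f t0 x0 +oo%O x.
Proof.
move=> A0 xt0 lx ix t; rewrite itv_boundlr bnd_simp => /andP[t0t _].
have [i1 i2] := ix t t0t; split; last by split=> //; rewrite -xt0 -[LHS](subrK (x t0)) i2 addrC.
have B0 : 0 <= n%:R * A by rewrite mulr_ge0.
move=> e e0; exists (e / (n%:R * A + 1)); first by rewrite divr_gt0 // ltr_wpDl.
move=> k l r hlr _; rewrite ltr_pdivlMr ?ltr_wpDl //; apply: le_lt_trans.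
rewrite mulr_suml; apply: ler_sum => i _; have [_ [lr _]] := hlr i.
apply: le_trans (enorm_le_mxnorm _) _.
apply: le_trans (ler_wpM2l (ler0n _ _) (lx _ _)) _.
have lr0 : 0 <= r i - l i by rewrite subr_ge0.
by rewrite ger0_norm // mulrA mulrC ler_wpM2l // lerDl.
Qed.

End SolutionsAsTrajectories.

Section PracticalStability.
Context {R : realType} {n : nat}.
Notation V := 'rV[R]_n.
Variables (F : R -> R -> V -> V) (G : R -> V -> V) (S : set V) (M : R).
Hypothesis M0 : 0 <= M.
Hypothesis S_bounded : forall a x, Unbhd S a x -> `|x| <= M + a.

(** Together with [has_trajectories], all that the transfer of stability knows about F and G. The
    threshold w0 is uniform in the initial time, the initial value and the curves. *)
Definition approximates : Prop := forall rho tau eta : R, 0 <= rho -> 0 < tau -> 0 < eta ->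
  exists2 w0, 0 < w0 & forall w, w0 < w -> forall t0 t1 (z0 : V) (z x : R -> V),
  t1 <= t0 + tau -> solution G t0 z0 +oo%O z ->
  (forall t, t0 <= t <= t1 -> `|z t| <= rho - 2) ->
  trajectory (F w) rho t0 t1 x -> x t0 = z0 ->
  forall t, t0 <= t <= t1 -> `|x t - z t| <= eta.

(** The curve solves the modified equation; it becomes a solution of the true one once an a priori
    bound shows that it remains in the cube. *)
Definition has_trajectories : Prop := forall rho : R, 0 <= rho ->
  exists2 w0, 0 < w0 & forall w, w0 < w -> forall t0 (x0 : V),
  exists2 x : R -> V, forall t1, trajectory (F w) rho t0 t1 x &
    x t0 = x0 /\
    ((forall t, t0 <= t -> cube rho (x t)) -> solution (F w) t0 x0 +oo%O x).

Hypotheses (F_approx : approximates) (F_traj : has_trajectories).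

(** [steers] also provides a solution z of (LB) from x(t0) on the whole half-line, so a comparison
    curve is always at hand; its bound e1 determines how large the cube has to be. *)
Lemma window_tracking (d e1 tf d2 eps rho tau : R) : 0 < eps -> 0 < e1 -> 0 < tau -> M + e1 + 2 <= rho ->
  (forall t0, steers G S t0 d t0 e1) -> (forall t0, steers G S t0 d (t0 + tf) d2) ->
  exists2 w0, 0 < w0 & forall w, w0 < w -> forall t0 t1 (x : R -> V),
  trajectory (F w) rho t0 t1 x -> t1 <= t0 + tau -> Unbhd S d (x t0) ->
  forall t, t0 <= t <= t1 ->
    Unbhd S (e1 + eps) (x t) /\ (t0 + tf <= t -> Unbhd S (d2 + eps) (x t)).
Proof.
move=> eps0 e10 tau0 rhoM st1 st2.
have rho0 : 0 <= rho by move: M0; lra.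
have eta0 : 0 < eps / n.+1%:R by rewrite divr_gt0.
have [w0 w00 hw] := F_approx rho0 tau0 eta0.
exists w0 => // w ww t0 t1 x tr t1t xd t /andP[ht ht1].
have [[z zsol] zst] := st1 t0 _ xd; have [_ zst2] := st2 t0 _ xd.
have inf q : t0 <= q -> q \in Interval (BLeft t0) (+oo%O : itv_bound R).
  by move=> hq; rewrite itv_boundlr bnd_simp hq.
have zr q : t0 <= q <= t1 -> `|z q| <= rho - 2.
  by move=> /andP[q0 _]; have := S_bounded (zst _ _ zsol q (inf q q0) q0); lra.
have htt : t0 <= t <= t1 by rewrite ht.
have xz := hw w ww t0 t1 _ z x t1t zsol zr tr erefl t htt.
split=> [|tft].
  exact: Unbhd_shift (zst _ _ zsol t (inf t ht) ht) xz (ltW eps0).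
exact: Unbhd_shift (zst2 _ _ zsol t (inf t ht) tft) xz (ltW eps0).
Qed.

(* After the time tf, attraction to U_{d/2} has absorbed the tracking error, so that the
   solution z can be restarted from x at each multiple of tf + 1. *)
Lemma trajectory_invariance (d e1 e rho : R) : 0 < d -> 0 < e1 -> e1 < e -> M + e + 2 <= rho ->
  (forall t0, steers G S t0 d t0 e1) -> unif_attractive d G S ->
  exists2 w0, 0 < w0 & forall w, w0 < w -> forall t0 t1 (x : R -> V),
  trajectory (F w) rho t0 t1 x -> t0 <= t1 -> Unbhd S d (x t0) -> Unbhd S e (x t1).
Proof.
move=> d0 e10 e1e rhoM st att.
have d20 : 0 < d / 2 by lra.
have [tf tf0 st2] := att _ d20.
(* eps <= d / 2 brings x back into U_d for the restart, and eps <= e - e1 keeps it in U_e in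
   between. *)
pose eps := Num.min (d / 2) (e - e1).
have eps0 : 0 < eps by rewrite lt_min d20 subr_gt0.
have [epsd epse] : eps <= d / 2 /\ eps <= e - e1 by apply/andP; rewrite -le_min.
(* The window has length tf + 1 rather than tf to be positive when tf = 0. *)
have tau0 : 0 < tf + 1 by rewrite ltr_wpDl.
have rhoM1 : M + e1 + 2 <= rho by lra.
have [w0 w00 hw] := window_tracking eps0 e10 tau0 rhoM1 st st2.
exists w0 => // w ww t0 t1 x tr t01 xd.
set tau := tf + 1 in tau0 hw.
have ak0 k : t0 <= t0 + k%:R * tau by rewrite lerDl mulr_ge0 // ltW.
have akS k : t0 + k.+1%:R * tau = t0 + k%:R * tau + tau by rewrite -natr1; ring.
have main k : t0 + k%:R * tau <= t1 -> Unbhd S d (x (t0 + k%:R * tau)).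
  elim: k => [_|k IH]; first by rewrite mul0r addr0.
  rewrite akS; set a := t0 + k%:R * tau in IH *; move=> at1.
  have a1 : a <= t1 by apply: le_trans at1; rewrite lerDl ltW.
  have trS := trajectoryS (ak0 k) at1 tr.
  have hin : a <= a + tau <= a + tau by rewrite lexx andbT lerDl ltW.
  have [_ h] := hw w ww _ _ _ trS (lexx _) (IH a1) _ hin.
  apply: UnbhdW (h _); first by lra.
  by rewrite lerD2l /tau lerDl.
have q0 : 0 <= (t1 - t0) / tau by rewrite divr_ge0 ?subr_ge0 // ltW.
have /andP[k1 k2] := truncn_itv q0.
set k := Num.truncn _ in k1 k2.
have kt : t0 + k%:R * tau <= t1 by rewrite -lerBrDl -ler_pdivlMr.
have tk : t1 <= t0 + k%:R * tau + tau by rewrite -akS -lerBlDl -ler_pdivrMr // ltW.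
have trS := trajectoryS (ak0 k) (lexx t1) tr.
have hin : t0 + k%:R * tau <= t1 <= t1 by rewrite kt lexx.
have [h _] := hw w ww _ _ _ trS tk (main k kt) _ hin.
by apply: UnbhdW h; lra.
Qed.

(** Both halves of [steers] at once. Existence: the modified solution is a trajectory, so the bound
    e' holds it in the cube and it solves the true equation. Conclusion for all solutions: each of
    them is a trajectory. *)
Lemma steers_of_trajectories (d e e' tf rho w0 : R) : 0 <= tf -> 0 <= rho -> M + e' <= rho -> 0 < w0 ->
  (forall w, w0 < w -> forall t0 t1 (x : R -> V),
     trajectory (F w) rho t0 t1 x -> t0 <= t1 -> Unbhd S d (x t0) ->
     Unbhd S e' (x t1) /\ (t0 + tf <= t1 -> Unbhd S e (x t1))) ->
  exists2 w1, 0 < w1 & forall t0 w, w1 < w -> steers (F w) S t0 d (t0 + tf) e.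
Proof.
move=> tf0 rho0 rhoM w00 H; have [w2 w20 hw2] := F_traj rho0.
exists (Num.max w0 w2); first by rewrite lt_max w00.
move=> t0 w; rewrite gt_max => /andP[ww0 ww2] x0 xd; split.
  have [x tr [xt0 sol]] := hw2 w ww2 t0 x0; exists x; apply: sol => t t0t.
  rewrite -xt0 in xd.
  have [h _] := H w ww0 _ _ _ (tr t) t0t xd.
  exact: le_trans (S_bounded h) rhoM.
move=> b x sol t ht st.
have xt0 := solution_start sol ht; rewrite -xt0 in xd.
have tr := solution_trajectory rho sol ht.
have t0t : t0 <= t by apply: le_trans st; rewrite lerDl.
by have [_ h] := H w ww0 _ _ _ tr t0t xd; exact: h.
Qed.

Lemma pract_steers (d e1 e : R) : 0 < d -> 0 < e1 -> e1 < e ->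
  (forall t0, steers G S t0 d t0 e1) -> unif_attractive d G S ->
  exists2 w1, 0 < w1 & forall t0 w, w1 < w -> steers (F w) S t0 d t0 e.
Proof.
move=> d0 e10 e1e st att.
have [w0 w00 hw] := trajectory_invariance d0 e10 e1e (lexx _) st att.
have rho0 : 0 <= M + e + 2 by move: M0; lra.
have rhoM : M + e <= M + e + 2 by lra.
have [|w1 w10 h] := steers_of_trajectories (e := e) (lexx 0) rho0 rhoM w00 (d := d).
  by move=> w ww t0 t1 x tr t01 xd; have h := hw w ww _ _ _ tr t01 xd.
by exists w1 => // t0 w ww; have := h t0 w ww; rewrite addr0.
Qed.

(** Stability and boundedness of F also use attractivity of G, because tracking holds over bounded
    time intervals only. *)
Theorem practical_stability : globally_unif_asympt_stable G S ->
  semiglobally_pract_unif_asympt_stable F S.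
Proof.
move=> [Gst Gatt Gbd]; split=> [e e0|d d0 e e0|d d0].
- have e20 : 0 < e / 2 by lra.
  have [d d0 st] := Gst _ e20; exists d => //.
  by apply: pract_steers st (Gatt d d0) => //; lra.
- have e20 : 0 < e / 2 by lra.
  (* Attraction aims at U_{d'/2}; the tracking error d'/2 then still leaves x in U_{d'}, from where
     invariance keeps it in U_e. *)
  have [d' d'0 st'] := Gst _ e20; have d20 : 0 < d' / 2 by lra.
  have [e1 e10 st] := Gbd d d0; have [tf tf0 st2] := Gatt d d0 _ d20.
  (* The sum of the radii serves as a common bound for the transient phase and for the time after
     it. *)
  pose rho := M + (e1 + d' / 2 + e) + 2.
  have rho0 : 0 <= rho by move: M0; rewrite /rho; lra.
  have [||w1 w10 hw1] := trajectory_invariance (e := e) (rho := rho) d'0 e20 _ _ st' (Gatt d' d'0).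
  - lra.
  - rewrite /rho; lra.
  have tau0 : 0 < tf + 1 by rewrite ltr_wpDl.
  have [|w2 w20 hw2] := window_tracking (rho := rho) d20 e10 tau0 _ st st2; first by rewrite /rho; lra.
  exists tf => //.
  have rhoM : M + (e1 + d' / 2 + e) <= rho by rewrite /rho; lra.
  have w30 : 0 < Num.max w1 w2 by rewrite lt_max w10.
  apply: (steers_of_trajectories tf0 rho0 rhoM w30) => w; rewrite gt_max => /andP[ww1 ww2] t0 t1 x tr t01 xd.
  have late : t0 + tf <= t1 -> Unbhd S e (x t1).
    move=> tft1; have tft : t0 <= t0 + tf by rewrite lerDl.
    have trS := trajectoryS (lexx t0) tft1 tr.
    have ttau : t0 + tf <= t0 + (tf + 1) by rewrite lerD2l lerDl.
    have hin : t0 <= t0 + tf <= t0 + tf by rewrite tft lexx.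
    have [_ h] := hw2 w ww2 _ _ _ trS ttau xd _ hin.
    have xd' : Unbhd S d' (x (t0 + tf)) by apply: UnbhdW (h (lexx _)); lra.
    exact: hw1 w ww1 _ _ _ (trajectoryS tft (lexx t1) tr) tft1 xd'.
  split=> //; have [tft1|/ltW t1tf] := leP (t0 + tf) t1.
    by apply: UnbhdW (late tft1); lra.
  have ttau : t1 <= t0 + (tf + 1) by apply: le_trans t1tf _; rewrite lerD2l lerDl.
  have hin : t0 <= t1 <= t1 by rewrite t01 lexx.
  have [h _] := hw2 w ww2 _ _ _ tr ttau xd _ hin.
  by apply: UnbhdW h; lra.
- have [e1 e10 st] := Gbd d d0; exists (e1 + 1); first by lra.
  by apply: pract_steers st (Gatt d d0) => //; lra.
Qed.

End PracticalStability.

(** * The input-affine system satisfies the hypotheses of the stability transfer *)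

Section Averaging.
Context {R : realType} {n m : nat}.
Notation V := 'rV[R]_n.
Variables (b : 'I_m.+1 -> R -> V -> V) (u : 'I_m -> R -> R -> R) (T : R).
Hypotheses (hA1 : assumption_A1 b) (hA2 : assumption_A2 b) (hA3 : assumption_A3 u)
  (hT : 0 < T) (hA4 : assumption_A4 u T).

Lemma input_bounds : exists2 c, 0 <= c &
  (forall i t1 t2 th, `|u i t1 th - u i t2 th| <= c * `|t1 - t2|) /\
  (forall i t th, `|u i t th| <= c).
Proof.
have /choice[LM hLM] : forall i, exists p : R * R, [/\ 0 < p.1, 0 < p.2,
      forall t1 t2 th, `|u i t1 th - u i t2 th| <= p.1 * `|t1 - t2|
    & forall t th, `|u i t th| <= p.2].
  by move=> i; have [_ [L [M h]]] := hA3 i; exists (L, M).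
pose c := \sum_i ((LM i).1 + (LM i).2).
have p0 i : 0 <= (LM i).1 + (LM i).2.
  by have [h1 h2 _ _] := hLM i; rewrite addr_ge0 // ltW.
have cge i : (LM i).1 + (LM i).2 <= c.
  by rewrite /c (bigD1 i) //= lerDl sumr_ge0.
exists c; first exact: sumr_ge0.
split=> [i t1 t2 th|i t th]; have [h1 h2 h3 h4] := hLM i; have := cge i.
  move=> hc; apply: le_trans (h3 _ _ _) _; rewrite ler_wpM2r //; lra.
by move=> hc; have := h4 t th; lra.
Qed.

Lemma uniform_bounds (rho : R) : exists2 c, 1 <= c &
  [/\ T <= c,
      [/\ forall i, lipschitz_on (b i) rho c,
          forall i t x (z : V), cube rho x -> `|z *m 'J (b i t) x| <= c * `|z|
        & forall j k : 'I_m, lipschitz_on (lie (bu b j) (bu b k)) rho c],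
      forall i t1 t2 th, `|u i t1 th - u i t2 th| <= c * `|t1 - t2|
    & forall i t th, `|u i t th| <= c].
Proof.
have [c1 c11 [h1 h2 h3]] := field_bounds hA1 hA2 rho.
have [c2 c20 [h4 h5]] := input_bounds.
have T0 := ltW hT.
have k1 : c1 <= c1 + c2 + T by lra.
have k2 : c2 <= c1 + c2 + T by lra.
exists (c1 + c2 + T); first by lra.
split; first by lra.
- split=> [i|i t x z hx|j k]; [exact: lipschitz_onW (h1 i)| |exact: lipschitz_onW (h3 j k)].
  by apply: le_trans (h2 i t x z hx) _; rewrite ler_wpM2r.
- by move=> i t1 t2 th; apply: le_trans (h4 _ _ _ _) _; rewrite ler_wpM2r.
- by move=> i t th; apply: le_trans (h5 _ _ _) _.
Qed.

Let u_meas i : lebesgue_measurable_fun2 (fun p => u i p.1 p.2). Proof. by have [] := hA3 i. Qed.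

Lemma input_affine_approximates :
  approximates (input_affine b u) (lie_bracket_system b u T).
Proof.
move=> rho tau eta rho0 tau0 eta0.
have [c c1 [Tc [h1 h2 h3] h4 h5]] := uniform_bounds rho.
have [h h0 tk] := tracking c1 hT Tc hA1 h1 h2 h3 u_meas h4 h5 hA4 tau0 eta0.
exists (h^-1 ^+ 2); first by rewrite exprn_gt0 ?invr_gt0.
move=> w ww t0 t1 z0 z x t1t zsol zr tr xz.
have w0 : 0 < w by apply: lt_trans ww; rewrite exprn_gt0 ?invr_gt0.
have wh : (Num.sqrt w)^-1 <= h.
  rewrite -[leRHS]invrK lef_pV2 ?posrE ?invr_gt0 ?sqrtr_gt0 //.
  have hi : 0 <= h^-1 by rewrite invr_ge0 ltW.
  by rewrite -(ger0_norm hi) -sqrtr_sqr ler_wsqrtr // ltW.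
move=> t ht; have /andP[t0t tt1] := ht.
have inf q : t0 <= q -> q \in Interval (BLeft t0) (+oo%O : itv_bound R).
  by move=> hq; rewrite itv_boundlr bnd_simp hq.
have xz0 : x t0 = z t0 by rewrite xz (solution_start zsol (inf t0 (lexx _))).
apply: (tk w w0 wh t0 t1 z x t1t zr _ tr xz0 t ht) => p q k1 k2 k3.
exact: (solution_increment zsol (inf q (le_trans k1 k2)) k1 k2).
Qed.

Lemma input_affine_has_trajectories : has_trajectories (input_affine b u).
Proof.
move=> rho rho0; exists 1 => // w w1 t0 x0.
have [c c1 [Tc [h1 h2 h3] h4 h5]] := uniform_bounds rho.
have r1 : 1 <= Num.sqrt w by rewrite -sqrtr1 ler_wsqrtr // ltW.
have [x [xt0 [A A0 lx] ix]] := clipped_solution c1 h1 u_meas h4 h5 t0 x0 rho0 r1.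
exists x => [t1|]; first exact: clipped_trajectory A0 lx ix.
split=> // xc; apply: (lipschitz_solution A0 xt0 lx) => t t0t.
have [_ it] := clipped_trajectory t A0 lx ix.
by apply: it => // ta /andP[h _]; exact: xc.
Qed.

End Averaging.

Theorem theorem3 (R : realType) (n m : nat)
  (b : 'I_m.+1 -> R -> 'rV[R]_n -> 'rV[R]_n) (u : 'I_m -> R -> R -> R) (T : R)
  (S : set 'rV[R]_n)
  (hA1 : assumption_A1 b) (hA2 : assumption_A2 b) (hA3 : assumption_A3 u)
  (hT : 0 < T) (hA4 : assumption_A4 u T)
  (hS : compact S)
  (hLB : globally_unif_asympt_stable (lie_bracket_system b u T) S) :
  semiglobally_pract_unif_asympt_stable (input_affine b u) S.
Proof.
have [M M0 hM] := Unbhd_bounded hS.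
apply: practical_stability M0 hM _ _ hLB.
  exact: input_affine_approximates.
exact: input_affine_has_trajectories.
Qed.
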